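(* Let $0<\varepsilon\ll1$ and suppose that: (a) the initial velocity $\dot x(0)$ of the charged-particle system is bounded independently of $\varepsilon$ and $h$; (b) the exact solution $x(t)$ stays in an $\varepsilon$-independent compact set $K$ for $0\le t\le T$; (c) for some $N\ge1$ the following nonresonance conditions hold: $$\Big|\sin\Big(\frac{kh}{2\varepsilon}\Big)\Big|\ge c_0>0,\qquad \Big|\cos\Big(\frac{kh}{2\varepsilon}\Big)\Big|\ge c_0>0,\qquad k=1,2,\dots,N,$$ where $c_0$ is a positive constant. When the filtered two-step variational integrator FVI with stepsize $h$ is applied to the system, there exist positive constants $C^*$ and $c^*$ such that the global errors in the position $x$ and the parallel velocity $v_\parallel=P_\parallel v$ at time $t_{n+1/2}=(n+1/2)h\le T$ satisfy $$|x_{n+1/2}-x(t_{n+1/2})|\le Ch^2,\quad |v_\parallel^{n+1/2}-v_\parallel(t_{n+1/2})|\le Ch^2\quad\text{provided that } h^2>C^*\varepsilon,$$ $$|x_{n+1/2}-x(t_{n+1/2})|\le C\varepsilon,\quad |v_\parallel^{n+1/2}-v_\parallel(t_{n+1/2})|\le C\varepsilon\quad\text{provided that } c^*\varepsilon^2\le h^2\le C^*\varepsilon.$$ Moreover, for $t_{n+1}=(n+1)h\le T$, $$|x_n-x(t_n)|\le Ch^2,\quad |v_\parallel^{n}-v_\parallel(t_n)|\le Ch^2\quad\text{provided that } h^2>C^*\varepsilon,$$ $$|x_n-x(t_n)|\le C\varepsilon,\quad |v_\parallel^{n}-v_\parallel(t_n)|\le C\varepsilon\quad\text{provided that } c^*\varepsilon^2\le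 h^2\le C^*\varepsilon.$$ The constant $C$ is independent of $\varepsilon$, $h$ and $n$, but depends on $T$, the velocity bound, the constants $c_0,c^*,C^*$, and the bounds of the derivatives of $B_1$ and $F$ on the compact set $K$.
   Context: System: $\ddot x(t)=\dot x(t)\times B(x(t))+F(x(t))$, $t\in[0,T]$, $x(t)\in\mathbb{R}^3$, $v:=\dot x$, with $B(x)=\tfrac1\varepsilon B_0+B_1(x)$, where $B_0\in\mathbb{R}^3$ is a fixed vector with $|B_0|=1$ ($|\cdot|$ is the Euclidean norm), $B_1:\mathbb{R}^3\to\mathbb{R}^3$ is a non-constant magnetic field with known vector potential $A_1$, and $F:\mathbb{R}^3\to\mathbb{R}^3$; $B_1$ and $F$ are smooth and uniformly bounded with respect to $\varepsilon$. The full vector potential is $A(x)=-\tfrac12 x\times\tfrac{B_0}{\varepsilon}+A_1(x)$, so $B=\nabla_x\times A$. $A'(x)=(\partial_jA_i(x))_{i,j=1}^3$ is the Jacobian. The initial data satisfy $|x(0)|\le\hat C$, $|\dot x(0)|\le\hat C$ with $\hat C$ independent of $\varepsilon$. Parallel velocity: $P_\parallel w=\frac{B_0}{|B_0|}\big(\frac{B_0}{|B_0|}\cdot w\big)$; $v_\parallel(t)=P_\parallel v(t)$, $v_\parallel^n=P_\parallel v_n$, $v_\parallel^{n+1/2}=P_\parallel v_{n+1/2}$. Filters: $\tilde B_0$ is the skew-symmetric matrix with $-\tilde B_0v=v\times B_0$ for all $v\in\mathbb{R}^3$; $\operatorname{tanc}(\zeta)=\tan(\zeta)/\zeta$, $\operatorname{sinc}(\zeta)=\sin(\zeta)/\zeta$;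 $$\Psi=I+\big(1-\operatorname{tanc}(\tfrac h{2\varepsilon})\big)\tilde B_0^2,\qquad \Phi=I+\big(1-\operatorname{sinc}(\tfrac h{2\varepsilon})^{-1}\big)\tilde B_0^2 .$$ Method FVI: $t_n=nh$, $x_0=x(0)$, $v_0=\dot x(0)$, $x_{n\pm1/2}:=(x_n+x_{n\pm1})/2$, and for $n\ge1$ $$x_{n+1}-2x_n+x_{n-1}=\Psi\Big(\tfrac h2A'(x_{n+1/2})^{\intercal}(x_{n+1}-x_n)+\tfrac h2A'(x_{n-1/2})^{\intercal}(x_n-x_{n-1})-h\big(A(x_{n+1/2})-A(x_{n-1/2})\big)+\tfrac{h^2}2\big(F(x_{n+1/2})+F(x_{n-1/2})\big)\Big).$$ The starting value $x_1$ is defined by $x_1=x_0+h\Psi\big(p_0+\tfrac12A'(x_{1/2})^{\intercal}(x_1-x_0)-A(x_{1/2})+\tfrac h2F(x_{1/2})\big)$ with $p_0=v_0+A(x_0)$ and $x_{1/2}=(x_0+x_1)/2$. The velocities are defined for $n\ge0$ by $v_{n+1/2}:=\dfrac{v_{n+1}+v_n}{2}=\Phi\,\dfrac{x_{n+1}-x_n}{h}$.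
   Formalization: The numerical solution is taken on the branch with |x_{k+1}-x_k| ≤ ρ (ρ>0 arbitrary, independent of ε, h, n), since spurious solutions of the implicit equations violate the bounds, and C depends on ρ and on derivative bounds of A_1, B_1, F on the ρ-neighbourhood of K. *)

(* Defs.v *)
From HB Require Import structures.
From mathcomp Require Import all_boot all_order all_algebra ring.
From mathcomp Require Import all_classical all_reals all_analysis.

Set Implicit Arguments.
Unset Strict Implicit.
Unset Printing Implicit Defensive.

Import Order.TTheory GRing.Theory Num.Theory.
Import numFieldNormedType.Exports.

Local Open Scope classical_set_scope.
Local Open Scope ring_scope.

Section Vectors.
Variable R : realType.
Local Notation V := 'cV[R]_3.

Definition dotv (u w : V) : R := \sum_i u i 0 * w i 0.

(* The library norm `|_| on matrices is the maximum norm. *)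
Definition enorm (u : V) : R := Num.sqrt (dotv u u).

(* Indices in 'I_3 are added modulo 3. *)
Definition cross (u w : V) : V :=
  \col_(i < 3) (u (i + 1) 0 * w (i + 2) 0 - u (i + 2) 0 * w (i + 1) 0).

Definition partial (j : 'I_3) (f : V -> V) : V -> V :=
  fun x => 'D_(delta_mx j 0) f x.

Definition partials (s : seq 'I_3) (f : V -> V) : V -> V := foldr partial f s.

Definition smooth (f : V -> V) : Prop :=
  forall (s : seq 'I_3) (x : V), differentiable (partials s f) x.

Definition derivs_bounded_on (D : set V) (L : nat -> R) (f : V -> V) : Prop :=
  forall (s : seq 'I_3) (x : V), D x -> enorm (partials s f x) <= L (size s).

(* Entry (i, j) is the j-th partial derivative of the i-th component; the
   library's 'J is for row vectors and is the transpose of this matrix. *)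
Definition jac (f : V -> V) (x : V) : 'M[R]_3 :=
  \matrix_(i, j) partial j f x i 0.

Definition curl (f : V -> V) (x : V) : V :=
  \col_(i < 3) (jac f x (i + 2) (i + 1) - jac f x (i + 1) (i + 2)).

(* The numerical solution evaluates the fields at points close to K, such as
   midpoints of chords, that need not belong to K; uniform derivative bounds
   are therefore taken on a neighbourhood of K of fixed positive radius. *)
Definition closed_nbhd (K : set V) (rho : R) : set V :=
  [set y | exists2 x, K x & enorm (y - x) <= rho].

Definition mid (u w : V) : V := 2^-1 *: (u + w).

End Vectors.

Section ChargedParticle.
Variable R : realType.
Local Notation V := 'cV[R]_3.
Variables (eps : R) (B0 : V).

Definition magnetic_field (B1 : V -> V) (x : V) : V := eps^-1 *: B0 + B1 x.

Definition vector_potential (A1 : V -> V) (x : V) : V :=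
  - (2^-1 *: cross x (eps^-1 *: B0)) + A1 x.

(* x is C^1 on [0, T] with x' = v; at the end points the derivatives are
   one-sided, so the equations are imposed on ]0, T[ and x, v are required to
   be continuous on [0, T]. *)
Definition is_solution (B1 F : V -> V) (T : R) (x v : R -> V) : Prop :=
  [/\ {within `[0, T], continuous x},
      {within `[0, T], continuous v},
      (forall t, 0 < t < T -> is_derive t 1 x (v t)) &
      (forall t, 0 < t < T ->
         is_derive t 1 v (cross (v t) (magnetic_field B1 (x t)) + F (x t)))].

Definition Ppar (w : V) : V :=
  ((enorm B0)^-1 * dotv ((enorm B0)^-1 *: B0) w) *: B0.

Definition tB0 : 'M[R]_3 := \matrix_(i, j) - cross (delta_mx j 0) B0 i 0.

Lemma tB0E (w : V) : - (tB0 *m w) = cross w B0.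
Proof.
have [g gE] : exists g : V -> nat -> R, forall (u : V) (i : 'I_3), u i 0 = g u i.
  by exists (fun u n => u (inord n) 0) => u i; rewrite inord_val.
apply/matrixP => i j; rewrite (ord1 j) !mxE.
by case: i => [[|[|[|//]]] p];
  rewrite !big_ord_recr big_ord0 /= !mxE !(gE w, gE B0) /=; ring.
Qed.

Definition tanc (z : R) : R := tan z / z.
Definition sinc (z : R) : R := sin z / z.

Definition Psi (h : R) : 'M[R]_3 :=
  1%:M + (1 - tanc (h / (2 * eps))) *: (tB0 *m tB0).

Definition Phi (h : R) : 'M[R]_3 :=
  1%:M + (1 - (sinc (h / (2 * eps)))^-1) *: (tB0 *m tB0).

Definition nonresonant (h c0 : R) (N : nat) : Prop :=
  forall k : nat, (1 <= k <= N)%N ->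
    c0 <= `|sin (k%:R * h / (2 * eps))| /\
    c0 <= `|cos (k%:R * h / (2 * eps))|.

Section FVI.
Variables (A1 F : V -> V) (h : R).
Let A := vector_potential A1.

Definition fvi_start (x0 v0 x1 : V) : Prop :=
  let p0 := v0 + A x0 in
  x1 = x0 + h *: (Psi h *m
    (p0 + 2^-1 *: ((jac A (mid x0 x1))^T *m (x1 - x0)) - A (mid x0 x1)
     + (h / 2) *: F (mid x0 x1))).

(* (xm, x, xp) stands for (x_(n-1), x_n, x_(n+1)). *)
Definition fvi_step (xm x xp : V) : Prop :=
  xp - 2 *: x + xm = Psi h *m
    ((h / 2) *: ((jac A (mid x xp))^T *m (xp - x))
     + (h / 2) *: ((jac A (mid x xm))^T *m (x - xm))
     - h *: (A (mid x xp) - A (mid x xm))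
     + (h ^+ 2 / 2) *: (F (mid x xp) + F (mid x xm))).

(* The terms of xs and vs of index at most n.+1 are computed by FVI. *)
Definition is_fvi (x0 v0 : V) (n : nat) (xs vs : nat -> V) : Prop :=
  [/\ xs 0%N = x0 /\ vs 0%N = v0,
      fvi_start x0 v0 (xs 1%N),
      (forall k, (1 <= k <= n)%N -> fvi_step (xs k.-1) (xs k) (xs k.+1)) &
      (forall k, (k <= n)%N ->
         mid (vs k) (vs k.+1) = Phi h *m (h^-1 *: (xs k.+1 - xs k)))].

(* The implicit equations may have further solutions that leave every bounded
   set as h tends to 0 (with a force cubic in x, for instance, one of them is
   of size 1/h).  This selects the computed branch, where one step moves the
   particle by at most rho, for a fixed but arbitrary rho. *)
Definition step_within (rho : R) (n : nat) (xs : nat -> V) : Prop :=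
  forall k, (k <= n)%N -> enorm (xs k.+1 - xs k) <= rho.

End FVI.
End ChargedParticle.

(* Main.v *)
Require Import Defs.
From HB Require Import structures.
From mathcomp Require Import all_boot all_order all_algebra ring lra.
From mathcomp Require Import all_classical all_reals all_analysis.

Set Implicit Arguments.
Unset Strict Implicit.
Unset Printing Implicit Defensive.

Import Order.TTheory GRing.Theory Num.Theory.
Import numFieldNormedType.Exports.

Local Open Scope classical_set_scope.
Local Open Scope ring_scope.

(** Both solutions are compared through slow variables, on which the strong
    field acts only by perturbations of size O(eps). Write [b] for the direction
    of the strong field and eta for [eps + h ^+ 2]; all four errors are O(eta),
    which is O(h ^+ 2) or O(eps) according to which term dominates.

    Exact solution. Across [b] the particle gyrates around a guiding centre with
    radius and drift velocity O(eps), so its position is constant there up to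
    O(eps). Along [b], the magnetic force of [B1] only involves the gyrating
    velocity and is, up to O(eps), the derivative of a quantity of size O(eps).
    Subtracting that quantity from the parallel velocity gives a variable [W]
    whose derivative is the parallel component of [F] up to O(eps). Parallel position
    and [W] therefore satisfy the trapezoidal rule with an error O(h * eta) per
    step, although the velocity itself oscillates with frequency 1 / eps
    ([trapezoid], [exact_slow_motion]).

    Numerical solution. With the filter, each increment of the position is across
    [b] the previous one rotated by [h / eps], plus a residual. The rotation
    preserves lengths, and [cos] bounded away from 0 keeps the filter bounded, so
    the increments stay O(eps) across [b] and O(h) along [b] ([speed_bounded]).
    The rotation can also be solved for the sum of two increments: this sum is, up to O(eps * h), a
    difference of consecutive terms of size O(eps) ([perp_sum]). This needs [sin]
    bounded away from 0, and replaces the averaging over the gyration: it shows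
    that the midpoints stay O(eps)-close to the initial position across [b], and
    provides a corrected parallel velocity as for the exact solution. The terms
    of the residual with the vector potential are those of a trapezoidal rule for
    its increment between two midpoints, plus the magnetic force
    ([resid_par_approx]). Hence the midpoints and the corrected velocities satisfy
    at half-integer times the same trapezoidal rule with error O(h * eta)
    ([numeric_slow_motion]).

    Comparison. A discrete Gronwall inequality bounds the difference of the slow
    variables ([err_bound]). Values at integer times are half a step away. The
    velocities [vs] are given by a recursion with growth factor -1, but a suitable
    velocity computed from the positions satisfies the same recursion up to
    summable errors ([par_vs_near]). The estimates also keep the numerical
    solution near [K], where the fields are controlled, which closes an induction
    on the number of steps when [h] is small ([error_small_steps]); when [h] is
    bounded below, the number of steps is bounded ([error_large_steps]). *)

(** * Euclidean vectors in dimension three *)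

Section Euclidean.
Variable R : realType.
Local Notation V := 'cV[R]_3.
Implicit Types (a b u v w : V) (k : R).

Lemma ord3_ind (P : 'I_3 -> Prop) : P 0 -> P 1 -> P 2 -> forall i, P i.
Proof.
move=> P0 P1 P2 [[|[|[|//]]] p].
- by rewrite (_ : Ordinal p = 0) //; exact: val_inj.
- by rewrite (_ : Ordinal p = 1) //; exact: val_inj.
- by rewrite (_ : Ordinal p = 2) //; exact: val_inj.
Qed.

Lemma sum3 (M : zmodType) (f : 'I_3 -> M) : \sum_i f i = f 0 + f 1 + f 2.
Proof.
rewrite !big_ord_recr big_ord0 /= add0r.
by congr (_ + _ + _); congr f; exact: val_inj.
Qed.

Lemma ord3D : (((0 + 1 : 'I_3)%R = 1%R) * ((0 + 2 : 'I_3)%R = 2%R) *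
  ((1 + 1 : 'I_3)%R = 2%R) * ((1 + 2 : 'I_3)%R = 0%R) *
  ((2 + 1 : 'I_3)%R = 0%R) * ((2 + 2 : 'I_3)%R = 1%R))%type.
Proof. by do !split; exact: val_inj. Qed.

Lemma dotvE u w : dotv u w = u 0 0 * w 0 0 + u 1 0 * w 1 0 + u 2 0 * w 2 0.
Proof. by rewrite /dotv sum3. Qed.

Lemma cross0E u w : cross u w 0 0 = u 1 0 * w 2 0 - u 2 0 * w 1 0.
Proof. by rewrite mxE !ord3D. Qed.

Lemma cross1E u w : cross u w 1 0 = u 2 0 * w 0 0 - u 0 0 * w 2 0.
Proof. by rewrite mxE !ord3D. Qed.

Lemma cross2E u w : cross u w 2 0 = u 0 0 * w 1 0 - u 1 0 * w 0 0.
Proof. by rewrite mxE !ord3D. Qed.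

Definition crossE := (cross0E, cross1E, cross2E).

Lemma col3P u w : u 0 0 = w 0 0 -> u 1 0 = w 1 0 -> u 2 0 = w 2 0 -> u = w.
Proof.
by move=> h0 h1 h2; apply/matrixP => i j; rewrite (ord1 j); elim/ord3_ind: i.
Qed.

Lemma dotvC u w : dotv u w = dotv w u.
Proof. by rewrite !dotvE; ring. Qed.

Lemma dotvDl u v w : dotv (u + v) w = dotv u w + dotv v w.
Proof. by rewrite !dotvE !mxE; ring. Qed.

Lemma dotvDr u v w : dotv w (u + v) = dotv w u + dotv w v.
Proof. by rewrite !dotvE !mxE; ring. Qed.

Lemma dotvNl u w : dotv (- u) w = - dotv u w.
Proof. by rewrite !dotvE !mxE; ring. Qed.

Lemma dotvNr u w : dotv w (- u) = - dotv w u.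
Proof. by rewrite !dotvE !mxE; ring. Qed.

Lemma dotvBr u v w : dotv w (u - v) = dotv w u - dotv w v.
Proof. by rewrite dotvDr dotvNr. Qed.

Lemma dotvZl k u w : dotv (k *: u) w = k * dotv u w.
Proof. by rewrite !dotvE !mxE; ring. Qed.

Lemma dotvZr k u w : dotv w (k *: u) = k * dotv w u.
Proof. by rewrite !dotvE !mxE; ring. Qed.

Lemma dotv0r w : dotv w 0 = 0.
Proof. by rewrite !dotvE !mxE; ring. Qed.

Definition dotvS := (dotvDl, dotvDr, dotvNl, dotvNr, dotvZl, dotvZr).

Lemma crossDl u v w : cross (u + v) w = cross u w + cross v w.
Proof. by apply: col3P; rewrite [RHS]mxE !crossE !mxE; ring. Qed.

Lemma crossNl u w : cross (- u) w = - cross u w.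
Proof. by apply: col3P; rewrite [RHS]mxE !crossE !mxE; ring. Qed.

Lemma crossBl u v w : cross (u - v) w = cross u w - cross v w.
Proof. by rewrite crossDl crossNl. Qed.

Lemma crossZl k u w : cross (k *: u) w = k *: cross u w.
Proof. by apply: col3P; rewrite [RHS]mxE !crossE !mxE; ring. Qed.

Lemma crossDr u v w : cross w (u + v) = cross w u + cross w v.
Proof. by apply: col3P; rewrite [RHS]mxE !crossE !mxE; ring. Qed.

Lemma crossNr u w : cross w (- u) = - cross w u.
Proof. by apply: col3P; rewrite [RHS]mxE !crossE !mxE; ring. Qed.

Lemma crossBr u v w : cross w (u - v) = cross w u - cross w v.
Proof. by rewrite crossDr crossNr. Qed.

Lemma crossZr k u w : cross w (k *: u) = k *: cross w u.
Proof. by apply: col3P; rewrite [RHS]mxE !crossE !mxE; ring. Qed.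

Lemma dotv_cross_r u b : dotv b (cross u b) = 0.
Proof. by rewrite dotvE !crossE; ring. Qed.

Lemma dotv_cross_l u b : dotv u (cross u b) = 0.
Proof. by rewrite dotvE !crossE; ring. Qed.

Lemma dotv_ge0 u : 0 <= dotv u u.
Proof. by rewrite dotvE -!expr2; do !apply: addr_ge0; exact: sqr_ge0. Qed.

Lemma enorm_ge0 u : 0 <= enorm u.
Proof. exact: sqrtr_ge0. Qed.

Lemma sqr_enorm u : enorm u ^+ 2 = dotv u u.
Proof. by rewrite sqr_sqrtr // dotv_ge0. Qed.

Lemma enorm_le u k : 0 <= k -> dotv u u <= k ^+ 2 -> enorm u <= k.
Proof.
by move=> k0 uk; rewrite -(ler_pXn2r (n := 2)) ?nnegrE ?enorm_ge0 ?sqr_enorm.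
Qed.

Lemma enorm0 : enorm (0 : V) = 0.
Proof. by rewrite /enorm dotv0r sqrtr0. Qed.

Lemma enormZ k u : enorm (k *: u) = `|k| * enorm u.
Proof. by rewrite /enorm dotvZl dotvZr mulrA -expr2 sqrtrM ?sqr_ge0 // sqrtr_sqr. Qed.

Lemma enormN u : enorm (- u) = enorm u.
Proof. by rewrite -scaleN1r enormZ normrN1 mul1r. Qed.

Lemma enormBC u w : enorm (u - w) = enorm (w - u).
Proof. by rewrite -enormN opprB. Qed.

Lemma dotv_cross_cross u w :
  dotv (cross u w) (cross u w) + dotv u w ^+ 2 = dotv u u * dotv w w.
Proof. by rewrite !dotvE !crossE; ring. Qed.

Lemma normr_dotv u w : `|dotv u w| <= enorm u * enorm w.
Proof.
rewrite -(ler_pXn2r (n := 2)) ?nnegrE ?mulr_ge0 ?enorm_ge0 //.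
rewrite exprMn !sqr_enorm real_normK ?num_real // -dotv_cross_cross.
by rewrite lerDr dotv_ge0.
Qed.

Lemma enorm_cross u w : enorm (cross u w) <= enorm u * enorm w.
Proof.
apply: enorm_le; first by rewrite mulr_ge0 ?enorm_ge0.
by rewrite exprMn !sqr_enorm -dotv_cross_cross lerDl sqr_ge0.
Qed.

Lemma enormD u w : enorm (u + w) <= enorm u + enorm w.
Proof.
apply: enorm_le; first by rewrite addr_ge0 ?enorm_ge0.
have := normr_dotv u w; rewrite ler_norml => /andP[_ uw].
rewrite sqrrD !sqr_enorm !dotvS (dotvC w u).
lra.
Qed.

Lemma enormB u w : enorm (u - w) <= enorm u + enorm w.
Proof. by rewrite -(enormN w) enormD. Qed.

Lemma enormD_le u w (k l : R) : enorm u <= k -> enorm w <= l -> enorm (u + w) <= k + l.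
Proof. by move=> uk wl; apply: le_trans (enormD u w) _; rewrite lerD. Qed.

Lemma enormB_le u w (k l : R) : enorm u <= k -> enorm w <= l -> enorm (u - w) <= k + l.
Proof. by move=> uk wl; apply: le_trans (enormB u w) _; rewrite lerD. Qed.

Lemma enorm_dist u v w : enorm (u - w) <= enorm (u - v) + enorm (v - w).
Proof. by rewrite -(subrKA v) enormD. Qed.

Lemma normr_coord u i : `|u i 0| <= enorm u.
Proof.
rewrite -sqrtr_sqr ler_sqrt ?dotv_ge0 // dotvE -!expr2.
have := (sqr_ge0 (u 0 0), sqr_ge0 (u 1 0), sqr_ge0 (u 2 0)) => -[[h0 h1] h2].
by elim/ord3_ind: i; lra.
Qed.

(** Vector inequalities are reduced to scalar ones by testing against every
    direction; the mean value theorem can then be used. *)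
Lemma enorm_le_dual u k : 0 <= k ->
  (forall c, `|dotv c u| <= k * enorm c) -> enorm u <= k.
Proof.
move=> k0 /(_ u); rewrite ger0_norm ?dotv_ge0 // -sqr_enorm expr2.
have := enorm_ge0 u; rewrite le_eqVlt => /predU1P[<- //|u0].
by rewrite ler_pM2r.
Qed.

Lemma enorm_midl u w : enorm (mid u w - u) = enorm (w - u) / 2.
Proof.
rewrite (_ : mid u w - u = 2^-1 *: (w - u)); last first.
  by apply: col3P; rewrite /mid !mxE; field.
by rewrite enormZ ger0_norm ?invr_ge0 // mulrC.
Qed.

Lemma midC u w : mid u w = mid w u.
Proof. by rewrite /mid addrC. Qed.

Section Direction.
Variable b : V.
Hypothesis b1 : enorm b = 1.

Let bb : dotv b b = 1.
Proof. by rewrite -sqr_enorm b1 expr1n. Qed.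

Definition perp u : V := u - dotv b u *: b.

Lemma perpD u w : perp (u + w) = perp u + perp w.
Proof. by apply: col3P; rewrite /perp !dotvS !mxE; ring. Qed.

Lemma perpZ k u : perp (k *: u) = k *: perp u.
Proof. by apply: col3P; rewrite /perp !dotvS !mxE; ring. Qed.

Lemma perpN u : perp (- u) = - perp u.
Proof. by apply: col3P; rewrite /perp !dotvS !mxE; ring. Qed.

Lemma perpB u w : perp (u - w) = perp u - perp w.
Proof. by rewrite perpD perpN. Qed.

Lemma perp_split u : u = dotv b u *: b + perp u.
Proof. by rewrite /perp addrC subrK. Qed.

Lemma dotv_perp u : dotv b (perp u) = 0.
Proof. by rewrite /perp !dotvS bb; ring. Qed.

Lemma dotv_perp_perp u : dotv (perp u) (perp u) = dotv u u - dotv b u ^+ 2.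
Proof. by rewrite /perp !dotvS bb (dotvC u b); ring. Qed.

Lemma enorm_perp u : enorm (perp u) <= enorm u.
Proof.
by apply: enorm_le (enorm_ge0 _) _; rewrite sqr_enorm dotv_perp_perp gerBl sqr_ge0.
Qed.

Lemma normr_par u : `|dotv b u| <= enorm u.
Proof. by rewrite -[leRHS]mul1r -b1 normr_dotv. Qed.

Lemma enorm_cross1 u : enorm (cross u b) <= enorm u.
Proof. by rewrite -[leRHS]mulr1 -b1 enorm_cross. Qed.

Lemma enorm_par_perp u : enorm u <= `|dotv b u| + enorm (perp u).
Proof.
by rewrite {1}[u]perp_split (le_trans (enormD _ _)) // enormZ b1 mulr1.
Qed.

Lemma crossbb u : cross (cross u b) b = - perp u.
Proof.
have h : perp u = dotv b b *: u - dotv b u *: b by rewrite bb scale1r.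
by rewrite h; apply: col3P; rewrite !crossE !mxE ?crossE !dotvE ?mxE; ring.
Qed.

Lemma cross_perp u : cross (perp u) b = cross u b.
Proof. by apply: col3P; rewrite /perp !crossE !mxE; ring. Qed.

Lemma perp_cross u : perp (cross u b) = cross u b.
Proof. by rewrite /perp dotv_cross_r scale0r subr0. Qed.

Lemma dotv_cross_perp u w : dotv b (cross u w) = dotv b (cross (perp u) w).
Proof. by rewrite /perp !dotvE !crossE !mxE; ring. Qed.

Lemma normr_triple u w : `|dotv b (cross u w)| <= enorm u * enorm w.
Proof. exact: le_trans (normr_par _) (enorm_cross _ _). Qed.

(** In the direction of the strong field a magnetic force only feels the velocity
    orthogonal to that field. Increments of the numerical solution are O(eps) in
    those directions, but only O(h) along [b]. *)
Lemma normr_triple_perp u w : `|dotv b (cross u w)| <= enorm (perp u) * enorm w.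
Proof. by rewrite dotv_cross_perp normr_triple. Qed.

Lemma normr_quadruple u w :
  `|dotv b (cross (cross u b) w)| <= enorm (perp u) * enorm w.
Proof.
rewrite -cross_perp; apply: le_trans (normr_triple _ _) _.
by rewrite ler_wpM2r ?enorm_ge0 // enorm_cross1.
Qed.

Lemma PparE u : Ppar b u = dotv b u *: b.
Proof. by rewrite /Ppar b1 invr1 mul1r scale1r. Qed.

Lemma enorm_Ppar u w : enorm (Ppar b u - Ppar b w) = `|dotv b u - dotv b w|.
Proof. by rewrite !PparE -scalerBl enormZ b1 mulr1. Qed.

Lemma tB0sq u : tB0 b *m tB0 b *m u = - perp u.
Proof.
rewrite -mulmxA; have h w : tB0 b *m w = - cross w b by rewrite -tB0E opprK.
by rewrite !h crossNl opprK crossbb.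
Qed.

(** Both filters act as the identity along [b] and as a scalar across it. *)
Lemma filterE k u :
  (1%:M + (1 - k) *: (tB0 b *m tB0 b)) *m u = dotv b u *: b + k *: perp u.
Proof.
rewrite mulmxDl mul1mx -scalemxAl tB0sq {1}[u]perp_split.
by apply: col3P; rewrite !mxE; ring.
Qed.

End Direction.
End Euclidean.

(** * Derivatives along curves and Taylor estimates *)

Section DerivOn.
Variable R : realType.
Local Notation V := 'cV[R]_3.

Section Generic.
Variables (a b : R) (W : normedModType R).
Implicit Types f g : R -> W.

(** At the end points only continuity is asked for, as for solutions of the
    equations of motion; this is what the mean value theorem needs. *)
Definition deriv_on (f df : R -> W) : Prop :=
  {within `[a, b], continuous f} /\
  forall t, a < t < b -> is_derive t 1 f (df t).

Lemma deriv_on_eq f df dg :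
  (forall t, a < t < b -> df t = dg t) -> deriv_on f df -> deriv_on f dg.
Proof.
move=> e [cf Df]; split=> // t tab; have := Df t tab.
by rewrite e.
Qed.

Lemma deriv_on_cst (w : W) : deriv_on (fun=> w) (fun=> 0).
Proof.
split=> [|t _]; last exact: is_derive_cst.
by apply: continuous_subspaceT => t; exact: cvg_cst.
Qed.

Lemma deriv_onD f df g dg : deriv_on f df -> deriv_on g dg ->
  deriv_on (fun t => f t + g t) (fun t => df t + dg t).
Proof.
move=> [cf Df] [cg Dg]; split=> [t|t tab]; first by apply: cvgD; [exact: cf|exact: cg].
by apply: is_deriveD; [exact: Df|exact: Dg].
Qed.

Lemma deriv_onN f df : deriv_on f df -> deriv_on (fun t => - f t) (fun t => - df t).
Proof.
move=> [cf Df]; split=> [t|t tab]; first by apply: cvgN; exact: cf.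
by apply: is_deriveN; exact: Df.
Qed.

Lemma deriv_onZ (k : R) f df : deriv_on f df ->
  deriv_on (fun t => k *: f t) (fun t => k *: df t).
Proof.
move=> [cf Df]; split=> [t|t tab]; first by apply: cvgZ; [exact: cvg_cst|exact: cf].
by apply: is_deriveZ; exact: Df.
Qed.

End Generic.

Lemma deriv_on_id (a b : R) : deriv_on a b (fun t : R => t : R) (fun=> 1).
Proof.
split=> [|t _]; last exact: is_derive_id.
by apply: continuous_subspaceT => t; exact: cvg_id.
Qed.

Lemma deriv_onM (a b : R) (f df g dg : R -> R) :
  deriv_on a b f df -> deriv_on a b g dg ->
  deriv_on a b (fun t => f t * g t) (fun t => df t * g t + f t * dg t).
Proof.
move=> [cf Df] [cg Dg]; split=> [t|t tab]; first by apply: cvgM; [exact: cf|exact: cg].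
have h1 := Df t tab; have h2 := Dg t tab.
have h3 := is_deriveM h1 h2; apply: is_derive_eq h3 _.
by rewrite addrC [_ *: _ in LHS]mulrC.
Qed.

Lemma deriv_on_sub (W : normedModType R) (a b a' b' : R) (f df : R -> W) :
  a <= a' -> b' <= b -> deriv_on a b f df -> deriv_on a' b' f df.
Proof.
move=> aa bb [cf Df]; split=> [|t /andP[ta tb]]; last first.
  by apply: Df; rewrite (le_lt_trans aa) ?(lt_le_trans tb).
by apply: continuous_subspaceW cf; apply: subset_itvScc; rewrite bnd_simp.
Qed.

Lemma deriv_on_coord (a b : R) (x dx : R -> V) i :
  deriv_on a b x dx -> deriv_on a b (fun t => x t i 0) (fun t => dx t i 0).
Proof.
move=> [cx Dx]; split=> [t|t tab].
  exact: (cvg_comp x (fun M : V => M i 0) (cx t) (@coord_continuous _ _ _ i 0 _)).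
have [dxt <-] := Dx t tab; rewrite derive_mx // mxE.
by apply: DeriveDef => //; exact: (derivable_mxP x t 1).1.
Qed.

Lemma deriv_on_col (a b : R) (x dx : R -> V) :
  (forall i, deriv_on a b (fun t => x t i 0) (fun t => dx t i 0)) ->
  deriv_on a b x dx.
Proof.
move=> h; split=> [t|t tab].
  apply/cvgrPdist_le => /= e e0.
  have h' i := (cvgrPdist_le _ _).1 ((h i).1 t) _ e0.
  near=> s.
  rewrite /Num.Def.normr/= mx_normrE (bigmax_le _ (ltW e0))//= => -[i j] _.
  rewrite !mxE /= (ord1 j).
  by move: i; near: s; apply: filter_forall => i; exact: h'.
have dxt : derivable x t 1.
  by apply/derivable_mxP => i j; rewrite (ord1 j); case: ((h i).2 t tab).
apply: DeriveDef => //; rewrite derive_mx //.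
apply/matrixP => i j; rewrite (ord1 j) mxE.
by have [_] := (h i).2 t tab.
Unshelve. all: by end_near. Qed.

End DerivOn.

Section MeanValue.
Variable R : realType.
Implicit Types a b c : R.

Lemma deriv_on_bound a b (f df : R -> R) (c M : R) : a <= b ->
  deriv_on a b f df -> (forall t, a < t < b -> `|df t - c| <= M) ->
  `|f b - f a - c * (b - a)| <= M * (b - a).
Proof.
move=> ab [cf Df] dfM; move: (ab); rewrite le_eqVlt => /predU1P[ab_eq|ltab].
  by rewrite ab_eq !subrr !mulr0 subrr normr0.
have Df' t : t \in `]a, b[%R -> is_derive t 1 f (df t) by rewrite in_itv; exact: Df.
have [t tab ->] := MVT ltab Df' cf.
rewrite -mulrBl normrM [`|b - a|]ger0_norm ?subr_ge0 //.
by rewrite ler_wpM2r ?subr_ge0 // dfM //; move: tab; rewrite in_itv.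
Qed.

(** The error of the trapezoidal rule, in a form that tolerates a perturbation
    [eta] of the integrand and only asks that its derivative be nearly
    constant: this is what a highly oscillatory integrand still satisfies. *)
Lemma trapezoid a b (G dG g dg : R -> R) (c eta d : R) : a <= b ->
  deriv_on a b G dG -> deriv_on a b g dg ->
  (forall t, a < t < b -> `|dG t - g t| <= eta) ->
  (forall t, a < t < b -> `|dg t - c| <= d) ->
  `|G b - G a - (b - a) / 2 * (g a + g b)| <= (eta + 2 * d * (b - a)) * (b - a).
Proof.
move=> ab DG Dg Gg gc; move: (ab); rewrite le_eqVlt => /predU1P[ab_eq|ltab].
  by rewrite ab_eq !subrr !(mul0r, mulr0) subrr normr0.
have gb : `|g b - g a - c * (b - a)| <= d * (b - a) by exact: deriv_on_bound Dg gc.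
have d0 : 0 <= d.
  have /gc : a < (a + b) / 2 < b by rewrite !midf_lt.
  exact: le_trans.
pose H t := G t - c / 2 * ((t - a) * (t - a)).
have DH : deriv_on a b H (fun t => dG t - c * (t - a)).
  have Dt : deriv_on a b (fun t => t - a) (fun=> 1 + 0).
    by apply: deriv_onD; [exact: deriv_on_id|exact: deriv_on_cst].
  have := deriv_onD DG (deriv_onN
    (deriv_onM (@deriv_on_cst R a b R (c / 2)) (deriv_onM Dt Dt))).
  by apply: deriv_on_eq => t _; field.
have Hab : `|H b - H a - g a * (b - a)| <= (eta + d * (b - a)) * (b - a).
  apply: (deriv_on_bound ab DH) => t /andP[ta tb].
  have gt : `|g t - g a - c * (t - a)| <= d * (t - a).
    apply: deriv_on_bound (ltW ta) (deriv_on_sub (lexx a) (ltW tb) Dg) _.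
    by move=> s /andP[sa sb]; rewrite gc // sa (lt_trans sb).
  have dtb : d * (t - a) <= d * (b - a) by rewrite ler_wpM2l // lerB // ltW.
  have := Gg t; rewrite ta tb => /(_ isT).
  move: gt; rewrite !ler_norml => /andP[? ?] /andP[? ?]; lra.
have gb2 : `|(b - a) / 2 * (g b - g a - c * (b - a))| <= d * (b - a) * (b - a) / 2.
  rewrite normrM ger0_norm ?divr_ge0 ?subr_ge0 //.
  rewrite (_ : d * _ * _ / 2 = (b - a) / 2 * (d * (b - a))); last by field.
  by rewrite ler_wpM2l ?divr_ge0 ?subr_ge0.
have -> : G b - G a - (b - a) / 2 * (g a + g b) = (H b - H a - g a * (b - a)) -
    ((b - a) / 2 * (g b - g a - c * (b - a))) by rewrite /H; field.
apply: le_trans (ler_normB _ _) _.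
have dbb : 0 <= d * (b - a) * (b - a) by rewrite !mulr_ge0 ?subr_ge0.
lra.
Qed.

End MeanValue.

Section Fields.
Variable R : realType.
Local Notation V := 'cV[R]_3.
Implicit Types (f : V -> V) (p q y w : V).

(** The derivative of [f] at [y] in the direction [w], as a combination of
    partial derivatives, which is how bounds on derivatives are given. *)
Definition ddir f y w : V :=
  w 0 0 *: partial 0 f y + w 1 0 *: partial 1 f y + w 2 0 *: partial 2 f y.

Lemma ddirE f y w : differentiable f y -> 'd f y w = ddir f y w.
Proof.
move=> df.
have -> : w = w 0 0 *: delta_mx 0 0 + w 1 0 *: delta_mx 1 0 + w 2 0 *: delta_mx 2 0.
  by apply: col3P; rewrite !mxE /=; ring.
rewrite !linearD !linearZ /= -!deriveE // /ddir /partial.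
by congr (_ *: _ + _ *: _ + _ *: _); rewrite !mxE /=; ring.
Qed.

Lemma deriv_on_comp (a b : R) f (x dx : R -> V) :
  (forall y, differentiable f y) -> deriv_on a b x dx ->
  deriv_on a b (fun t => f (x t)) (fun t => ddir f (x t) (dx t)).
Proof.
move=> df [cx Dx]; split=> [t|t tab].
  exact: (cvg_comp x f (cx t) (differentiable_continuous (df _))).
have [dxt dxE] := Dx t tab.
have dxt' : differentiable x t by apply/derivable1_diffP.
have dfx := @differentiable_comp R R V V x f t dxt' (df _).
apply: DeriveDef; first exact/derivable1_diffP.
by rewrite deriveE // diff_comp //= -(@deriveE R R V x t 1 dxt') dxE ddirE.
Qed.

Lemma ddirD f y v w : ddir f y (v + w) = ddir f y v + ddir f y w.
Proof.
rewrite /ddir; move: (partial 0 f y) (partial 1 f y) (partial 2 f y) => p0 p1 p2.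
by apply: col3P; rewrite !mxE; ring.
Qed.

Lemma ddirZ f y k w : ddir f y (k *: w) = k *: ddir f y w.
Proof.
rewrite /ddir; move: (partial 0 f y) (partial 1 f y) (partial 2 f y) => p0 p1 p2.
by apply: col3P; rewrite !mxE; ring.
Qed.

Lemma comb3B (c : 'I_3 -> R) (u w : 'I_3 -> V) :
  c 0 *: u 0 + c 1 *: u 1 + c 2 *: u 2 - (c 0 *: w 0 + c 1 *: w 1 + c 2 *: w 2) =
  c 0 *: (u 0 - w 0) + c 1 *: (u 1 - w 1) + c 2 *: (u 2 - w 2).
Proof. by apply: col3P; rewrite !mxE; ring. Qed.

Lemma enorm_comb3 (c : 'I_3 -> R) (u : 'I_3 -> V) (m M : R) :
  0 <= M -> (forall j, `|c j| <= m) -> (forall j, enorm (u j) <= M) ->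
  enorm (c 0 *: u 0 + c 1 *: u 1 + c 2 *: u 2) <= 3 * M * m.
Proof.
move=> M0 cm uM.
have h j : enorm (c j *: u j) <= M * m.
  by rewrite enormZ mulrC ler_pM ?enorm_ge0.
have := enormD (c 0 *: u 0 + c 1 *: u 1) (c 2 *: u 2).
have := enormD (c 0 *: u 0) (c 1 *: u 1).
by have := (h 0, h 1, h 2) => -[[? ?] ?]; lra.
Qed.

Lemma enorm_ddir f y w (M : R) : 0 <= M ->
  (forall j, enorm (partial j f y) <= M) -> enorm (ddir f y w) <= 3 * M * enorm w.
Proof.
move=> M0 fM; apply: (enorm_comb3 (c := fun j => w j 0) (u := fun j => partial j f y)) => //.
by move=> j; exact: normr_coord.
Qed.

(** Three derivatives suffice: the third one enters through the error of the
    trapezoidal rule for the vector potential. *)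
Definition smooth_bound (D : set V) (M : R) (k : nat) f : Prop :=
  [/\ smooth f, 0 <= M & forall s y, (size s <= k)%N -> D y ->
    enorm (partials s f y) <= M].

Lemma smooth_partial f j : smooth f -> smooth (partial j f).
Proof.
move=> sf s; rewrite (_ : partials s (partial j f) = partials (rcons s j) f) //.
by rewrite /partials foldr_rcons.
Qed.

Section Bounds.
Variables (D : set V) (M : R).

Lemma smooth_bound_partial k f j :
  smooth_bound D M k.+1 f -> smooth_bound D M k (partial j f).
Proof.
move=> [sf M0 fM]; split=> // [|s y sk Dy]; first exact: smooth_partial.
rewrite (_ : partials s (partial j f) = partials (rcons s j) f).
  by rewrite fM // size_rcons.
by rewrite /partials foldr_rcons.
Qed.

Lemma smooth_boundW k l f : (k <= l)%N -> smooth_bound D M l f -> smooth_bound D M k f.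
Proof.
move=> kl [sf M0 fM]; split=> // s y sk; apply: fM.
exact: leq_trans kl.
Qed.

Lemma smooth_bound0 k f y : smooth_bound D M k f -> D y -> enorm (f y) <= M.
Proof. by move=> [_ _ fM] Dy; exact: (fM [::]). Qed.

Lemma smooth_bound_diff k f y : smooth_bound D M k f -> differentiable f y.
Proof. by move=> [sf _ _]; exact: (sf [::]). Qed.

Lemma smooth_bound_ddir f y w : smooth_bound D M 1 f -> D y ->
  enorm (ddir f y w) <= 3 * M * enorm w.
Proof.
move=> [_ M0 fM] Dy; apply: enorm_ddir => // j.
exact: (fM [:: j]).
Qed.

Definition segment_in p q : Prop := forall t : R, 0 <= t <= 1 -> D (p + t *: (q - p)).

Lemma segment_inr p q : segment_in p q -> D q.
Proof. by move=> /(_ 1); rewrite scale1r addrC subrK; apply; rewrite lexx ler01. Qed.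

Lemma segment_in_subl p q (t : R) : 0 <= t <= 1 -> segment_in p q ->
  segment_in p (p + t *: (q - p)).
Proof.
move=> /andP[t0 t1] h s /andP[s0 s1].
rewrite addrAC subrr add0r scalerA; apply: h.
by rewrite mulr_ge0 //= mulr_ile1.
Qed.

Lemma segment_in_subr p q (t : R) : 0 <= t <= 1 -> segment_in p q ->
  segment_in (p + t *: (q - p)) q.
Proof.
move=> /andP[t0 t1] h s /andP[s0 s1].
have -> : p + t *: (q - p) + s *: (q - (p + t *: (q - p))) =
    p + (t + s * (1 - t)) *: (q - p) by apply: col3P; rewrite !mxE; ring.
apply: h; rewrite addr_ge0 ?mulr_ge0 ?subr_ge0 //=.
have : s * (1 - t) <= 1 - t by rewrite ler_piMl ?subr_ge0.
lra.
Qed.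

Lemma deriv_on_segment p q :
  deriv_on 0 1 (fun t : R => p + t *: (q - p)) (fun=> q - p).
Proof.
apply: deriv_on_col => i.
have := deriv_onD (deriv_on_cst 0 1 (p i 0))
  (deriv_onM (deriv_on_id 0 1) (deriv_on_cst 0 1 ((q - p) i 0))).
have -> : (fun t : R => (p + t *: (q - p)) i 0) = (fun t => p i 0 + t * (q - p) i 0).
  by apply/funext => t; rewrite 2!mxE.
by apply: deriv_on_eq => t _; ring.
Qed.

Lemma deriv_on_dotv (a b : R) c (x dx : R -> V) : deriv_on a b x dx ->
  deriv_on a b (fun t => dotv c (x t)) (fun t => dotv c (dx t)).
Proof.
move=> Dx; have h j := deriv_onM (deriv_on_cst a b (c j 0)) (deriv_on_coord j Dx).
have := deriv_onD (deriv_onD (h 0) (h 1)) (h 2).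
under eq_fun do rewrite -dotvE.
by apply: deriv_on_eq => t _; rewrite dotvE; ring.
Qed.

(** By duality, from the scalar mean value theorem in each direction. *)
Lemma deriv_on_enorm (a b : R) (x dx : R -> V) (w : V) (N : R) : a <= b -> 0 <= N ->
  deriv_on a b x dx -> (forall t, a < t < b -> enorm (dx t - w) <= N) ->
  enorm (x b - x a - (b - a) *: w) <= N * (b - a).
Proof.
move=> ab N0 Dx xN; apply: enorm_le_dual => [|c].
  by rewrite mulr_ge0 ?subr_ge0.
rewrite !dotvBr dotvZr [_ * dotv _ _]mulrC mulrAC.
apply: deriv_on_bound ab (deriv_on_dotv c Dx) _ => t tab.
rewrite -dotvBr (le_trans (normr_dotv _ _)) // mulrC.
by rewrite ler_wpM2r ?enorm_ge0 // xN.
Qed.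

Lemma smooth_bound_lip f p q : smooth_bound D M 1 f -> segment_in p q ->
  enorm (f q - f p) <= 3 * M * enorm (q - p).
Proof.
move=> fM pq; have M0 : 0 <= M by case: fM.
have Df := deriv_on_comp (fun y => smooth_bound_diff y fM) (deriv_on_segment p q).
have := @deriv_on_enorm 0 1 _ _ 0 (3 * M * enorm (q - p)) ler01 _ Df.
rewrite scale1r subrKC scaler0 subr0 scale0r addr0 subr0 mulr1; apply.
  by rewrite !mulr_ge0 ?enorm_ge0.
move=> t /andP[t0 t1]; rewrite subr0; apply: smooth_bound_ddir => //.
by apply: pq; rewrite !ltW.
Qed.

Lemma smooth_bound_lip_ddir f p q w : smooth_bound D M 2 f -> segment_in p q ->
  enorm (ddir f q w - ddir f p w) <= 9 * M * enorm (q - p) * enorm w.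
Proof.
move=> fM pq; have M0 : 0 <= M by case: fM.
rewrite (_ : _ - _ = w 0 0 *: (partial 0 f q - partial 0 f p) +
  w 1 0 *: (partial 1 f q - partial 1 f p) + w 2 0 *: (partial 2 f q - partial 2 f p)).
  have h j : enorm (partial j f q - partial j f p) <= 3 * M * enorm (q - p).
    by apply: smooth_bound_lip => //; exact: smooth_bound_partial.
  have := @enorm_comb3 (fun j => w j 0) (fun j => partial j f q - partial j f p)
    (enorm w) (3 * M * enorm (q - p)) _ (normr_coord w) h.
  rewrite !mulr_ge0 ?enorm_ge0 // => /(_ isT) /le_trans; apply.
  by rewrite le_eqVlt; apply/orP; left; apply/eqP; ring.
rewrite /ddir; move: (partial 0 f p) (partial 1 f p) (partial 2 f p) => p0 p1 p2.
move: (partial 0 f q) (partial 1 f q) (partial 2 f q) => q0 q1 q2.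
by apply: col3P; rewrite !mxE; ring.
Qed.

Lemma smooth_bound_taylor f p q : smooth_bound D M 2 f -> segment_in p q ->
  enorm (f q - f p - ddir f q (q - p)) <= 9 * M * enorm (q - p) ^+ 2.
Proof.
move=> fM pq; have M0 : 0 <= M by case: fM.
have Df := deriv_on_comp (fun y => smooth_bound_diff y fM) (deriv_on_segment p q).
have := @deriv_on_enorm 0 1 _ _ (ddir f q (q - p)) (9 * M * enorm (q - p) ^+ 2) ler01 _ Df.
rewrite scale1r subrKC scale0r addr0 subr0 mulr1 scale1r; apply.
  by rewrite !mulr_ge0 ?exprn_ge0 ?enorm_ge0.
move=> t /andP[t0 t1]; have t01 : 0 <= t <= 1 by rewrite !ltW.
rewrite enormBC (le_trans (smooth_bound_lip_ddir _ fM (segment_in_subr t01 pq))) //.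
rewrite expr2 mulrA ler_wpM2r ?enorm_ge0 // ler_wpM2l ?mulr_ge0 //.
rewrite (_ : _ - _ = (1 - t) *: (q - p)); last by apply: col3P; rewrite !mxE; ring.
by rewrite enormZ ger0_norm ?subr_ge0 ?(ltW t1) // ler_piMl ?enorm_ge0 // gerBl ltW.
Qed.

Lemma smooth_bound_trapezoid f p q c : smooth_bound D M 3 f -> segment_in p q ->
  enorm c = 1 ->
  `|dotv c (f q - f p - 2^-1 *: (ddir f p (q - p) + ddir f q (q - p)))|
    <= 54 * M * enorm (q - p) ^+ 3.
Proof.
move=> fM pq c1; have M0 : 0 <= M by case: fM.
set d := q - p; set X := fun t : R => p + t *: d.
have DX : deriv_on 0 1 X (fun=> d) by exact: deriv_on_segment.
have Df := deriv_on_dotv c (deriv_on_comp (fun y => smooth_bound_diff y fM) DX).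
have pM j : smooth_bound D M 2 (partial j f) by exact: smooth_bound_partial.
have Dp j := deriv_onZ (d j 0)
  (deriv_on_comp (fun y => smooth_bound_diff y (pM j)) DX).
pose dd y := d 0 0 *: ddir (partial 0 f) y d + d 1 0 *: ddir (partial 1 f) y d
  + d 2 0 *: ddir (partial 2 f) y d.
have Dg : deriv_on 0 1 (fun t => dotv c (ddir f (X t) d)) (fun t => dotv c (dd (X t))).
  exact: (deriv_on_dotv c (deriv_onD (deriv_onD (Dp 0) (Dp 1)) (Dp 2))).
have X0 : X 0 = p by rewrite /X scale0r addr0.
have X1 : X 1 = q by rewrite /X scale1r subrKC.
suff /(trapezoid ler01 Df Dg) : forall t, 0 < t < 1 ->
    `|dotv c (dd (X t)) - dotv c (dd p)| <= 27 * M * enorm d ^+ 3.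
  move=> /(_ 0); rewrite X0 X1 subr0 mulr1 mul1r add0r.
  move: (ddir f p d) (ddir f q d) => P Q; rewrite !(dotvDr, dotvNr, dotvZr) mulr1.
  rewrite (_ : 54 * M * _ = 2 * (27 * M * enorm d ^+ 3)); last by ring.
  by apply=> t _; rewrite subrr normr0.
move=> t /andP[t0 t1]; have t01 : 0 <= t <= 1 by rewrite !ltW.
rewrite -dotvBr (le_trans (normr_dotv _ _)) // c1 mul1r.
have pt := segment_in_subl t01 pq.
have h j : enorm (ddir (partial j f) (X t) d - ddir (partial j f) p d)
    <= 9 * M * enorm d ^+ 2.
  rewrite (le_trans (smooth_bound_lip_ddir _ (pM j) pt)) //.
  rewrite expr2 mulrA ler_wpM2r ?enorm_ge0 // ler_wpM2l ?mulr_ge0 //.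
  rewrite addrAC subrr add0r enormZ ger0_norm ?(ltW t0) //.
  by rewrite ler_piMl ?enorm_ge0 // ltW.
have := @enorm_comb3 (fun j => d j 0)
  (fun j => ddir (partial j f) (X t) d - ddir (partial j f) p d)
  (enorm d) (9 * M * enorm d ^+ 2) _ (normr_coord d) h.
rewrite !mulr_ge0 ?exprn_ge0 ?enorm_ge0 // => /(_ isT) h'.
rewrite (_ : 27 * M * _ = 3 * (9 * M * enorm d ^+ 2) * enorm d); last by ring.
have dE := comb3B (fun j => d j 0) (fun j => ddir (partial j f) (X t) d)
  (fun j => ddir (partial j f) p d).
by apply: le_trans h'; rewrite -dE.
Qed.

End Bounds.

(** [K] need not be convex, but balls around its points are. *)
Lemma segment_in_nbhd (K : set V) (rho : R) y p q : K y ->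
  enorm (p - y) <= rho -> enorm (q - y) <= rho -> segment_in (closed_nbhd K rho) p q.
Proof.
move=> Ky py qy t /andP[t0 t1]; exists y => //.
rewrite (_ : _ - y = (1 - t) *: (p - y) + t *: (q - y)); last first.
  by apply: col3P; rewrite !mxE; ring.
rewrite (le_trans (enormD _ _)) // !enormZ !ger0_norm ?subr_ge0 //.
have : (1 - t) * enorm (p - y) <= (1 - t) * rho by rewrite ler_wpM2l ?subr_ge0.
have : t * enorm (q - y) <= t * rho by rewrite ler_wpM2l.
lra.
Qed.

End Fields.

(** * The guiding centre of the exact solution *)

Section DerivOnProducts.
Variables (R : realType) (a b : R).
Local Notation V := 'cV[R]_3.

Lemma deriv_on_cross (x dx y dy : R -> V) :
  deriv_on a b x dx -> deriv_on a b y dy ->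
  deriv_on a b (fun t => cross (x t) (y t))
    (fun t => cross (dx t) (y t) + cross (x t) (dy t)).
Proof.
move=> Dx Dy; apply: deriv_on_col => i.
have h j k := deriv_onM (deriv_on_coord j Dx) (deriv_on_coord k Dy).
have := deriv_onD (h (i + 1) (i + 2)) (deriv_onN (h (i + 2) (i + 1))).
rewrite (_ : (fun t => cross (x t) (y t) i 0) = (fun t => x t (i + 1) 0 * y t (i + 2) 0
  - x t (i + 2) 0 * y t (i + 1) 0)); last by apply/funext => t; rewrite mxE.
by apply: deriv_on_eq => t _; rewrite !mxE; ring.
Qed.

Lemma deriv_on_dot (x dx y dy : R -> V) :
  deriv_on a b x dx -> deriv_on a b y dy ->
  deriv_on a b (fun t => dotv (x t) (y t))
    (fun t => dotv (dx t) (y t) + dotv (x t) (dy t)).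
Proof.
move=> Dx Dy; have h j := deriv_onM (deriv_on_coord j Dx) (deriv_on_coord j Dy).
have := deriv_onD (deriv_onD (h 0) (h 1)) (h 2).
under eq_fun do rewrite -dotvE.
by apply: deriv_on_eq => t _; rewrite !dotvE; ring.
Qed.

End DerivOnProducts.

Section ExactSolution.
Variables (R : realType) (T Chat rho L eps : R).
Local Notation V := 'cV[R]_3.
Variables (K : set V) (b : V) (B1 F : V -> V) (x v : R -> V).
Local Notation D := (closed_nbhd K rho).

Record exact_setting : Prop := ExactSetting {
  exact_T : 0 < T;
  exact_Chat : 0 <= Chat;
  exact_rho : 0 < rho;
  exact_eps : 0 < eps;
  exact_b : enorm b = 1;
  exact_B1 : smooth_bound D L 3 B1;
  exact_F : smooth_bound D L 3 F;
  exact_sol : is_solution eps b B1 F T x v;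
  exact_v0 : enorm (v 0) <= Chat;
  exact_K : forall t, 0 <= t <= T -> K (x t) }.

Hypothesis H : exact_setting.

Let T0 := ltW (exact_T H).
Let e0 := exact_eps H.
Let b1 := exact_b H.
Let L0 : 0 <= L. Proof. by case: (exact_F H). Qed.

Lemma exact_in_nbhd t : 0 <= t <= T -> D (x t).
Proof.
move=> tT; exists (x t); first exact: exact_K tT.
by rewrite subrr enorm0 (ltW (exact_rho H)).
Qed.

Let Ftb t : 0 <= t <= T -> enorm (F (x t)) <= L.
Proof. by move=> tT; exact: smooth_bound0 (exact_F H) (exact_in_nbhd tT). Qed.

Let Btb t : 0 <= t <= T -> enorm (B1 (x t)) <= L.
Proof. by move=> tT; exact: smooth_bound0 (exact_B1 H) (exact_in_nbhd tT). Qed.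

Definition slow_force t : V := cross (v t) (B1 (x t)) + F (x t).

Lemma deriv_on_position : deriv_on 0 T x v.
Proof. by have [? ? ? ?] := exact_sol H. Qed.

Lemma deriv_on_velocity :
  deriv_on 0 T v (fun t => eps^-1 *: cross (v t) b + slow_force t).
Proof.
have [? ? ? Dv] := exact_sol H; split=> // t /Dv.
by rewrite /magnetic_field /slow_force crossDr crossZr addrA.
Qed.

Let subT t s : 0 <= s -> t <= T -> forall r, s < r < t -> 0 <= r <= T.
Proof.
move=> s0 tT r /andP[sr rt].
by rewrite (le_trans s0 (ltW sr)) (le_trans (ltW rt) tT).
Qed.

Definition speed_bound : R := Chat + 2 * L * T.
Local Notation Vb := speed_bound.

(** The magnetic force does no work. *)
Lemma speed_le t : 0 <= t <= T -> enorm (v t) <= Vb.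
Proof.
have DE : deriv_on 0 T (fun t => dotv (v t) (v t)) (fun t => 2 * dotv (v t) (F (x t))).
  have := deriv_on_dot deriv_on_velocity deriv_on_velocity.
  apply: deriv_on_eq => s _; rewrite [dotv (_ + _) _]dotvC.
  by rewrite /slow_force !(dotvDr, dotvZr) !dotv_cross_l; ring.
have [c /[!in_itv]/= cT vc] := EVT_max T0 DE.1.
have [c0 c1] := andP cT.
have vle s : 0 <= s <= T -> enorm (v s) <= enorm (v c).
  by move=> sT; rewrite enorm_le ?enorm_ge0 // sqr_enorm; apply: vc; rewrite in_itv.
move=> tT; apply: le_trans (vle _ tT) _.
have : `|dotv (v c) (v c) - dotv (v 0) (v 0) - 0 * (c - 0)|
    <= 2 * L * enorm (v c) * (c - 0).
  apply: deriv_on_bound c0 (deriv_on_sub (lexx 0) c1 DE) _ => s sc.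
  have sT := subT (lexx 0) c1 sc.
  rewrite subr0 normrM ger0_norm // -mulrA ler_wpM2l // mulrC.
  by rewrite (le_trans (normr_dotv _ _)) // ler_pM ?enorm_ge0 ?vle ?Ftb.
rewrite mul0r !subr0 -!sqr_enorm => /(le_trans (ler_norm _)) h.
have h2 : 2 * L * enorm (v c) * c <= 2 * L * enorm (v c) * T.
  by rewrite ler_wpM2l // !mulr_ge0 ?enorm_ge0.
have h3 : enorm (v 0) ^+ 2 <= Chat ^+ 2.
  by rewrite lerXn2r ?nnegrE ?enorm_ge0 ?(exact_v0 H) // (exact_Chat H).
rewrite leNgt; apply/negP => hlt.
have LT : 0 <= L * T by rewrite mulr_ge0.
have C0 := exact_Chat H.
have h4 : 0 <= (enorm (v c) - Chat) * Chat.
  by rewrite mulr_ge0 // subr_ge0; rewrite /Vb in hlt; lra.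
have h5 : 0 < (enorm (v c) - Vb) * enorm (v c).
  by rewrite mulr_gt0 ?subr_gt0 //; rewrite /Vb in hlt; lra.
rewrite /Vb in h5; nra.
Qed.

Let Vb0 : 0 <= Vb.
Proof. by rewrite addr_ge0 ?(exact_Chat H) // !mulr_ge0. Qed.

Definition force_bound : R := L * (Vb + 1).
Local Notation Gb := force_bound.

Let Gb0 : 0 <= Gb. Proof. exact: mulr_ge0 L0 (addr_ge0 Vb0 ler01). Qed.

Lemma slow_force_le t : 0 <= t <= T -> enorm (slow_force t) <= Gb.
Proof.
move=> tT; rewrite (le_trans (enormD _ _)) // /Gb mulrDr mulr1 lerD ?Ftb //.
by rewrite (le_trans (enorm_cross _ _)) // mulrC ler_pM ?enorm_ge0 ?speed_le ?Btb.
Qed.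

(** The centre of the gyration, seen from which the rotation is removed. *)
Definition guiding_center t : V := x t + eps *: cross (v t) b.

Lemma deriv_on_guiding_center : deriv_on 0 T guiding_center
  (fun t => dotv b (v t) *: b + eps *: cross (slow_force t) b).
Proof.
have := deriv_onD deriv_on_position
  (deriv_onZ eps (deriv_on_cross deriv_on_velocity (deriv_on_cst 0 T b))).
apply: deriv_on_eq => t _.
rewrite (_ : cross (v t) 0 = 0) ?addr0; last by apply: col3P; rewrite !mxE; ring.
rewrite crossDl crossZl crossbb // scalerDr scalerA mulfV ?gt_eqF // scale1r.
by rewrite addrA {1}[v t](perp_split b) addrK.
Qed.

(** Orthogonally to the strong field the guiding centre only drifts with speed
    O(eps), and the gyroradius is O(eps). *)
Lemma exact_perp_le t : 0 <= t <= T ->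
  enorm (perp b (x t) - perp b (x 0)) <= (Gb * T + 2 * Vb) * eps.
Proof.
move=> tT; have [t0 tle] := andP tT.
have Dp : deriv_on 0 T (fun t => perp b (guiding_center t))
    (fun t => eps *: cross (slow_force t) b).
  have Dd := deriv_on_dotv b deriv_on_guiding_center.
  have Db : deriv_on 0 T (fun t => dotv b (guiding_center t) *: b)
      (fun t => dotv b (v t) *: b).
    apply: deriv_on_col => i.
    have := deriv_onM Dd (deriv_on_cst 0 T (b i 0)).
    rewrite (_ : (fun t => _ i 0) = fun t => dotv b (guiding_center t) * b i 0); last first.
      by apply/funext => s; rewrite mxE.
    apply: deriv_on_eq => s _; rewrite dotvDr !dotvZr dotv_cross_r -sqr_enorm b1.
    by rewrite mxE; ring.
  have := deriv_onD deriv_on_guiding_center (deriv_onN Db).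
  by apply: deriv_on_eq => s _; rewrite addrAC subrr add0r.
have hz : enorm (perp b (guiding_center t) - perp b (guiding_center 0)) <= Gb * T * eps.
  have := @deriv_on_enorm _ 0 t _ _ 0 (Gb * eps) t0 _ (deriv_on_sub (lexx 0) tle Dp).
  rewrite scaler0 !subr0 => h; apply: le_trans (h _ _) _.
  - by rewrite mulr_ge0 // ltW.
  - move=> s st; rewrite subr0 enormZ gtr0_norm // mulrC ler_pM2r //.
    by rewrite (le_trans (enorm_cross1 b1 _)) // slow_force_le // (subT _ _ st).
  - by rewrite mulrAC ler_pM2r // ler_wpM2l.
have hg s : 0 <= s <= T -> enorm (eps *: cross (v s) b) <= Vb * eps.
  move=> sT; rewrite enormZ gtr0_norm // mulrC ler_pM2r //.
  by rewrite (le_trans (enorm_cross1 b1 _)) // speed_le.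
have zE s : perp b (guiding_center s) = perp b (x s) + eps *: cross (v s) b.
  by rewrite perpD perpZ perp_cross.
have -> : perp b (x t) - perp b (x 0) = perp b (guiding_center t)
    - perp b (guiding_center 0) - eps *: cross (v t) b + eps *: cross (v 0) b.
  by rewrite !zE; apply: col3P; rewrite !mxE; ring.
have := hg t tT; have := hg 0; rewrite lexx T0 => /(_ isT).
have := enormD (perp b (guiding_center t) - perp b (guiding_center 0)
  - eps *: cross (v t) b) (eps *: cross (v 0) b).
have := enormB (perp b (guiding_center t) - perp b (guiding_center 0))
  (eps *: cross (v t) b).
lra.
Qed.

(** The parallel velocity is driven by the oscillating magnetic force of [B1].
    Since [eps * v'] is [v] crossed with [b] up to O(eps), the added term of size
    O(eps) is an antiderivative of minus that force up to O(eps), and only the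
    force [F] is left in the derivative. *)
Definition par_velocity t : R :=
  dotv b (v t) + eps * dotv b (cross (cross (v t) b) (B1 (x t))).
Local Notation W := par_velocity.

Definition dpar_velocity t : R := dotv b (F (x t)) +
  eps * (dotv b (cross (cross (slow_force t) b) (B1 (x t)))
    + dotv b (cross (cross (v t) b) (ddir B1 (x t) (v t)))).

Lemma deriv_on_par_velocity : deriv_on 0 T W dpar_velocity.
Proof.
have DB := deriv_on_comp (fun y => smooth_bound_diff y (exact_B1 H)) deriv_on_position.
have Dc := deriv_on_cross (deriv_on_cross deriv_on_velocity (deriv_on_cst 0 T b)) DB.
have := deriv_onD (deriv_on_dotv b deriv_on_velocity) (deriv_onZ eps (deriv_on_dotv b Dc)).
apply: deriv_on_eq => t _.
rewrite (_ : cross (v t) 0 = 0) ?addr0; last by apply: col3P; rewrite !mxE; ring.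
rewrite [cross (_ + _) b]crossDl crossZl crossbb // /dpar_velocity.
rewrite [cross (eps^-1 *: _ + _) _]crossDl crossZl crossNl !dotvDr !dotvZr dotvNr.
rewrite dotv_cross_r /GRing.scale /= -dotv_cross_perp.
by field; rewrite gt_eqF.
Qed.

Lemma par_velocity_near t : 0 <= t <= T -> `|W t - dotv b (v t)| <= Vb * L * eps.
Proof.
move=> tT; rewrite addrAC subrr add0r normrM gtr0_norm // mulrC ler_pM2r //.
rewrite (le_trans (normr_quadruple b1 _ _)) // ler_pM ?enorm_ge0 ?Btb //.
by rewrite (le_trans (enorm_perp b1 _)) // speed_le.
Qed.

Definition par_defect : R := Gb * L + 3 * L * Vb ^+ 2.

Let pd0 : 0 <= par_defect.
Proof.
by apply: addr_ge0; [exact: mulr_ge0 Gb0 L0|rewrite !mulr_ge0 ?exprn_ge0 ?Vb0].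
Qed.

Lemma dpar_velocity_near t : 0 <= t <= T ->
  `|dpar_velocity t - dotv b (F (x t))| <= par_defect * eps.
Proof.
move=> tT; rewrite addrAC subrr add0r normrM gtr0_norm // mulrC ler_pM2r //.
rewrite (le_trans (ler_normD _ _)) // lerD //.
  rewrite (le_trans (normr_quadruple b1 _ _)) // ler_pM ?enorm_ge0 ?Btb //.
  by rewrite (le_trans (enorm_perp b1 _)) // slow_force_le.
rewrite (le_trans (normr_quadruple b1 _ _)) //.
rewrite (_ : 3 * L * _ = Vb * (3 * L * Vb)); last by ring.
rewrite ler_pM ?enorm_ge0 //.
  by rewrite (le_trans (enorm_perp b1 _)) // speed_le.
rewrite (le_trans (smooth_bound_ddir _ (smooth_boundW _ (exact_B1 H)) (exact_in_nbhd tT))) //.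
by rewrite ler_wpM2l ?mulr_ge0 // speed_le.
Qed.

Lemma exact_lip s t : 0 <= s -> s <= t -> t <= T -> enorm (x t - x s) <= Vb * (t - s).
Proof.
move=> s0 st tT.
have := @deriv_on_enorm _ s t _ _ 0 Vb st Vb0 (deriv_on_sub s0 tT deriv_on_position).
rewrite scaler0 subr0; apply=> r rst; rewrite subr0 speed_le //.
exact: subT rst.
Qed.

Lemma par_velocity_lip s t : 0 <= s -> s <= t -> t <= T ->
  `|W t - W s| <= (L + par_defect * eps) * (t - s).
Proof.
move=> s0 st tT.
have := deriv_on_bound (c := 0) st (deriv_on_sub s0 tT deriv_on_par_velocity) _.
rewrite mul0r subr0; apply=> r rst; rewrite subr0.
have rT := subT s0 tT rst.
have := dpar_velocity_near rT; have := normr_par b1 (F (x r)).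
have := Ftb rT; have := ler_normD (dpar_velocity r - dotv b (F (x r))) (dotv b (F (x r))).
by rewrite subrK; lra.
Qed.

(** The position is the integral of [W] up to O(eps), and [W] has a nearly
    constant derivative over one step although [v] has not. *)
Lemma exact_par_trapezoid s t : 0 <= s -> s <= t -> t <= T -> Vb * (t - s) <= rho ->
  `|dotv b (x t) - dotv b (x s) - (t - s) / 2 * (W s + W t)|
    <= (Vb * L * eps + 2 * (par_defect * eps + 3 * L * Vb * (t - s)) * (t - s)) * (t - s).
Proof.
move=> s0 st tT str.
have sT : 0 <= s <= T by rewrite s0 (le_trans st).
have DG := deriv_on_sub s0 tT (deriv_on_dotv b deriv_on_position).
have Dg := deriv_on_sub s0 tT deriv_on_par_velocity.
apply: (trapezoid (c := dotv b (F (x s))) st DG Dg).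
  by move=> r rst; rewrite distrC par_velocity_near // (subT s0 tT rst).
move=> r rst; have rT := subT s0 tT rst; have [/ltW sr /ltW rt] := andP rst.
have xr : enorm (x r - x s) <= Vb * (r - s) by rewrite exact_lip // (le_trans rt).
have rsts : Vb * (r - s) <= Vb * (t - s) by rewrite ler_wpM2l // lerD2r.
have seg : segment_in D (x s) (x r).
  apply: (segment_in_nbhd (exact_K H sT)); first by rewrite subrr enorm0 (ltW (exact_rho H)).
  lra.
have h1 := smooth_bound_lip (smooth_boundW (isT : (1 <= 3)%N) (exact_F H)) seg.
have h2 : 3 * L * enorm (x r - x s) <= 3 * L * Vb * (t - s).
  by rewrite -[leRHS]mulrA ler_wpM2l ?mulr_ge0 // (le_trans xr).
have := dpar_velocity_near rT; have := normr_par b1 (F (x r) - F (x s)).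
have := ler_normD (dpar_velocity r - dotv b (F (x r))) (dotv b (F (x r)) - dotv b (F (x s))).
rewrite subrKA dotvBr; lra.
Qed.


Lemma guiding_center_near t : 0 <= t <= T ->
  enorm (guiding_center t - x t) <= Vb * eps.
Proof.
move=> tT; rewrite addrAC subrr add0r enormZ gtr0_norm // mulrC ler_pM2r //.
by rewrite (le_trans (enorm_cross1 b1 _)) // speed_le.
Qed.

Let VG0 : 0 <= Vb + Gb * eps.
Proof. exact: addr_ge0 Vb0 (mulr_ge0 Gb0 (ltW e0)). Qed.

Let LP0 : 0 <= L + par_defect * eps.
Proof. exact: addr_ge0 L0 (mulr_ge0 pd0 (ltW e0)). Qed.

Lemma guiding_center_lip s t : 0 <= s -> s <= t -> t <= T ->
  enorm (guiding_center t - guiding_center s) <= (Vb + Gb * eps) * (t - s).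
Proof.
move=> s0 st tT.
have := deriv_on_enorm (w := 0) (N := Vb + Gb * eps) st _
  (deriv_on_sub s0 tT deriv_on_guiding_center).
rewrite scaler0 subr0; apply=> // r rst; have rT := subT s0 tT rst.
rewrite subr0 (le_trans (enormD _ _)) // !enormZ b1 mulr1 lerD //.
  by rewrite (le_trans (normr_par b1 _)) // speed_le.
rewrite gtr0_norm // mulrC ler_pM2r //.
by rewrite (le_trans (enorm_cross1 b1 _)) // slow_force_le.
Qed.

Definition par_force_slope (d : R) : R :=
  3 * L * (2 * Vb * L * eps + (L + par_defect * eps) * d + Gb * eps) +
  9 * L * (Vb + Gb * eps) * Vb * d.

(** Along [x] itself the parallel force oscillates with frequency of order
    1/eps and amplitude eps, so its derivative is not nearly constant; along the
    guiding centre it is. *)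
Lemma exact_vel_trapezoid_gc s t : 0 <= s -> s <= t -> t <= T ->
  Vb * (t - s) + Vb * eps <= rho ->
  `|W t - W s - (t - s) / 2 *
      (dotv b (F (guiding_center s)) + dotv b (F (guiding_center t)))|
    <= ((par_defect + 3 * L * Vb) * eps + 2 * par_force_slope (t - s) * (t - s)) * (t - s).
Proof.
move=> s0 st tT str.
have sT : 0 <= s <= T by rewrite s0 (le_trans st).
have F1 := smooth_boundW (isT : (1 <= 3)%N) (exact_F H).
have F2 := smooth_boundW (isT : (2 <= 3)%N) (exact_F H).
have DG := deriv_on_sub s0 tT deriv_on_par_velocity.
have Dg := deriv_on_sub s0 tT (deriv_on_dotv b
  (deriv_on_comp (fun y => smooth_bound_diff y F1) deriv_on_guiding_center)).
have near r : 0 <= r <= T -> s <= r -> r <= t ->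
    enorm (x r - x s) <= rho /\ enorm (guiding_center r - x s) <= rho.
  move=> rT sr rt; have [r0 rT'] := andP rT.
  have h1 := exact_lip s0 sr rT'; have h2 := guiding_center_near rT.
  have h3 := enorm_dist (guiding_center r) (x r) (x s).
  have h4 : Vb * (r - s) <= Vb * (t - s) by rewrite ler_wpM2l // lerD2r.
  have h5 : 0 <= Vb * eps by rewrite mulr_ge0 // ltW.
  by split; lra.
apply: (trapezoid (c := dotv b (ddir F (guiding_center s) (dotv b (v s) *: b))) st DG Dg).
  move=> r rst; have rT := subT s0 tT rst; have [/ltW sr /ltW rt] := andP rst.
  have [n1 n2] := near r rT sr rt.
  have h1 := smooth_bound_lip F1 (segment_in_nbhd (exact_K H sT) n2 n1).
  have h2 := guiding_center_near rT; rewrite enormBC in h2.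
  have h3 : 3 * L * enorm (x r - guiding_center r) <= 3 * L * (Vb * eps).
    by rewrite ler_wpM2l ?mulr_ge0.
  have := dpar_velocity_near rT; have := normr_par b1 (F (x r) - F (guiding_center r)).
  have := ler_normD (dpar_velocity r - dotv b (F (x r)))
    (dotv b (F (x r)) - dotv b (F (guiding_center r))).
  by rewrite subrKA dotvBr; lra.
move=> r rst; have rT := subT s0 tT rst; have [/ltW sr /ltW rt] := andP rst.
have [_ n1] := near r rT sr rt; have [_ n2] := near s sT (lexx s) st.
have seg := segment_in_nbhd (exact_K H sT) n2 n1.
have [r0 rT'] := andP rT.
rewrite -dotvBr (le_trans (normr_par b1 _)) //.
set dz := (X in ddir F (guiding_center r) X); set dz0 := dotv b (v s) *: b.
have -> : ddir F (guiding_center r) dz - ddir F (guiding_center s) dz0 =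
  ddir F (guiding_center r) (dz - dz0) +
  (ddir F (guiding_center r) dz0 - ddir F (guiding_center s) dz0).
  by rewrite addrA -ddirD subrK.
rewrite (le_trans (enormD _ _)) // lerD //.
  rewrite (le_trans (smooth_bound_ddir _ F1 (segment_inr seg))) // ler_wpM2l ?mulr_ge0 //.
  have -> : dz - dz0 = (dotv b (v r) - dotv b (v s)) *: b
      + eps *: cross (slow_force r) b by rewrite /dz /dz0 addrAC -scalerBl.
  rewrite (le_trans (enormD _ _)) // !enormZ b1 mulr1 lerD //.
    have := par_velocity_near sT; have := par_velocity_near rT.
    have := par_velocity_lip s0 sr rT'.
    have : (L + par_defect * eps) * (r - s) <= (L + par_defect * eps) * (t - s).
      by rewrite ler_wpM2l ?lerD2r.
    rewrite !ler_norml => ? /andP[? ?] /andP[? ?] /andP[? ?]; apply/andP; split; lra.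
  rewrite gtr0_norm // mulrC ler_pM2r //.
  by rewrite (le_trans (enorm_cross1 b1 _)) // slow_force_le.
rewrite (le_trans (smooth_bound_lip_ddir _ F2 seg)) //.
have dz0V : enorm dz0 <= Vb.
  by rewrite enormZ b1 mulr1 (le_trans (normr_par b1 _)) // speed_le.
have zz : enorm (guiding_center r - guiding_center s) <= (Vb + Gb * eps) * (t - s).
  apply: le_trans (guiding_center_lip s0 sr rT') _.
  by rewrite ler_wpM2l ?lerD2r.
rewrite (_ : 9 * L * (Vb + Gb * eps) * Vb * (t - s) =
  9 * L * ((Vb + Gb * eps) * (t - s)) * Vb); last by ring.
rewrite ler_pM ?enorm_ge0 ?mulr_ge0 ?enorm_ge0 //.
by rewrite ler_wpM2l ?mulr_ge0.
Qed.

Lemma exact_vel_trapezoid s t : 0 <= s -> s <= t -> t <= T ->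
  Vb * (t - s) + Vb * eps <= rho ->
  `|W t - W s - (t - s) / 2 * (dotv b (F (x s)) + dotv b (F (x t)))|
    <= ((par_defect + 6 * L * Vb) * eps + 2 * par_force_slope (t - s) * (t - s)) * (t - s).
Proof.
move=> s0 st tT str.
have F1 := smooth_boundW (isT : (1 <= 3)%N) (exact_F H).
have near r : 0 <= r <= T ->
    `|dotv b (F (x r)) - dotv b (F (guiding_center r))| <= 3 * L * Vb * eps.
  move=> rT; rewrite -dotvBr (le_trans (normr_par b1 _)) // -mulrA.
  have h2 := guiding_center_near rT.
  have xx : enorm (x r - x r) <= rho by rewrite subrr enorm0 ltW // exact_rho.
  have zx : enorm (guiding_center r - x r) <= rho.
    by rewrite (le_trans h2) // (le_trans _ str) // lerDr mulr_ge0 // subr_ge0.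
  rewrite (le_trans (smooth_bound_lip F1 (segment_in_nbhd (exact_K H rT) zx xx))) //.
  by rewrite enormBC ler_wpM2l ?mulr_ge0.
have ts0 : 0 <= (t - s) / 2 by rewrite divr_ge0 ?subr_ge0.
have sT : 0 <= s <= T by rewrite s0 (le_trans st).
have tT' : 0 <= t <= T by rewrite (le_trans s0 st).
set q := dotv b (F (x s)) + dotv b (F (x t)).
set q' := dotv b (F (guiding_center s)) + dotv b (F (guiding_center t)).
have qq : `|(t - s) / 2 * (q' - q)| <= (t - s) / 2 * (6 * L * Vb * eps).
  rewrite normrM ger0_norm // ler_wpM2l //.
  have := near s sT; have := near t tT'; rewrite /q /q' !ler_norml.
  by move=> /andP[? ?] /andP[? ?]; apply/andP; split; lra.
have h := exact_vel_trapezoid_gc s0 st tT str; rewrite -/q' in h.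
have -> : W t - W s - (t - s) / 2 * q = W t - W s - (t - s) / 2 * q' +
  (t - s) / 2 * (q' - q) by ring.
apply: le_trans (ler_normD _ _) _; lra.
Qed.

End ExactSolution.

(** What the comparison with the numerical solution needs to know of the exact
    one: the slow variables are [dotv b x] and [W], and they satisfy the
    trapezoidal rule up to an error of the size that is claimed. *)
Record slow_motion (R : realType) (T rho eps C : R) (b : 'cV[R]_3)
    (F : 'cV[R]_3 -> 'cV[R]_3) (x v : R -> 'cV[R]_3) (W : R -> R) : Prop := SlowMotion {
  slow_perp : forall t, 0 <= t <= T -> enorm (perp b (x t) - perp b (x 0)) <= C * eps;
  slow_near : forall t, 0 <= t <= T -> `|W t - dotv b (v t)| <= C * eps;
  slow_lip : forall s t, 0 <= s -> s <= t -> t <= T -> enorm (x t - x s) <= C * (t - s);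
  slow_par : forall s t, 0 <= s -> s <= t -> t <= T -> t - s <= 1 ->
    C * (t - s + eps) <= rho ->
    `|dotv b (x t) - dotv b (x s) - (t - s) / 2 * (W s + W t)|
      <= C * (eps + (t - s) ^+ 2) * (t - s);
  slow_vel : forall s t, 0 <= s -> s <= t -> t <= T -> t - s <= 1 ->
    C * (t - s + eps) <= rho ->
    `|W t - W s - (t - s) / 2 * (dotv b (F (x s)) + dotv b (F (x t)))|
      <= C * (eps + (t - s) ^+ 2) * (t - s) }.

Lemma exact_slow_motion (R : realType) (T Chat rho L : R) : 0 < T -> 0 <= Chat -> 0 <= L ->
  exists2 C : R, 0 < C & forall eps K b B1 F x v,
    exact_setting T Chat rho L eps K b B1 F x v -> eps <= 1 ->
    slow_motion T rho eps C b F x v (par_velocity eps b B1 x v).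
Proof.
move=> T0 Ch0 L0.
pose V := speed_bound T Chat L; pose G := force_bound T Chat L.
pose P := par_defect T Chat L.
have V0 : 0 <= V by rewrite addr_ge0 // !mulr_ge0 // ltW.
have G0 : 0 <= G by rewrite mulr_ge0 // addr_ge0.
have P0 : 0 <= P.
  apply: addr_ge0; first exact: mulr_ge0 G0 L0.
  by apply: mulr_ge0; rewrite ?mulr_ge0 ?exprn_ge0.
have T1 := ltW T0.
pose C1 := V * L + 2 * P + 6 * L * V.
pose C2 := P + 6 * L * V + 2 * (6 * L * V * L + 3 * L * (L + P) + 3 * L * G
  + 9 * L * (V + G) * V).
pose C := 1 + V + (G * T + 2 * V) + V * L + C1 + C2.
have C10 : 0 <= C1 by rewrite !addr_ge0 ?mulr_ge0.
have C20 : 0 <= C2 by rewrite !(addr_ge0, mulr_ge0).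
have GT0 : 0 <= G * T by rewrite mulr_ge0.
have VL0 : 0 <= V * L by rewrite mulr_ge0.
have C0 : 0 < C by rewrite /C; lra.
have VC : V <= C by rewrite /C; lra.
have GTC : G * T + 2 * V <= C by rewrite /C; lra.
have VLC : V * L <= C by rewrite /C; lra.
have C1C : C1 <= C by rewrite /C; lra.
have C2C : C2 <= C by rewrite /C; lra.
have [EV [EG EP]] : speed_bound T Chat L = V /\ force_bound T Chat L = G /\
  par_defect T Chat L = P by [].
clearbody V G P.
exists C => // eps K b B1 F x v H e1.
have e0 := exact_eps H; have e0' := ltW e0.
have small (s t : R) : s <= t -> C * (t - s + eps) <= rho -> V * (t - s) + V * eps <= rho.
  move=> st; apply: le_trans; have ts : 0 <= t - s by rewrite subr_ge0.
  by rewrite -mulrDr ler_wpM2r // addr_ge0.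
split=> [t tT|t tT|s t s0 st tT|s t s0 st tT st1 str|s t s0 st tT st1 str].
- apply: le_trans (exact_perp_le H tT) _; by rewrite ler_pM2r // ?EV ?EG.
- apply: le_trans (par_velocity_near H tT) _; by rewrite ler_pM2r // ?EV ?EG.
- apply: le_trans (exact_lip H s0 st tT) _.
  by rewrite ler_wpM2r ?subr_ge0 // EV.
- have smalls := small _ _ st str.
  have d0 : 0 <= t - s by rewrite subr_ge0.
  apply: le_trans (exact_par_trapezoid H s0 st tT _) _.
    by apply: le_trans smalls; rewrite EV lerDl mulr_ge0.
  rewrite ler_wpM2r // EV EP; move: (t - s) d0 st1 => d d0 d1.
  have e_d : eps * d <= eps by rewrite ler_piMr.
  have dd : 0 <= d ^+ 2 by rewrite exprn_ge0.
  have h1 : V * L * eps <= V * L * (eps + d ^+ 2) by rewrite ler_wpM2l // lerDl.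
  have h2 : P * (eps * d) <= P * (eps + d ^+ 2) by rewrite ler_wpM2l //; lra.
  have h3 : L * V * d ^+ 2 <= L * V * (eps + d ^+ 2) by rewrite ler_wpM2l ?mulr_ge0 // lerDr.
  apply: (@le_trans _ _ (C1 * (eps + d ^+ 2))).
    by rewrite /C1; lra.
  by rewrite ler_wpM2r ?addr_ge0.
have smalls := small _ _ st str.
have d0 : 0 <= t - s by rewrite subr_ge0.
rewrite -EV in smalls; apply: le_trans (exact_vel_trapezoid H s0 st tT smalls) _.
rewrite ler_wpM2r // /par_force_slope EV EP EG.
move: (t - s) d0 st1 => d d0 d1.
have e_d : eps * d <= eps by rewrite ler_piMr.
have dd : 0 <= d ^+ 2 by rewrite exprn_ge0.
have edd : eps * d ^+ 2 <= d ^+ 2 by rewrite ler_piMl.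
have h (k X : R) : 0 <= k -> X <= eps + d ^+ 2 -> k * X <= k * (eps + d ^+ 2).
  by move=> k0 ?; rewrite ler_wpM2l.
apply: (@le_trans _ _ (C2 * (eps + d ^+ 2))); last first.
  by rewrite ler_wpM2r ?addr_ge0.
have h1 : (P + 6 * L * V) * eps <= (P + 6 * L * V) * (eps + d ^+ 2).
  by apply: h; [rewrite !(addr_ge0, mulr_ge0)|lra].
have h2 : (6 * L * V * L) * (eps * d) <= (6 * L * V * L) * (eps + d ^+ 2).
  by apply: h; [rewrite !(addr_ge0, mulr_ge0)|lra].
have h3 : (3 * L * L) * (d ^+ 2) <= (3 * L * L) * (eps + d ^+ 2).
  by apply: h; [rewrite !(addr_ge0, mulr_ge0)|lra].
have h4 : (3 * L * P) * (eps * d ^+ 2) <= (3 * L * P) * (eps + d ^+ 2).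
  by apply: h; [rewrite !(addr_ge0, mulr_ge0)|lra].
have h5 : (3 * L * G) * (eps * d) <= (3 * L * G) * (eps + d ^+ 2).
  by apply: h; [rewrite !(addr_ge0, mulr_ge0)|lra].
have h6 : (9 * L * V * V) * (d ^+ 2) <= (9 * L * V * V) * (eps + d ^+ 2).
  by apply: h; [rewrite !(addr_ge0, mulr_ge0)|lra].
have h7 : (9 * L * G * V) * (eps * d ^+ 2) <= (9 * L * G * V) * (eps + d ^+ 2).
  by apply: h; [rewrite !(addr_ge0, mulr_ge0)|lra].
by rewrite /C2; lra.
Qed.

(** * Two scalar inequalities *)

Section Gronwall.
Variable R : realType.

(** The recursion is implicit, as the trapezoidal rule is; it can be solved for
    [a k.+1] because [h * kappa] is at most 1/2. *)
Lemma discrete_gronwall (a : nat -> R) (n : nat) (h T kappa eta : R) :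
  0 <= h -> 0 <= kappa -> 0 <= eta -> 2 * (h * kappa) <= 1 -> n%:R * h <= T ->
  (forall k, (k <= n)%N -> 0 <= a k) ->
  (forall k, (k < n)%N -> a k.+1 <= a k + h * kappa * (a k + a k.+1) + h * eta) ->
  forall k, (k <= n)%N -> a k <= expR (4 * kappa * T) * (a 0%N + 2 * eta * T).
Proof.
move=> h0 k0 e0 hk nT a0 step.
have main k : (k <= n)%N ->
    a k <= expR (4 * (h * kappa) * k%:R) * (a 0%N + 2 * (h * eta) * k%:R).
  elim: k => [|k IH] kn; first by rewrite !mulr0 addr0 expR0 mul1r.
  have {}IH := IH (ltnW kn); have {}step := step k kn.
  have ak := a0 k (ltnW kn); have ak1 := a0 _ kn; have a00 := a0 0%N (leq0n _).
  set X := h * kappa in hk step IH *.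
  have X0 : 0 <= X by rewrite mulr_ge0.
  have he : 0 <= h * eta by rewrite mulr_ge0.
  have step2 : a k.+1 <= (1 + 4 * X) * a k + 2 * (h * eta).
    rewrite leNgt; apply/negP => lt.
    have p1 : 0 < (1 - X) * (a k.+1 - ((1 + 4 * X) * a k + 2 * (h * eta))).
      by rewrite mulr_gt0 ?subr_gt0 //; lra.
    have p2 : 0 <= X * (1 - 2 * X) * a k by rewrite !mulr_ge0 //; lra.
    have p3 : 0 <= (1 - 2 * X) * (h * eta) by rewrite mulr_ge0 //; lra.
    nra.
  set E := expR (4 * X * k%:R) in IH; set S := a 0%N + _ in IH.
  have -> : expR (4 * X * k.+1%:R) = expR (4 * X) * E.
    by rewrite -expRD -(natr1 k); congr expR; ring.
  have -> : a 0%N + 2 * (h * eta) * k.+1%:R = S + 2 * (h * eta).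
    by rewrite /S -(natr1 k); ring.
  have E1 : 1 <= E by rewrite -expR0 ler_expR !mulr_ge0.
  have S0 : 0 <= S by rewrite !addr_ge0 ?mulr_ge0.
  have X1 : 1 + 4 * X <= expR (4 * X) by exact: expR_ge1Dx.
  have X2 : 1 <= expR (4 * X) by apply: le_trans X1; lra.
  have q1 : (1 + 4 * X) * a k <= expR (4 * X) * (E * S).
    by rewrite ler_pM //; lra.
  have q2 : 2 * (h * eta) <= expR (4 * X) * E * (2 * (h * eta)).
    by rewrite ler_peMl ?mulr_ge0 // mulr_ege1.
  by apply: le_trans step2 _; rewrite mulrDr -mulrA lerD // mulrA.
move=> k kn; apply: le_trans (main k kn) _.
have khT : k%:R * h <= T.
  by apply: le_trans nT; rewrite ler_wpM2r // ler_nat.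
have a00 := a0 0%N (leq0n _).
rewrite ler_pM ?expR_ge0 ?addr_ge0 ?mulr_ge0 //.
  rewrite ler_expR (_ : 4 * (h * kappa) * k%:R = 4 * kappa * (k%:R * h)); last by ring.
  by rewrite ler_wpM2l ?mulr_ge0.
rewrite lerD2l (_ : 2 * (h * eta) * k%:R = 2 * eta * (k%:R * h)); last by ring.
by rewrite ler_wpM2l ?mulr_ge0.
Qed.

Lemma normr_sin_le (z : R) : 0 <= z -> `|sin z| <= z.
Proof.
move=> z0; have Ds : deriv_on 0 z (@sin R) (@cos R).
  split=> [|t _]; last exact: is_derive_sin.
  by apply: continuous_subspaceT; exact: continuous_sin.
have := deriv_on_bound (c := 0) (M := 1) z0 Ds _.
rewrite mul0r !subr0 sin0 subr0 mul1r; apply=> t _.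
by rewrite subr0 ler_norml cos_geN1 cos_le1.
Qed.

End Gronwall.

(** * One step of the method *)

Section Potential.
Variable R : realType.
Local Notation V := 'cV[R]_3.
Implicit Types (f : V -> V) (y d : V).

(** The transposed Jacobian applied to [d], in terms of the partial derivatives
    that the hypotheses bound. *)
Definition gradt f y d : V := \col_i dotv (partial i f y) d.

Lemma jacT_mul f y d : (jac f y)^T *m d = gradt f y d.
Proof.
apply/matrixP => i j; rewrite (ord1 j) !mxE /dotv; apply: eq_bigr => k _.
by rewrite !mxE.
Qed.

(** The antisymmetric part of the Jacobian is the magnetic force. *)
Lemma gradt_curl f y d : gradt f y d = ddir f y d + cross d (curl f y).
Proof.
rewrite /gradt /ddir /curl /jac.
have E i : (\col_i0 dotv (partial i0 f y) d) i 0 = dotv (partial i f y) d by rewrite mxE.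
have C i j : (\matrix_(i0, j0) partial j0 f y i0 0) i j = partial j f y i 0 by rewrite mxE.
have Q i : (\col_i0 ((\matrix_(i1, j0) partial j0 f y i1 0) (i0 + 2) (i0 + 1) -
   (\matrix_(i1, j0) partial j0 f y i1 0) (i0 + 1) (i0 + 2))) i 0 =
   partial (i + 1) f y (i + 2) 0 - partial (i + 2) f y (i + 1) 0 by rewrite mxE !C.
apply: col3P; rewrite E [RHS]mxE crossE !Q !ord3D dotvE;
  move: (partial 0 f y) (partial 1 f y) (partial 2 f y) => p0 p1 p2;
  by rewrite !mxE; ring.
Qed.

Lemma partial_lin (g f : V -> V) i y : (forall u w k, g (k *: u + w) = k *: g u + g w) ->
  differentiable f y ->
  partial i (fun x => g x + f x) y = g (delta_mx i 0) + partial i f y.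
Proof.
move=> lg df; rewrite /partial; set w := delta_mx i 0.
have Dg : is_derive y w g (g w).
  have gE : \forall h \near 0^', h^-1 *: ((g \o shift y) (h *: w) - g y) = g w.
    near=> h; rewrite /= lg addrK scalerA mulVf ?scale1r //.
    by near: h; exact: nbhs_dnbhs_neq.
  by apply: DeriveDef; [exact: is_cvg_near_cst gE|exact: lim_near_cst gE].
have Df := derivableP (@diff_derivable _ _ _ f y w df).
by have := is_deriveD Dg Df => -[_ <-].
Unshelve. all: by end_near. Qed.

Variables (eps : R) (b : V).

Lemma gradt_vector_potential f y d : differentiable f y ->
  gradt (vector_potential eps b f) y d = (2 * eps)^-1 *: cross d b + gradt f y d.
Proof.
move=> df; apply/matrixP => i j; rewrite (ord1 j) [LHS]mxE [RHS]mxE /vector_potential.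
rewrite partial_lin //; last first.
  move=> u w k; rewrite crossDl crossZl; apply: col3P; rewrite !mxE; ring.
rewrite dotvDl [RHS in _ = _ + RHS]mxE; congr (_ + _); rewrite mxE invfM.
by elim/ord3_ind: i; rewrite dotvE !(mxE, ord3D) /=; ring.
Qed.

End Potential.

Section Step.
Variable R : realType.
Local Notation V := 'cV[R]_3.
Variables (eps h : R) (b : V) (A1 F : V -> V).
Hypotheses (e0 : 0 < eps) (h0 : 0 < h) (b1 : enorm b = 1).
Hypothesis dA1 : forall y, differentiable A1 y.
Local Notation theta := (h / (2 * eps)).

(** The part of the step that does not involve the strong field, which enters
    only through an exact rotation. *)
Definition residual (m d m' d' : V) : V :=
  2^-1 *: (gradt A1 m d + gradt A1 m' d') - (A1 m' - A1 m) + (h / 2) *: (F m + F m').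

Definition start_residual (x0 m d : V) : V :=
  A1 x0 - A1 m + 2^-1 *: gradt A1 m d + (h / 2) *: F m.

Let th0 : theta != 0.
Proof. by rewrite gt_eqF // divr_gt0 // mulr_gt0. Qed.

Lemma tanc_strong : tanc theta * theta = tan theta.
Proof. by rewrite /tanc divfK. Qed.

Lemma tanc_weak : tanc theta * h = 2 * eps * tan theta.
Proof. by rewrite -tanc_strong; field; rewrite gt_eqF. Qed.

Lemma filtered_par (u s r : V) : u = Psi eps b h *m (theta *: cross s b + h *: r) ->
  dotv b u = h * dotv b r.
Proof.
move=> ->; rewrite /Psi filterE // dotvDr !dotvZr -sqr_enorm b1 dotv_perp //.
by rewrite dotvDr !dotvZr dotv_cross_r; ring.
Qed.

(** The filter turns the large coefficient [theta] of the strong field into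
    [tan theta], the value for which the step is an exact rotation by the angle
    [2 * theta = h / eps], and multiplies all other forces by O(eps / h). *)
Lemma filtered_perp (u s r : V) : u = Psi eps b h *m (theta *: cross s b + h *: r) ->
  perp b u = tan theta *: cross s b + (2 * eps * tan theta) *: perp b r.
Proof.
move=> ->; rewrite /Psi filterE // perpD !perpZ.
have -> : perp b b = 0 by rewrite /perp -sqr_enorm b1 expr1n scale1r subrr.
have pp y : perp b (perp b y) = perp b y by rewrite {1}/perp dotv_perp // scale0r subr0.
rewrite scaler0 add0r pp perpD !perpZ perp_cross scalerDr !scalerA.
by rewrite tanc_strong tanc_weak.
Qed.

Lemma fvi_step_filtered xm x xp : fvi_step eps b A1 F h xm x xp ->
  (xp - x) - (x - xm) = Psi eps b h *m (theta *: cross ((xp - x) + (x - xm)) b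
    + h *: residual (mid xm x) (x - xm) (mid x xp) (xp - x)).
Proof.
have J m d : (jac (vector_potential eps b A1) m)^T *m d =
    (2 * eps)^-1 *: cross d b + gradt A1 m d.
  by rewrite jacT_mul (gradt_vector_potential _ _ _ (dA1 _)).
have key G G' : G = (2 * eps)^-1 *: cross (xp - x) b + gradt A1 (mid x xp) (xp - x) ->
    G' = (2 * eps)^-1 *: cross (x - xm) b + gradt A1 (mid xm x) (x - xm) ->
    (h / 2) *: G + (h / 2) *: G' - h *: (vector_potential eps b A1 (mid x xp)
      - vector_potential eps b A1 (mid xm x))
      + (h ^+ 2 / 2) *: (F (mid x xp) + F (mid xm x)) =
    theta *: cross ((xp - x) + (x - xm)) b
      + h *: residual (mid xm x) (x - xm) (mid x xp) (xp - x).
  move=> -> ->; rewrite /residual /vector_potential.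
  move: (gradt _ _ (xp - x)) (gradt _ _ (x - xm)) => g g'.
  move: (A1 _) (A1 _) (F _) (F _) => a a' f f'.
  by apply: col3P; rewrite !(mxE, ord3D) /mid ?mxE; field; rewrite gt_eqF.
rewrite /fvi_step; cbv zeta; move: (Psi eps b h) => P; rewrite [mid x xm]midC => E.
have lhs : (xp - x) - (x - xm) = xp - 2 *: x + xm.
  by apply: col3P; rewrite !mxE; ring.
by apply: (etrans lhs (etrans E _)); congr (P *m _); apply: key; exact: J.
Qed.

Lemma fvi_start_filtered x0 v0 x1 : fvi_start eps b A1 F h x0 v0 x1 ->
  x1 - x0 = Psi eps b h *m (theta *: cross (x1 - x0) b
    + h *: (v0 + start_residual x0 (mid x0 x1) (x1 - x0))).
Proof.
rewrite /fvi_start; cbv zeta; move: (Psi eps b h) => P E.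
have lhs w : x0 + h *: (P *m w) - x0 = P *m (h *: w).
  by rewrite addrAC subrr add0r scalemxAr.
apply: (etrans (congr1 (fun z => z - x0) E)); rewrite lhs; clear E lhs.
congr (P *m _); rewrite jacT_mul (gradt_vector_potential _ _ _ (dA1 _)).
set g := gradt A1 _ _.
rewrite /start_residual -/g /vector_potential.
move: (A1 _) (A1 _) (F _) g => a a' f g.
by apply: col3P; rewrite !(mxE, ord3D) /mid ?mxE; field; rewrite gt_eqF.
Qed.

Lemma Phi_par u : dotv b (Phi eps b h *m u) = dotv b u.
Proof.
by rewrite /Phi filterE // dotvDr !dotvZr -sqr_enorm b1 dotv_perp //; ring.
Qed.

End Step.

(** * A priori bounds for the numerical solution *)

Section Numerical.
Variables (R : realType) (T Chat c0 rho L eps h : R).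
Local Notation V := 'cV[R]_3.
Variables (K : set V) (b : V) (A1 B1 F : V -> V) (x0 v0 : V) (n : nat).
Variables (xs vs : nat -> V).
Local Notation D := (closed_nbhd K rho).
Local Notation theta := (h / (2 * eps)).

Record numeric_setting : Prop := NumericSetting {
  num_eps : 0 < eps;
  num_h : 0 < h;
  num_c0 : 0 < c0;
  num_rho : 0 < rho;
  num_b : enorm b = 1;
  num_sin : c0 <= `|sin theta|;
  num_cos : c0 <= `|cos theta|;
  num_A1 : smooth_bound D L 3 A1;
  num_B1 : smooth_bound D L 3 B1;
  num_F : smooth_bound D L 3 F;
  num_curl : forall y, B1 y = curl A1 y;
  num_v0 : enorm v0 <= Chat;
  num_fvi : is_fvi eps b A1 F h x0 v0 n xs vs;
  num_step : step_within rho n xs;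
  num_time : n%:R * h <= T;
  num_near : forall k, (k <= n)%N -> exists2 y, K y & enorm (xs k - y) <= rho / 2 }.

Hypothesis H : numeric_setting.

Let e0 := num_eps H.
Let h0 := num_h H.
Let c00 := num_c0 H.
Let b1 := num_b H.
Let L0 : 0 <= L. Proof. by case: (num_F H). Qed.
Let dA1 y : differentiable A1 y. Proof. exact: smooth_bound_diff (num_A1 H). Qed.

Definition incr k : V := xs k.+1 - xs k.
Definition midpt k : V := mid (xs k) (xs k.+1).
Definition par_speed k : R := dotv b (incr k) / h.
Definition resid k : V := residual h A1 F (midpt k) (incr k) (midpt k.+1) (incr k.+1).
Definition resid0 : V := start_residual h A1 F (xs 0%N) (midpt 0) (incr 0).
Definition cotan : R := cos theta / sin theta.
Local Notation u := par_speed.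

Lemma nonres_c0_le1 : c0 <= 1.
Proof.
apply: le_trans (num_sin H) _.
by rewrite ler_norml sin_geN1 sin_le1.
Qed.

(** Nonresonance keeps the step size above a multiple of eps. *)
Lemma nonres_eps_le : 2 * c0 * eps <= h.
Proof.
have th0 : 0 <= theta by rewrite divr_ge0 ?mulr_ge0 // ltW.
have := le_trans (num_sin H) (normr_sin_le th0).
by rewrite ler_pdivlMr ?mulr_gt0 // mulrCA mulrA.
Qed.

Let sin0 : sin theta != 0.
Proof. by rewrite -normr_gt0 (lt_le_trans c00 (num_sin H)). Qed.

Let cos0 : cos theta != 0.
Proof. by rewrite -normr_gt0 (lt_le_trans c00 (num_cos H)). Qed.

Lemma nonres_tan : `|tan theta| <= c0^-1.
Proof.
rewrite /tan normrM normfV ler_pdivrMr ?normr_gt0 // ler_pdivlMl //.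
have : `|sin theta| <= 1 by rewrite ler_norml sin_geN1 sin_le1.
by move=> ?; rewrite (le_trans _ (num_cos H)) // ler_piMr // ltW.
Qed.

Lemma nonres_cotan : `|cotan| <= c0^-1.
Proof.
rewrite /cotan normrM normfV ler_pdivrMr ?normr_gt0 // ler_pdivlMl //.
have : `|cos theta| <= 1 by rewrite ler_norml cos_geN1 cos_le1.
by move=> ?; rewrite (le_trans _ (num_sin H)) // ler_piMr // ltW.
Qed.

Lemma cotan_tan : cotan * tan theta = 1.
Proof. by rewrite /cotan /tan; field; rewrite sin0 cos0. Qed.

Lemma num_x0 : xs 0%N = x0.
Proof. by have [[]] := num_fvi H. Qed.

Lemma step_eq k : (k < n)%N ->
  incr k.+1 - incr k = Psi eps b h *m (theta *: cross (incr k.+1 + incr k) b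
    + h *: resid k).
Proof.
move=> kn; have [_ _ st _] := num_fvi H.
exact (fvi_step_filtered e0 dA1 (st k.+1 kn)).
Qed.

Lemma start_eq :
  incr 0 = Psi eps b h *m (theta *: cross (incr 0) b + h *: (v0 + resid0)).
Proof.
have [_ st _ _] := num_fvi H; rewrite -num_x0 in st.
exact (fvi_start_filtered e0 dA1 st).
Qed.

Lemma incr_par k : dotv b (incr k) = h * u k.
Proof. by rewrite /par_speed mulrCA mulfV ?mulr1 // gt_eqF. Qed.

Lemma par_step k : (k < n)%N -> u k.+1 - u k = dotv b (resid k).
Proof.
move=> kn; have := filtered_par b1 (step_eq kn).
rewrite dotvBr !incr_par -mulrBr; apply: mulfI.
by rewrite gt_eqF.
Qed.

Lemma par_start : u 0 = dotv b v0 + dotv b resid0.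
Proof.
have := filtered_par b1 start_eq; rewrite incr_par dotvDr; apply: mulfI.
by rewrite gt_eqF.
Qed.

Lemma perp_step k : (k < n)%N ->
  perp b (incr k.+1) - perp b (incr k) =
    tan theta *: cross (perp b (incr k.+1) + perp b (incr k)) b
    + (2 * eps * tan theta) *: perp b (resid k).
Proof.
by move=> kn; rewrite -perpB -perpD (filtered_perp e0 h0 b1 (step_eq kn)) cross_perp.
Qed.

Lemma perp_start : perp b (incr 0) = tan theta *: cross (perp b (incr 0)) b
    + (2 * eps * tan theta) *: perp b (v0 + resid0).
Proof. by rewrite {1}(filtered_perp e0 h0 b1 start_eq) cross_perp. Qed.

(** The step is a rotation up to the residual, hence preserves lengths up to it. *)
Lemma enorm_perp_step (p q r : V) (s k : R) :
  p - q = s *: cross (p + q) b + k *: r -> enorm p <= enorm q + `|k| * enorm r.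
Proof.
move=> E; have E2 : dotv (p + q) (p - q) = dotv p p - dotv q q.
  by rewrite !dotvDl !dotvBr (dotvC q p); ring.
have : enorm p ^+ 2 - enorm q ^+ 2 <= `|k| * enorm r * (enorm p + enorm q).
  rewrite !sqr_enorm -E2 E dotvDr !dotvZr dotv_cross_l mulr0 add0r.
  rewrite (le_trans (ler_norm _)) // normrM -mulrA ler_wpM2l //.
  rewrite (le_trans (normr_dotv _ _)) // mulrC ler_wpM2l ?enorm_ge0 //.
  exact: enormD.
have : 0 <= `|k| * enorm r by rewrite mulr_ge0 ?enorm_ge0.
have := enorm_ge0 p; have := enorm_ge0 q.
move: (enorm p) (enorm q) (`|k| * enorm r) => P Q X Q0 P0 X0 h1.
rewrite leNgt; apply/negP => lt.
have : 0 < (P - (Q + X)) * P by rewrite mulr_gt0 ?subr_gt0 //; lra.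
have : 0 <= (P - (Q + X)) * Q by rewrite mulr_ge0 ?subr_ge0 // ltW.
nra.
Qed.

Lemma nonres_2eps_tan : `|2 * eps * tan theta| <= 2 * eps / c0.
Proof.
by rewrite normrM gtr0_norm ?mulr_gt0 // ler_wpM2l ?nonres_tan // mulr_ge0 // ltW.
Qed.

Lemma perp_step_le k : (k < n)%N ->
  enorm (perp b (incr k.+1)) <= enorm (perp b (incr k)) + 2 * eps / c0 * enorm (resid k).
Proof.
move=> kn; apply: le_trans (enorm_perp_step (perp_step kn)) _.
by rewrite lerD2l ler_pM ?enorm_ge0 ?nonres_2eps_tan ?enorm_perp.
Qed.

Lemma perp_start_le :
  enorm (perp b (incr 0)) <= 2 * eps / c0 * (enorm v0 + enorm resid0).
Proof.
have := @enorm_perp_step (perp b (incr 0)) 0 (perp b (v0 + resid0)) (tan theta)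
  (2 * eps * tan theta).
rewrite addr0 subr0 enorm0 add0r => /(_ perp_start) /le_trans; apply.
rewrite ler_pM ?enorm_ge0 ?nonres_2eps_tan //.
by rewrite (le_trans (enorm_perp b1 _)) // enormD.
Qed.

Lemma midpt_sub_l k : midpt k - xs k = 2^-1 *: incr k.
Proof. by rewrite /midpt /incr; apply: col3P; rewrite /mid !mxE; field. Qed.

Lemma midpt_sub_r k : midpt k - xs k.+1 = - (2^-1 *: incr k).
Proof. by rewrite /midpt /incr; apply: col3P; rewrite /mid !mxE; field. Qed.

Lemma midpt_step k : midpt k.+1 - midpt k = 2^-1 *: (incr k.+1 + incr k).
Proof. by rewrite /midpt /incr; apply: col3P; rewrite /mid !mxE; field. Qed.

Lemma incr_le_rho k : (k <= n)%N -> enorm (incr k) <= rho.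
Proof. exact: num_step. Qed.

Let half_incr k : (k <= n)%N -> enorm (2^-1 *: incr k) <= rho / 2.
Proof.
move=> kn; rewrite enormZ ger0_norm ?invr_ge0 // mulrC ler_wpM2r ?invr_ge0 //.
exact: incr_le_rho.
Qed.

Lemma segment_midpt k : (k < n)%N -> segment_in D (midpt k) (midpt k.+1).
Proof.
move=> kn; have [y Ky yk] := num_near H kn.
have ball p : enorm (p - xs k.+1) <= rho / 2 -> enorm (p - y) <= rho.
  by move=> pk; have := enorm_dist p (xs k.+1) y; lra.
apply: (segment_in_nbhd Ky); apply: ball.
  by rewrite midpt_sub_r enormN half_incr // ltnW.
by rewrite midpt_sub_l half_incr.
Qed.

Lemma segment_start k : (k <= n)%N -> segment_in D (xs k) (midpt k).
Proof.
move=> kn; have [y Ky yk] := num_near H kn.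
apply: (segment_in_nbhd Ky); first by have := num_rho H; lra.
have := enorm_dist (midpt k) (xs k) y; rewrite midpt_sub_l.
by have := half_incr kn; lra.
Qed.

Lemma midpt_in k : (k <= n)%N -> D (midpt k).
Proof. by move=> kn; exact: segment_inr (segment_start kn). Qed.

Lemma enorm_coord_le (w : V) (m : R) : 0 <= m -> (forall i, `|w i 0| <= m) ->
  enorm w <= 2 * m.
Proof.
move=> m0 wm; apply: enorm_le; first by rewrite mulr_ge0.
have wi i : w i 0 * w i 0 <= m ^+ 2.
  by rewrite -expr2 -real_normK ?num_real // lerXn2r ?nnegrE.
rewrite dotvE exprMn; have := wi 0; have := wi 1; have := wi 2.
by have := sqr_ge0 m; lra.
Qed.

Lemma enorm_gradt y d : D y -> enorm (gradt A1 y d) <= 2 * L * enorm d.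
Proof.
move=> Dy; rewrite -mulrA; apply: enorm_coord_le => [|i].
  by rewrite mulr_ge0 ?enorm_ge0.
rewrite mxE (le_trans (normr_dotv _ _)) // ler_wpM2r ?enorm_ge0 //.
exact: (smooth_bound0 (smooth_bound_partial i (num_A1 H)) Dy).
Qed.

Let F_le y : D y -> enorm (F y) <= L. Proof. exact: smooth_bound0 (num_F H). Qed.

Lemma resid_le k : (k < n)%N ->
  enorm (resid k) <= 3 * L * (enorm (incr k) + enorm (incr k.+1)) + L * h.
Proof.
move=> kn; have kn' := ltnW kn.
have g1 := enorm_gradt (incr k) (midpt_in kn').
have g2 := enorm_gradt (incr k.+1) (midpt_in kn).
have lA := smooth_bound_lip (smooth_boundW (isT : (1 <= 3)%N) (num_A1 H)) (segment_midpt kn).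
have f1 := F_le (midpt_in kn'); have f2 := F_le (midpt_in kn).
have dm : enorm (midpt k.+1 - midpt k) <= (enorm (incr k) + enorm (incr k.+1)) / 2.
  rewrite midpt_step enormZ ger0_norm ?invr_ge0 // mulrC ler_wpM2r ?invr_ge0 //.
  by rewrite addrC enormD.
have {}lA : enorm (A1 (midpt k.+1) - A1 (midpt k)) <=
    3 * L * ((enorm (incr k) + enorm (incr k.+1)) / 2).
  by apply: le_trans lA _; rewrite ler_wpM2l // mulr_ge0.
rewrite /resid /residual.
move: (gradt _ _ (incr k)) (gradt _ _ (incr k.+1)) g1 g2 => g g' g1 g2.
have a1 := enormD (2^-1 *: (g + g') - (A1 (midpt k.+1) - A1 (midpt k)))
  ((h / 2) *: (F (midpt k) + F (midpt k.+1))).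
have a2 := enormB (2^-1 *: (g + g')) (A1 (midpt k.+1) - A1 (midpt k)).
have a3 := enormD g g'; have a4 := enormD (F (midpt k)) (F (midpt k.+1)).
have h2 : 0 <= h / 2 by rewrite divr_ge0 // ltW.
rewrite !enormZ [`|h / 2|]ger0_norm // [`|2^-1|]ger0_norm ?invr_ge0 // in a1 a2.
have a5 : h / 2 * enorm (F (midpt k) + F (midpt k.+1)) <= h / 2 * (2 * L).
  by rewrite ler_wpM2l //; lra.
have d1 : 0 <= L * enorm (incr k) by rewrite mulr_ge0 ?enorm_ge0.
have d2 : 0 <= L * enorm (incr k.+1) by rewrite mulr_ge0 ?enorm_ge0.
lra.
Qed.

Lemma resid0_le : enorm resid0 <= 3 * L * enorm (incr 0) + L * h.
Proof.
have n0 := leq0n n.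
have g1 := enorm_gradt (incr 0) (midpt_in n0).
have lA := smooth_bound_lip (smooth_boundW (isT : (1 <= 3)%N) (num_A1 H)) (segment_start n0).
have f1 := F_le (midpt_in n0).
rewrite midpt_sub_l enormZ ger0_norm ?invr_ge0 // in lA.
rewrite /resid0 /start_residual.
move: (gradt _ _ _) g1 => g g1; rewrite enormBC in lA.
have a1 := enormD (A1 (xs 0%N) - A1 (midpt 0) + 2^-1 *: g) ((h / 2) *: F (midpt 0)).
have a2 := enormD (A1 (xs 0%N) - A1 (midpt 0)) (2^-1 *: g).
have h2 : 0 <= h / 2 by rewrite divr_ge0 // ltW.
rewrite !enormZ [`|h / 2|]ger0_norm // [`|2^-1|]ger0_norm ?invr_ge0 // in a1 a2.
have a5 : h / 2 * enorm (F (midpt 0)) <= h / 2 * L by rewrite ler_wpM2l.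
have hL : 0 <= h * L by rewrite mulr_ge0 // ltW.
have dL : 0 <= L * enorm (incr 0) by rewrite mulr_ge0 ?enorm_ge0.
lra.
Qed.

(** Velocities on both scales: the increments orthogonal to [b] are measured in
    units of eps. *)
Definition speed k : R := `|u k| + c0 / (2 * eps) * enorm (perp b (incr k)).

Let ce0 : 0 <= c0 / (2 * eps).
Proof. by apply/ltW/divr_gt0 => //; exact: mulr_gt0. Qed.

Lemma speed_ge0 k : 0 <= speed k.
Proof. exact: addr_ge0 (normr_ge0 _) (mulr_ge0 ce0 (enorm_ge0 _)). Qed.

Lemma perp_incr_le k : enorm (perp b (incr k)) <= 2 / c0 * speed k * eps.
Proof.
rewrite /speed mulrDr mulrDl.
rewrite (_ : 2 / c0 * (c0 / (2 * eps) * enorm (perp b (incr k))) * eps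
  = enorm (perp b (incr k))); last by field; rewrite !gt_eqF.
by rewrite lerDr !mulr_ge0 ?invr_ge0 // ltW.
Qed.

Lemma incr_le k : enorm (incr k) <= h / c0 ^+ 2 * speed k.
Proof.
have s0 := speed_ge0 k; have uk : `|u k| <= speed k.
  by rewrite lerDl mulr_ge0 ?enorm_ge0.
rewrite (le_trans (enorm_par_perp b1 _)) // incr_par normrM gtr0_norm //.
rewrite /speed mulrDr lerD //.
  rewrite ler_wpM2r //; rewrite ler_pdivlMr ?exprn_gt0 // ler_piMr ?(ltW h0) //.
  by rewrite expr_le1 ?nonres_c0_le1 // ltW.
rewrite (_ : h / c0 ^+ 2 * _ = h / (2 * c0 * eps) * enorm (perp b (incr k))); last first.
  by field; rewrite !gt_eqF.
rewrite ler_peMl ?enorm_ge0 // ler_pdivlMr ?mulr_gt0 //.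
by rewrite mul1r nonres_eps_le.
Qed.

Lemma speed_step k : (k < n)%N -> speed k.+1 <= speed k + 2 * enorm (resid k).
Proof.
move=> kn; have p := perp_step_le kn.
have q : `|u k.+1| <= `|u k| + enorm (resid k).
  rewrite -{1}(subrK (u k) (u k.+1)) (par_step kn) addrC.
  by rewrite (le_trans (ler_normD _ _)) // lerD2l normr_par.
have e : c0 / (2 * eps) * (2 * eps / c0 * enorm (resid k)) = enorm (resid k).
  by field; rewrite !gt_eqF.
have := ler_wpM2l ce0 p; rewrite mulrDr e /speed; lra.
Qed.

Lemma speed_start : speed 0 <= 2 * (enorm v0 + enorm resid0).
Proof.
have p := perp_start_le.
have q : `|u 0| <= enorm v0 + enorm resid0.
  by rewrite par_start (le_trans (ler_normD _ _)) // lerD ?normr_par.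
have e : c0 / (2 * eps) * (2 * eps / c0 * (enorm v0 + enorm resid0))
    = enorm v0 + enorm resid0 by field; rewrite !gt_eqF.
by have := ler_wpM2l ce0 p; rewrite e /speed; lra.
Qed.

(** The residual is bounded by a multiple of the speeds, with a factor [h], so that
    speeds grow at most exponentially in time. *)
Definition speed_rate : R := 6 * L / c0 ^+ 2.

Definition num_speed_bound : R :=
  expR (4 * speed_rate * T) * (4 * Chat + 4 * L + 2 * (2 * L) * T).

Lemma speed_bounded : 2 * (h * speed_rate) <= 1 -> h <= 1 ->
  forall k, (k <= n)%N -> speed k <= num_speed_bound.
Proof.
move=> hr h1 k kn.
have r0 : 0 <= speed_rate by rewrite divr_ge0 ?mulr_ge0 ?exprn_ge0 // ltW.
have il j : 3 * L * enorm (incr j) <= h * speed_rate * speed j / 2.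
  have := ler_wpM2l (mulr_ge0 (ler0n _ 3) L0) (incr_le j).
  by move/le_trans; apply; rewrite le_eqVlt; apply/orP; left; apply/eqP;
    rewrite /speed_rate; field; rewrite gt_eqF.
have Lh : L * h <= L by rewrite ler_piMr.
have start : speed 0 <= 4 * Chat + 4 * L.
  have := speed_start; have := resid0_le; have := il 0%N; have := num_v0 H.
  have : h * speed_rate * speed 0 <= speed 0 / 2.
    have := speed_ge0 0; move: (speed 0) => s s0.
    by have : 0 <= (1 - 2 * (h * speed_rate)) * s; [rewrite mulr_ge0 // subr_ge0|lra].
  by lra.
apply: (@le_trans _ _ (expR (4 * speed_rate * T) * (speed 0 + 2 * (2 * L) * T))).
  apply: (discrete_gronwall (ltW h0) r0 _ hr (num_time H)) kn.
  - by rewrite mulr_ge0.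
  - by move=> j _; exact: speed_ge0.
  move=> j jn; have := speed_step jn; have := resid_le jn; have := il j; have := il j.+1.
  move: (enorm (resid j)) (enorm (incr j)) (enorm (incr j.+1)) => p q q'.
  by move: (speed j) (speed j.+1) => w w'; rewrite (mulrDr (3 * L)); lra.
by rewrite ler_wpM2l ?expR_ge0 // lerD2r.
Qed.

End Numerical.

(** * The slow variables of the numerical solution *)

Section NumericalSlow.
Variables (R : realType) (T Chat c0 rho L eps h : R).
Local Notation V := 'cV[R]_3.
Variables (K : set V) (b : V) (A1 B1 F : V -> V) (x0 v0 : V) (n : nat).
Variables (xs vs : nat -> V).
Local Notation D := (closed_nbhd K rho).
Hypothesis H : numeric_setting T Chat c0 rho L eps h K b A1 B1 F x0 v0 n xs vs.
Local Notation d := (incr xs).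
Local Notation m := (midpt xs).
Local Notation u := (par_speed h b xs).
Local Notation res := (resid h A1 F xs).
Local Notation cot := (cotan eps h).
Local Notation f y := (dotv b (F y)).
Local Notation eta := (eps + h ^+ 2).

Variable M : R.
Hypotheses (LM : L <= M) (cM : c0^-1 <= M).
Hypothesis dM : forall k, (k <= n)%N -> enorm (d k) <= M * h.
Hypothesis pM : forall k, (k <= n)%N -> enorm (perp b (d k)) <= M * eps.
Hypothesis rM : forall k, (k < n)%N -> enorm (res k) <= M * h.

Let e0 := num_eps H.
Let h0 := num_h H.
Let b1 := num_b H.
Let L0 : 0 <= L. Proof. by case: (num_F H). Qed.
Let M1 : 1 <= M.
Proof. by apply: le_trans cM; rewrite invf_ge1 ?(num_c0 H) // (nonres_c0_le1 H). Qed.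
Let M0 : 0 <= M. Proof. exact: le_trans ler01 M1. Qed.
Let Mh0 : 0 <= M * h. Proof. by rewrite mulr_ge0 // ltW. Qed.
Let Me0 : 0 <= M * eps. Proof. by rewrite mulr_ge0 // ltW. Qed.
Let cotM : `|cot| <= M. Proof. exact: le_trans (nonres_cotan H) cM. Qed.
Let eta0 : 0 <= eta. Proof. by rewrite addr_ge0 ?exprn_ge0 // ltW. Qed.

Definition magnetic_par k : R := dotv b (cross (d k) (B1 (m k))).
Local Notation a := magnetic_par.

Let BM k : (k <= n)%N -> enorm (B1 (m k)) <= M.
Proof. by move=> kn; apply: le_trans LM; exact: smooth_bound0 (num_B1 H) (midpt_in H kn). Qed.

Lemma magnetic_par_le k : (k <= n)%N -> `|a k| <= M ^+ 2 * eps.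
Proof.
move=> kn; apply: le_trans (normr_triple_perp b1 _ _) _.
by rewrite expr2 mulrAC ler_pM ?enorm_ge0 ?pM ?BM.
Qed.

Lemma enorm_incr_diff k : (k < n)%N -> enorm (d k.+1 - d k) <= 2 * M * eta.
Proof.
move=> kn; rewrite (le_trans (enorm_par_perp b1 _)) //.
have -> : dotv b (d k.+1 - d k) = h * dotv b (res k).
  by rewrite -(par_step H kn) dotvBr !(incr_par H) mulrBr.
rewrite normrM gtr0_norm // perpB.
have := enormB (perp b (d k.+1)) (perp b (d k)).
have := pM kn; have := pM (ltnW kn).
have : h * `|dotv b (res k)| <= h * (M * h).
  by rewrite ler_pM2l // (le_trans (normr_par b1 _)) // rM.
have : 0 <= M * h ^+ 2 by rewrite mulr_ge0 ?exprn_ge0 // ltW.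
lra.
Qed.

Let dmM k : (k < n)%N -> enorm (m k.+1 - m k) <= M * h.
Proof.
move=> kn; rewrite midpt_step enormZ ger0_norm ?invr_ge0 //.
have := enormD (d k.+1) (d k); have := dM kn; have := dM (ltnW kn); lra.
Qed.

Definition resid_bound : R := 54 * M ^+ 4 + 9 * M ^+ 3.

(** The terms of the residual that come from [A1] are a trapezoidal rule for
    the increment of [A1] between midpoints, plus the magnetic force. *)
Lemma resid_par_approx k : (k < n)%N ->
  `|dotv b (res k) - (2^-1 * (a k + a k.+1) + h / 2 * (f (m k) + f (m k.+1)))|
    <= resid_bound * (h * eta).
Proof.
move=> kn; have A3 := num_A1 H.
have A2 := smooth_boundW (isT : (2 <= 3)%N) A3.
have seg := segment_midpt H kn.
set dl := m k.+1 - m k.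
pose e := 2^-1 *: (d k.+1 - d k).
have d1E : d k.+1 = dl + e.
  by rewrite /dl /e midpt_step; apply: col3P; rewrite !mxE; field.
have dE : d k = dl - e.
  by rewrite /dl /e midpt_step; apply: col3P; rewrite !mxE; field.
have tr := smooth_bound_trapezoid A3 seg b1; rewrite -/dl in tr.
have li := smooth_bound_lip_ddir e A2 seg; rewrite -/dl in li.
have eM : enorm e <= M * eta.
  rewrite enormZ ger0_norm ?invr_ge0 //; have := enorm_incr_diff kn; lra.
have dlM := dmM kn; rewrite -/dl in dlM.
have -> : dotv b (res k) - (2^-1 * (a k + a k.+1) + h / 2 * (f (m k) + f (m k.+1))) =
  2^-1 * dotv b (ddir A1 (m k.+1) e - ddir A1 (m k) e) -
  dotv b (A1 (m k.+1) - A1 (m k) - 2^-1 *: (ddir A1 (m k) dl + ddir A1 (m k.+1) dl)).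
  rewrite /resid /residual !gradt_curl -!(num_curl H) /magnetic_par.
  have -> : ddir A1 (m k) (d k) = ddir A1 (m k) dl - ddir A1 (m k) e.
    by rewrite dE ddirD -scaleN1r ddirZ scaleN1r.
  have -> : ddir A1 (m k.+1) (d k.+1) = ddir A1 (m k.+1) dl + ddir A1 (m k.+1) e.
    by rewrite d1E ddirD.
  move: (ddir A1 (m k) dl) (ddir A1 (m k.+1) dl) (ddir A1 (m k) e) (ddir A1 (m k.+1) e).
  move: (cross (d k) (B1 (m k))) (cross (d k.+1) (B1 (m k.+1))).
  move: (A1 (m k)) (A1 (m k.+1)) (F (m k)) (F (m k.+1)) => p1 p2 p3 p4 p5 p6 p7 p8 p9 p10.
  by rewrite !(dotvDr, dotvZr, dotvNr); field.
apply: le_trans (ler_normB _ _) _.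
have n1 : `|2^-1 * dotv b (ddir A1 (m k.+1) e - ddir A1 (m k) e)|
    <= 2^-1 * (9 * M * (M * h) * (M * eta)).
  rewrite normrM ger0_norm ?invr_ge0 // ler_wpM2l ?invr_ge0 //.
  rewrite (le_trans (normr_par b1 _)) // (le_trans li) //.
  rewrite ler_pM ?enorm_ge0 ?mulr_ge0 ?enorm_ge0 //.
  by rewrite ler_pM ?enorm_ge0 ?mulr_ge0 ?enorm_ge0 // ler_wpM2l.
have n2 : 54 * L * enorm dl ^+ 3 <= 54 * M * (M * h) ^+ 3.
  by rewrite ler_pM ?mulr_ge0 ?exprn_ge0 ?enorm_ge0 ?ler_wpM2l // lerXn2r ?nnegrE ?enorm_ge0.
have n3 : 54 * M * (M * h) ^+ 3 <= 54 * M ^+ 4 * (h * eta).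
  rewrite (_ : 54 * M * _ = 54 * M ^+ 4 * (h * h ^+ 2)); last by ring.
  by rewrite ler_wpM2l ?mulr_ge0 ?exprn_ge0 // ler_pM2l // lerDr ltW.
have n4 : 0 <= M ^+ 3 * (h * eta) by rewrite !mulr_ge0 ?exprn_ge0 // ltW.
by rewrite /resid_bound; lra.
Qed.

(** Solving the rotation for the sum of two increments instead of their
    difference turns it into a difference: sums of the rapidly rotating
    increments telescope. This is where [sin theta] must stay away from 0. *)
Lemma perp_sum k : (k < n)%N -> perp b (d k.+1) + perp b (d k) =
  - cot *: cross (d k.+1 - d k) b + (2 * eps) *: cross (res k) b.
Proof.
move=> kn; have pp : perp b (perp b (d k.+1) + perp b (d k)) =
    perp b (d k.+1) + perp b (d k).
  by rewrite {1}/perp dotvDr !dotv_perp // addr0 scale0r subr0.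
have E : cross (d k.+1 - d k) b = - tan (h / (2 * eps)) *: (perp b (d k.+1) + perp b (d k))
    + (2 * eps * tan (h / (2 * eps))) *: cross (res k) b.
  rewrite -cross_perp perpB (perp_step H kn).
  rewrite [LHS]crossDl !crossZl crossbb // pp cross_perp.
  by rewrite scalerN scaleNr.
rewrite E; move: (perp b (d k.+1) + perp b (d k)) (cross (res k) b) => S r.
have -> : - cot *: (- tan (h / (2 * eps)) *: S + (2 * eps * tan (h / (2 * eps))) *: r)
    + (2 * eps) *: r = (cot * tan (h / (2 * eps))) *: S
    + (2 * eps * (1 - cot * tan (h / (2 * eps)))) *: r.
  by apply: col3P; rewrite !mxE; ring.
by rewrite (cotan_tan H) subrr mulr0 scale0r scale1r addr0.
Qed.

(** By [perp_sum] the midpoint, once the O(eps) gyration is added, moves by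
    O(eps * h) per step: the discrete guiding centre. *)
Lemma midpt_perp_le k : (k <= n)%N ->
  enorm (perp b (m k) - perp b x0) <= (M * T + 2 * M ^+ 2) * eps.
Proof.
move=> kn; pose Z j := perp b (m j) + (cot / 2) *: cross (d j) b.
have Zstep j : (j < n)%N -> enorm (Z j.+1 - Z j) <= eps * (M * h).
  move=> jn; have -> : Z j.+1 - Z j = eps *: cross (res j) b.
    have -> : Z j.+1 - Z j = perp b (m j.+1 - m j) + (cot / 2) *: cross (d j.+1 - d j) b.
      by rewrite /Z perpB crossBl scalerBr opprD addrACA.
    have alg (X r : V) :
        2^-1 *: (- cot *: X + (2 * eps) *: r) + (cot / 2) *: X = eps *: r.
      by apply: col3P; rewrite !mxE; field.
    rewrite midpt_step perpZ perpD (perp_sum jn); exact: alg.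
  by rewrite enormZ gtr0_norm // ler_pM2l // (le_trans (enorm_cross1 b1 _)) // rM.
have Zk j : (j <= n)%N -> enorm (Z j - Z 0%N) <= eps * (M * h) * j%:R.
  elim: j => [|j IH] jn; first by rewrite subrr enorm0 mulr0.
  apply: le_trans (enorm_dist _ (Z j) _) _.
  rewrite -(natr1 j) mulrDr mulr1; move: (Zstep j jn) (IH (ltnW jn)).
  by move: (enorm (Z j.+1 - Z j)) (enorm (Z j - _)) => p q; lra.
have Zd j : (j <= n)%N -> enorm ((cot / 2) *: cross (d j) b) <= M * (M * eps) / 2.
  move=> jn; rewrite enormZ normrM [`|2^-1|]ger0_norm ?invr_ge0 // mulrAC.
  rewrite ler_wpM2r ?invr_ge0 // ler_pM ?enorm_ge0 // -cross_perp.
  by rewrite (le_trans (enorm_cross1 b1 _)) // pM.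
have d0 : enorm (perp b (m 0) - perp b x0) <= M * eps / 2.
  rewrite -perpB -(num_x0 H) midpt_sub_l perpZ enormZ ger0_norm ?invr_ge0 // mulrC.
  by rewrite ler_wpM2r ?invr_ge0 // pM.
have kT : eps * (M * h) * k%:R <= M * T * eps.
  rewrite (_ : eps * (M * h) * k%:R = M * (k%:R * h) * eps); last by ring.
  rewrite ler_pM2r // ler_wpM2l // (le_trans _ (num_time H)) // ler_pM2r // ler_nat.
  exact: kn.
have -> : perp b (m k) - perp b x0 = (Z k - Z 0%N) - (cot / 2) *: cross (d k) b +
    (cot / 2) *: cross (d 0) b + (perp b (m 0) - perp b x0).
  have alg (p q r c c' : V) : p - r = (p + c - (q + c')) - c + c' + (q - r).
    by apply: col3P; rewrite !mxE; ring.
  exact: alg.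
have tri := enormD_le (enormD_le (enormB_le (Zk k kn) (Zd k kn)) (Zd 0%N (leq0n n))) d0.
apply: le_trans tri _.
have : M * eps <= M ^+ 2 * eps by rewrite ler_pM2r // ler_eXnr.
move: Me0 kT; lra.
Qed.

(** The discrete counterpart of [par_velocity]. *)
Definition par_slow k : R := u k + cot / 2 * dotv b (cross (cross (d k) b) (B1 (m k))).
Local Notation U := par_slow.

Lemma par_slow_near k : (k <= n)%N -> `|U k - u k| <= M ^+ 3 * eps.
Proof.
move=> kn; rewrite addrAC subrr add0r normrM.
have c2 : `|cot / 2| <= M.
  rewrite normrM [`|2^-1|]ger0_norm ?invr_ge0 //; have := cotM; have := normr_ge0 cot; lra.
rewrite (_ : M ^+ 3 * eps = M * (M * eps * M)); last by ring.
rewrite ler_pM // (le_trans (normr_quadruple b1 _ _)) // ler_pM ?enorm_ge0 ?pM ?BM //.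
Qed.

(** The magnetic terms of two consecutive midpoints add up to a product with the
    sum of two increments, which [perp_sum] turns into a difference; the added
    term of [par_slow] cancels it. *)
Lemma par_slow_step k : (k < n)%N ->
  `|U k.+1 - U k - h / 2 * (f (m k) + f (m k.+1))| <= (resid_bound + 4 * M ^+ 4) * (h * eta).
Proof.
move=> kn; have kn' := ltnW kn.
have B1' := smooth_boundW (isT : (1 <= 3)%N) (num_B1 H).
have dB : enorm (B1 (m k.+1) - B1 (m k)) <= 3 * M * (M * h).
  apply: le_trans (smooth_bound_lip B1' (segment_midpt H kn)) _.
  by rewrite ler_pM ?enorm_ge0 ?mulr_ge0 ?dmM // ler_wpM2l.
have ap := resid_par_approx kn.
set B := B1 (m k) in dB; set B' := B1 (m k.+1) in dB.
have ps := perp_sum kn.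
have E : 2^-1 * (a k + a k.+1) + cot / 2 * (dotv b (cross (cross (d k.+1) b) B')
      - dotv b (cross (cross (d k) b) B)) =
    eps * dotv b (cross (cross (res k) b) B') - 2^-1 * dotv b (cross (d k) (B' - B))
    + cot / 2 * dotv b (cross (cross (d k) b) (B' - B)).
  have -> : a k + a k.+1 = dotv b (cross (perp b (d k.+1) + perp b (d k)) B')
      - dotv b (cross (d k) (B' - B)).
    rewrite -perpD -dotv_cross_perp /magnetic_par -/B -/B'.
    have alg (p q Q Q' : V) : dotv b (cross q Q) + dotv b (cross p Q') =
        dotv b (cross (p + q) Q') - dotv b (cross q (Q' - Q)).
      by rewrite !(crossDl, crossBr, dotvDr, dotvNr); ring.
    exact: alg.
  have alg (S p q r Q Q' : V) : S = - cot *: cross (p - q) b + (2 * eps) *: cross r b ->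
      2^-1 * (dotv b (cross S Q') - dotv b (cross q (Q' - Q))) + cot / 2 *
        (dotv b (cross (cross p b) Q') - dotv b (cross (cross q b) Q)) =
      eps * dotv b (cross (cross r b) Q') - 2^-1 * dotv b (cross q (Q' - Q))
        + cot / 2 * dotv b (cross (cross q b) (Q' - Q)).
    by move=> ->; rewrite !(crossDl, crossNl, crossZl, crossBr, dotvDr, dotvNr, dotvZr); field.
  exact: alg ps.
rewrite /par_slow -/B -/B'.
set X := dotv b (cross (cross (d k.+1) b) B') in E *.
set Y := dotv b (cross (cross (d k) b) B) in E *.
have us := par_step H kn.
have -> : u k.+1 + cot / 2 * X - (u k + cot / 2 * Y) - h / 2 * (f (m k) + f (m k.+1)) =
  (dotv b (res k) - (2^-1 * (a k + a k.+1) + h / 2 * (f (m k) + f (m k.+1)))) +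
  (2^-1 * (a k + a k.+1) + cot / 2 * (X - Y)) by rewrite -us; ring.
rewrite E (le_trans (ler_normD _ _)) // mulrDl lerD //.
have t1 : `|eps * dotv b (cross (cross (res k) b) B')| <= eps * (M * h * M).
  rewrite normrM gtr0_norm // ler_pM2l // (le_trans (normr_quadruple b1 _ _)) //.
  by rewrite ler_pM ?enorm_ge0 ?BM // (le_trans (enorm_perp b1 _)) // rM.
have t2 : `|2^-1 * dotv b (cross (d k) (B' - B))| <= 2^-1 * (M * eps * (3 * M * (M * h))).
  rewrite normrM ger0_norm ?invr_ge0 // ler_wpM2l ?invr_ge0 //.
  by rewrite (le_trans (normr_triple_perp b1 _ _)) // ler_pM ?enorm_ge0 ?pM.
have t3 : `|cot / 2 * dotv b (cross (cross (d k) b) (B' - B))|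
    <= M / 2 * (M * eps * (3 * M * (M * h))).
  have c2 : `|cot / 2| <= M / 2.
    by rewrite normrM [`|2^-1|]ger0_norm ?invr_ge0 // ler_wpM2r ?invr_ge0.
  rewrite normrM ler_pM // (le_trans (normr_quadruple b1 _ _)) //.
  by rewrite ler_pM ?enorm_ge0 ?pM.
apply: le_trans (ler_normD _ _) _; apply: le_trans (lerD (ler_normB _ _) (lexx _)) _.
have he : 0 <= h * eps by rewrite mulr_ge0 // ltW.
have M24 : M ^+ 2 * (h * eps) <= M ^+ 4 * (h * eps) by rewrite ler_wpM2r // ler_weXn2l.
have M34 : M ^+ 3 * (h * eps) <= M ^+ 4 * (h * eps) by rewrite ler_wpM2r // ler_weXn2l.
have fin : M ^+ 4 * (h * eps) <= M ^+ 4 * (h * eta).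
  by rewrite ler_wpM2l ?exprn_ge0 // ler_pM2l // lerDl exprn_ge0 // ltW.
lra.
Qed.

Lemma par_start_approx :
  `|u 0 - dotv b v0 - 2^-1 * a 0 - h / 2 * f (m 0)| <= 9 * M ^+ 3 * h ^+ 2.
Proof.
have n0 := leq0n n.
have A2 := smooth_boundW (isT : (2 <= 3)%N) (num_A1 H).
have ta := smooth_bound_taylor A2 (segment_start H n0).
have -> : u 0 - dotv b v0 - 2^-1 * a 0 - h / 2 * f (m 0) =
    dotv b (resid0 h A1 F xs) - 2^-1 * a 0 - h / 2 * f (m 0).
  by rewrite (par_start H); ring.
have -> : dotv b (resid0 h A1 F xs) - 2^-1 * a 0 - h / 2 * f (m 0) =
    - dotv b (A1 (m 0) - A1 (xs 0%N) - ddir A1 (m 0) (m 0 - xs 0%N)).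
  rewrite /resid0 /start_residual gradt_curl -(num_curl H) /magnetic_par midpt_sub_l ddirZ.
  move: (ddir A1 (m 0) (d 0)) (cross (d 0) (B1 (m 0))) => p1 p2.
  move: (A1 _) (A1 _) (F _) => p3 p4 p5.
  by rewrite !(dotvDr, dotvZr, dotvNr); field.
rewrite normrN (le_trans (normr_par b1 _)) // (le_trans ta) //.
rewrite (_ : 9 * M ^+ 3 * h ^+ 2 = 9 * M * (M * h) ^+ 2); last by ring.
rewrite ler_pM ?mulr_ge0 ?exprn_ge0 ?enorm_ge0 ?ler_wpM2l // lerXn2r ?nnegrE ?enorm_ge0 //.
rewrite midpt_sub_l enormZ ger0_norm ?invr_ge0 //.
by have := dM n0; have := enorm_ge0 (d 0); lra.
Qed.

(** A velocity at [t_k] that satisfies the recursion defining [vs] up to a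
    summable error; the recursion has the growth factor -1. *)
Definition par_node k : R := u k - 2^-1 * a k - h / 2 * f (m k).

Lemma par_vs_near k : (k <= n)%N ->
  `|dotv b (vs k) - par_node k| <= (9 * M ^+ 3 + resid_bound * T) * eta.
Proof.
have rb0 : 0 <= resid_bound by rewrite addr_ge0 ?mulr_ge0 ?exprn_ge0.
have [[_ vs0] _ _ vsE] := num_fvi H.
have qE j : (j <= n)%N -> dotv b (vs j) + dotv b (vs j.+1) = 2 * u j.
  move=> jn; have := congr1 (dotv b) (vsE j jn).
  rewrite Phi_par // /mid !dotvZr dotvDr /par_speed -/(d j) => E.
  by rewrite [dotv b (d j) / h]mulrC -E mulrA mulfV ?mul1r // pnatr_eq0.
have main j : (j <= n)%N -> `|dotv b (vs j) - par_node j|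
    <= 9 * M ^+ 3 * h ^+ 2 + resid_bound * (h * eta) * j%:R.
  elim: j => [|j IH] jn.
    rewrite mulr0 addr0 vs0 distrC /par_node.
    rewrite (_ : _ - dotv b v0 = u 0 - dotv b v0 - 2^-1 * a 0 - h / 2 * f (m 0)).
      exact: par_start_approx.
    by ring.
  have := IH (ltnW jn); have := resid_par_approx jn; have := qE j (ltnW jn).
  rewrite -(par_step H jn) -(natr1 j) /par_node.
  move=> q; have {q} -> : dotv b (vs j.+1) = 2 * u j - dotv b (vs j).
    by rewrite -q addrC addrA addNr add0r || (rewrite -q; ring).
  rewrite !ler_norml => /andP[? ?] /andP[? ?]; apply/andP; split; lra.
move=> kn; apply: le_trans (main k kn) _; rewrite [leRHS]mulrDl lerD //.
  by rewrite ler_wpM2l ?mulr_ge0 ?exprn_ge0 // lerDr ltW.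
rewrite (_ : _ * _ * k%:R = resid_bound * (k%:R * h) * eta); last by ring.
rewrite ler_wpM2r // ler_wpM2l // (le_trans _ (num_time H)) // ler_pM2r // ler_nat.
exact: kn.
Qed.

End NumericalSlow.

(** What the comparison with the exact solution needs to know of the numerical
    one. The velocity of index [k] lives at the half-integer time of the
    midpoint, where the method is the trapezoidal rule for the slow variables. *)
Record numeric_slow (R : realType) (C eps h : R) (b : 'cV[R]_3)
    (F : 'cV[R]_3 -> 'cV[R]_3) (x0 v0 : 'cV[R]_3) (n : nat)
    (xs vs : nat -> 'cV[R]_3) (U : nat -> R) : Prop := NumericSlow {
  ns_incr : forall k, (k <= n)%N -> enorm (incr xs k) <= C * h;
  ns_perp_incr : forall k, (k <= n)%N -> enorm (perp b (incr xs k)) <= C * eps;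
  ns_perp : forall k, (k <= n)%N ->
    enorm (perp b (midpt xs k) - perp b x0) <= C * eps;
  ns_near : forall k, (k <= n)%N -> `|U k - par_speed h b xs k| <= C * eps;
  ns_step : forall k, (k < n)%N ->
    `|U k.+1 - U k - h / 2 * (dotv b (F (midpt xs k)) + dotv b (F (midpt xs k.+1)))|
      <= C * (h * (eps + h ^+ 2));
  ns_start : `|par_speed h b xs 0 - dotv b v0 - h / 2 * dotv b (F (midpt xs 0))|
    <= C * (eps + h ^+ 2);
  ns_vs : forall k, (k <= n)%N ->
    `|dotv b (vs k) - (par_speed h b xs k - h / 2 * dotv b (F (midpt xs k)))|
      <= C * (eps + h ^+ 2) }.

Lemma numeric_slow_motion (R : realType) (T Chat c0 L : R) :
  0 < T -> 0 <= Chat -> 0 < c0 -> 0 <= L ->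
  exists C h1 : R, [/\ 0 < C, 0 < h1 & forall rho eps h K b A1 B1 F x0 v0 n xs vs,
    numeric_setting T Chat c0 rho L eps h K b A1 B1 F x0 v0 n xs vs -> h <= h1 ->
    numeric_slow C eps h b F x0 v0 n xs vs (par_slow eps h b B1 xs)].
Proof.
move=> T0 Ch0 c00 L0.
pose S := num_speed_bound T Chat c0 L; pose r := speed_rate c0 L.
have r0 : 0 <= r by rewrite divr_ge0 ?mulr_ge0 ?exprn_ge0 // ltW.
have S0 : 0 <= S.
  by rewrite mulr_ge0 ?expR_ge0 // !addr_ge0 ?mulr_ge0 // ltW.
have ES : num_speed_bound T Chat c0 L = S by [].
have Er : speed_rate c0 L = r by [].
clearbody S r.
pose h1 := (1 + 2 * r)^-1.
have h10 : 0 < h1 by rewrite invr_gt0; lra.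
pose M := 1 + L + c0^-1 + 2 / c0 * S + S / c0 ^+ 2 + (6 * L * (S / c0 ^+ 2) + L).
have c10 : 0 <= c0^-1 by rewrite invr_ge0 ltW.
have cS0 : 0 <= 2 / c0 * S by rewrite !mulr_ge0.
have c2S0 : 0 <= S / c0 ^+ 2 by rewrite divr_ge0 ?exprn_ge0 // ltW.
have Lc0 : 0 <= 6 * L * (S / c0 ^+ 2) by rewrite mulr_ge0 // mulr_ge0.
have LM : L <= M by rewrite /M; lra.
have cM : c0^-1 <= M by rewrite /M; lra.
have pMM : 2 / c0 * S <= M by rewrite /M; lra.
have dMM : S / c0 ^+ 2 <= M by rewrite /M; lra.
have rMM : 6 * L * (S / c0 ^+ 2) + L <= M by rewrite /M; lra.
have M0 : 0 <= M by exact: le_trans L0 LM.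
clearbody M.
pose Q := resid_bound M.
have Q0 : 0 <= Q by rewrite addr_ge0 ?mulr_ge0 ?exprn_ge0.
have EQ : resid_bound M = Q by [].
clearbody Q.
pose C := 1 + M + (M * T + 2 * M ^+ 2) + M ^+ 3 + (Q + 4 * M ^+ 4)
  + (9 * M ^+ 3 + M ^+ 2) + (9 * M ^+ 3 + Q * T + M ^+ 2).
have T1 := ltW T0.
have MT0 : 0 <= M * T by rewrite mulr_ge0.
have QT0 : 0 <= Q * T by rewrite mulr_ge0.
have M2 : 0 <= M ^+ 2 by rewrite exprn_ge0.
have M3 : 0 <= M ^+ 3 by rewrite exprn_ge0.
have M4 : 0 <= M ^+ 4 by rewrite exprn_ge0.
have k0 : 0 < C by rewrite /C; lra.
have k1 : M <= C by rewrite /C; lra.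
have k2 : M * T + 2 * M ^+ 2 <= C by rewrite /C; lra.
have k3 : M ^+ 3 <= C by rewrite /C; lra.
have k4 : Q + 4 * M ^+ 4 <= C by rewrite /C; lra.
have k5 : 9 * M ^+ 3 + M ^+ 2 <= C by rewrite /C; lra.
have k6 : 9 * M ^+ 3 + Q * T + M ^+ 2 <= C by rewrite /C; lra.
clearbody C.
exists C, h1; split=> // rho eps h K b A1 B1 F x0 v0 n xs vs H hh.
have h0 := ltW (num_h H); have e0 := ltW (num_eps H).
have eta0 : 0 <= eps + h ^+ 2 by rewrite addr_ge0 // exprn_ge0.
have hr1 : h * (1 + 2 * r) <= 1.
  by move: hh; rewrite /h1 -[leRHS]mul1r ler_pdivlMr //; lra.
have hr : 2 * (h * speed_rate c0 L) <= 1 by rewrite Er; lra.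
have h_1 : h <= 1 by have : 0 <= h * r; [rewrite mulr_ge0|lra].
have sp k (kn : (k <= n)%N) := speed_bounded H hr h_1 kn.
rewrite ES in sp.
have dM k : (k <= n)%N -> enorm (incr xs k) <= S / c0 ^+ 2 * h.
  move=> kn; apply: le_trans (incr_le H k) _.
  rewrite (_ : S / _ * h = h / c0 ^+ 2 * S); last by rewrite mulrC mulrA mulrAC.
  by rewrite ler_wpM2l ?sp // divr_ge0 ?exprn_ge0 // ltW.
have dM' k : (k <= n)%N -> enorm (incr xs k) <= M * h.
  by move=> kn; apply: le_trans (dM k kn) _; rewrite ler_wpM2r.
have pM k : (k <= n)%N -> enorm (perp b (incr xs k)) <= M * eps.
  move=> kn; apply: le_trans (perp_incr_le H k) _.
  rewrite ler_wpM2r // (le_trans _ pMM) // ler_wpM2l ?sp //.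
  by rewrite mulr_ge0.
have rM k : (k < n)%N -> enorm (resid h A1 F xs k) <= M * h.
  move=> kn; apply: le_trans (resid_le H kn) _.
  apply: (@le_trans _ _ ((6 * L * (S / c0 ^+ 2) + L) * h)); last by rewrite ler_wpM2r.
  have : L * enorm (incr xs k) <= L * (S / c0 ^+ 2 * h).
    by rewrite ler_wpM2l // dM // ltnW.
  have : L * enorm (incr xs k.+1) <= L * (S / c0 ^+ 2 * h) by rewrite ler_wpM2l // dM.
  lra.
have aM k (kn : (k <= n)%N) := magnetic_par_le H LM pM kn.
have e_eta : eps <= eps + h ^+ 2 by rewrite lerDl exprn_ge0.
have M2e : M ^+ 2 * eps <= M ^+ 2 * (eps + h ^+ 2) by rewrite ler_wpM2l.
split.
- by move=> k kn; apply: le_trans (dM' k kn) _; rewrite ler_wpM2r.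
- by move=> k kn; apply: le_trans (pM k kn) _; rewrite ler_wpM2r.
- move=> k kn; apply: le_trans (midpt_perp_le H cM pM rM kn) _.
  by rewrite ler_wpM2r.
- move=> k kn; apply: le_trans (par_slow_near H LM cM pM kn) _.
  by rewrite ler_wpM2r.
- move=> k kn; apply: le_trans (par_slow_step H LM cM dM' pM rM kn) _.
  by rewrite EQ ler_wpM2r // mulr_ge0.
- have st := par_start_approx H LM cM dM'; have a0 := aM 0%N (leq0n n).
  apply: (@le_trans _ _ ((9 * M ^+ 3 + M ^+ 2) * (eps + h ^+ 2))); last by rewrite ler_wpM2r.
  have : M ^+ 3 * h ^+ 2 <= M ^+ 3 * (eps + h ^+ 2) by rewrite ler_wpM2l // lerDr.
  move: st a0; rewrite !ler_norml => /andP[? ?] /andP[? ?] ?; apply/andP; split; lra.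
move=> k kn; have := par_vs_near H LM cM dM' pM rM kn; have := aM k kn.
rewrite EQ /par_node => ak vk.
apply: (@le_trans _ _ ((9 * M ^+ 3 + Q * T + M ^+ 2) * (eps + h ^+ 2))); last first.
  by rewrite ler_wpM2r.
rewrite [leRHS]mulrDl.
move: vk ak; set X := (9 * M ^+ 3 + _) * _; rewrite !ler_norml.
by move=> /andP[? ?] /andP[? ?]; apply/andP; split; lra.
Qed.

(** * Comparison of the slow variables *)

Section Comparison.
Variables (R : realType) (T rho L C eps h : R).
Local Notation V := 'cV[R]_3.
Variables (K : set V) (b : V) (F : V -> V) (x v : R -> V) (W : R -> R) (n : nat).
Variables (xs vs : nat -> V) (U : nat -> R).
Hypothesis SE : slow_motion T rho eps C b F x v W.
Hypothesis NS : numeric_slow C eps h b F (x 0) (v 0) n xs vs U.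
Hypothesis FB : smooth_bound (closed_nbhd K rho) L 3 F.
Hypothesis xK : forall t, 0 <= t <= T -> K (x t).
Hypotheses (b1 : enorm b = 1) (C0 : 0 <= C) (T0 : 0 <= T).
Hypotheses (e0 : 0 <= eps) (h0 : 0 < h) (h1 : h <= 1) (xs0 : xs 0%N = x 0).
Hypothesis near : forall k, (k <= n)%N -> enorm (xs k - x (k%:R * h)) <= rho / 2.
Hypothesis small : C * (h + eps) <= rho / 2.
Hypothesis rate : 2 * (h * (1 + 3 * L)) <= 1.
Hypothesis time : (n%:R + 2^-1) * h <= T.
Local Notation d := (incr xs).
Local Notation m := (midpt xs).
Local Notation u := (par_speed h b xs).
Local Notation f y := (dotv b (F y)).
Local Notation eta := (eps + h ^+ 2).
Local Notation node k := (k%:R * h).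
Local Notation half k := ((k%:R + 2^-1) * h).

Let L0 : 0 <= L. Proof. by case: FB. Qed.
Let h0' := ltW h0.
Let eta0 : 0 <= eta. Proof. by rewrite addr_ge0 ?exprn_ge0. Qed.
Let e_eta : eps <= eta. Proof. by rewrite lerDl exprn_ge0. Qed.
Let h_eta : h ^+ 2 <= eta. Proof. by rewrite lerDr. Qed.
Let small1 : C * h <= rho / 2.
Proof. by apply: le_trans small; rewrite mulrDr lerDl mulr_ge0. Qed.
Let small2 : C * (h + eps) <= rho.
Proof.
apply: le_trans small _; have : 0 <= C * (h + eps) by rewrite mulr_ge0 ?addr_ge0.
by move: small; lra.
Qed.
Let rho0 : 0 <= rho.
Proof. by apply: le_trans small2; rewrite mulr_ge0 ?addr_ge0. Qed.
Let smallh : C * (h / 2 + eps) <= rho.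
Proof. by apply: le_trans small2; rewrite ler_wpM2l // lerD2r; move: h0'; lra. Qed.

Let half_in k : (k <= n)%N -> 0 <= half k <= T.
Proof.
move=> kn; rewrite mulr_ge0 ?addr_ge0 ?invr_ge0 //=.
by apply: le_trans time; rewrite ler_pM2r // lerD2r ler_nat.
Qed.

Let half_node k : half k = node k + h / 2.
Proof. by rewrite mulrDl [2^-1 * h]mulrC. Qed.

Let node_half k : node k <= half k.
Proof. by rewrite half_node lerDl divr_ge0. Qed.

Let node_in k : (k <= n)%N -> 0 <= node k <= T.
Proof.
move=> kn; rewrite mulr_ge0 //= (le_trans (node_half k)) //.
by have /andP[] := half_in kn.
Qed.

Let half_step k : half k.+1 - half k = h.
Proof. by rewrite -(natr1 k); ring. Qed.

Lemma enorm_half_incr k : (k <= n)%N -> enorm (m k - xs k) <= C * h / 2.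
Proof.
move=> kn; rewrite midpt_sub_l enormZ ger0_norm ?invr_ge0 // mulrC.
by rewrite ler_wpM2r ?invr_ge0 // (ns_incr NS).
Qed.

Lemma exact_half_move k : (k <= n)%N -> enorm (x (half k) - x (node k)) <= C * h / 2.
Proof.
move=> kn; have [n0 _] := andP (node_in kn); have [_ hT] := andP (half_in kn).
apply: le_trans (slow_lip SE n0 (node_half k) hT) _.
by rewrite half_node addrAC subrr add0r mulrA.
Qed.

Lemma force_lip y p q : K y -> enorm (p - y) <= rho -> enorm (q - y) <= rho ->
  `|f q - f p| <= 3 * L * enorm (q - p).
Proof.
move=> Ky py qy; rewrite -dotvBr (le_trans (normr_par b1 _)) //.
exact: smooth_bound_lip (smooth_boundW (isT : (1 <= 3)%N) FB) (segment_in_nbhd Ky py qy).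
Qed.

Let self_near t : enorm (x t - x t) <= rho.
Proof. by rewrite subrr enorm0. Qed.

Lemma force_exact_le t : 0 <= t <= T -> `|f (x t)| <= L.
Proof.
move=> tT; rewrite (le_trans (normr_par b1 _)) //.
apply: smooth_bound0 FB _; exists (x t); first exact: xK.
exact: self_near.
Qed.

Definition par_err k : R := `|dotv b (m k) - dotv b (x (half k))|.
Definition vel_err k : R := `|U k - W (half k)|.

Lemma midpt_err k : (k <= n)%N ->
  enorm (m k - x (half k)) <= par_err k + 2 * C * eps.
Proof.
move=> kn; apply: le_trans (enorm_par_perp b1 _) _; rewrite dotvBr lerD2l perpB.
have p1 := ns_perp NS kn; have p2 := slow_perp SE (half_in kn).
rewrite enormBC in p2; have := enorm_dist (perp b (m k)) (perp b (x 0)) (perp b (x (half k))).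
lra.
Qed.

Lemma force_err k : (k <= n)%N ->
  `|f (m k) - f (x (half k))| <= 3 * L * (par_err k + 2 * C * eps).
Proof.
move=> kn; apply: le_trans (force_lip (xK (half_in kn)) (self_near _) _) _; last first.
  by rewrite ler_wpM2l ?mulr_ge0 // midpt_err.
have := enorm_half_incr kn; have := exact_half_move kn; have := near kn.
have := enorm_dist (m k) (xs k) (x (half k)).
have := enorm_dist (xs k) (x (node k)) (x (half k)).
rewrite [enorm (x (node k) - _)]enormBC; move: small1; lra.
Qed.

Let par_midpt_step k : dotv b (m k.+1) - dotv b (m k) = h / 2 * (u k + u k.+1).
Proof.
rewrite -dotvBr midpt_step dotvZr dotvDr /par_speed.
by move: (dotv b (d k)) (dotv b (d k.+1)) => p q; field; rewrite gt_eqF.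
Qed.

Definition err_defect : R := 4 * C + 6 * L * C.

(** Both solutions satisfy the same trapezoidal rule up to a defect of
    O(h * (eps + h ^+ 2)) per step, hence so do their differences. *)
Lemma err_step k : (k < n)%N ->
  par_err k.+1 + vel_err k.+1 <= par_err k + vel_err k
    + h * (1 + 3 * L) * ((par_err k + vel_err k) + (par_err k.+1 + vel_err k.+1))
    + h * (err_defect * eta).
Proof.
move=> kn; have kn' := ltnW kn.
have [s0 _] := andP (half_in kn'); have [_ tT] := andP (half_in kn).
have st : half k <= half k.+1 by rewrite -subr_ge0 half_step.
have sp := slow_par SE s0 st tT; rewrite half_step in sp; have {}sp := sp h1 small2.
have sv := slow_vel SE s0 st tT; rewrite half_step in sv; have {}sv := sv h1 small2.
have nv := ns_step NS kn; have pm := par_midpt_step k.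
have n1 := ns_near NS kn'; have n2 := ns_near NS kn.
have f1 := force_err kn'; have f2 := force_err kn.
have E1 : par_err k.+1 <= par_err k + h / 2 * (vel_err k + vel_err k.+1)
    + h * (C * eps) + C * eta * h.
  have hu : `|h / 2 * ((u k + u k.+1) - (W (half k) + W (half k.+1)))| <=
      h / 2 * (vel_err k + vel_err k.+1 + 2 * (C * eps)).
    rewrite normrM ger0_norm ?divr_ge0 // ler_wpM2l ?divr_ge0 //.
    rewrite (_ : _ - _ = - (U k - u k) - (U k.+1 - u k.+1) + (U k - W (half k))
      + (U k.+1 - W (half k.+1))); last by ring.
    apply: le_trans (ler_normD _ _) _; rewrite -/(vel_err k.+1).
    apply: le_trans (lerD (ler_normD _ _) (lexx _)) _; rewrite -/(vel_err k).
    apply: le_trans (lerD (lerD (ler_normB _ _) (lexx _)) (lexx _)) _.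
    by rewrite normrN; lra.
  rewrite /par_err.
  rewrite (_ : dotv b (m k.+1) - dotv b (x (half k.+1)) =
    (dotv b (m k) - dotv b (x (half k)))
    + h / 2 * ((u k + u k.+1) - (W (half k) + W (half k.+1)))
    - (dotv b (x (half k.+1)) - dotv b (x (half k)) - h / 2 * (W (half k) + W (half k.+1)))).
    apply: le_trans (ler_normB _ _) _; apply: le_trans (lerD (ler_normD _ _) sp) _.
    by rewrite -/(par_err k); lra.
  by move: pm; move: (dotv b (m k)) (dotv b (m k.+1)) => p q pq;
     rewrite mulrBr -pq; ring.
have E2 : vel_err k.+1 <= vel_err k
    + h / 2 * (3 * L * (par_err k + par_err k.+1 + 4 * C * eps)) + C * (h * eta) + C * eta * h.
  have hf : `|h / 2 * ((f (m k) - f (x (half k))) + (f (m k.+1) - f (x (half k.+1))))| <=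
      h / 2 * (3 * L * (par_err k + par_err k.+1 + 4 * C * eps)).
    rewrite normrM ger0_norm ?divr_ge0 // ler_wpM2l ?divr_ge0 //.
    by apply: le_trans (ler_normD _ _) _; lra.
  rewrite /vel_err.
  rewrite (_ : U k.+1 - W (half k.+1) = (U k - W (half k))
    + (U k.+1 - U k - h / 2 * (f (m k) + f (m k.+1)))
    + h / 2 * ((f (m k) - f (x (half k))) + (f (m k.+1) - f (x (half k.+1))))
    - (W (half k.+1) - W (half k) - h / 2 * (f (x (half k)) + f (x (half k.+1)))));
    last by ring.
  apply: le_trans (ler_normB _ _) _; apply: le_trans (lerD (ler_normD _ _) sv) _.
  apply: le_trans (lerD (lerD (ler_normD _ _) hf) (lexx _)) _.
  by rewrite -/(vel_err k); lra.
have p0 : 0 <= par_err k by exact: normr_ge0.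
have p1 : 0 <= par_err k.+1 by exact: normr_ge0.
have v0 : 0 <= vel_err k by exact: normr_ge0.
have v1 : 0 <= vel_err k.+1 by exact: normr_ge0.
have q1 : 0 <= h * (vel_err k + vel_err k.+1) by rewrite mulr_ge0 // addr_ge0.
have q2 : 0 <= h * (par_err k + par_err k.+1) by rewrite mulr_ge0 // addr_ge0.
have q3 : 0 <= h * L * (vel_err k + vel_err k.+1) by rewrite !mulr_ge0 // addr_ge0.
have q4 : 0 <= h * L * (par_err k + par_err k.+1) by rewrite !mulr_ge0 // addr_ge0.
have q5 : h * (C * eps) <= h * (C * eta) by rewrite !ler_wpM2l.
have q6 : h * L * (C * eps) <= h * L * (C * eta) by rewrite !ler_wpM2l // mulr_ge0.
by rewrite /err_defect; lra.
Qed.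

Lemma half0 : half 0%N = h / 2.
Proof. by rewrite add0r mulrC. Qed.

Lemma err_start : par_err 0 + vel_err 0 <= (L + 4 * L * C + 8 * C) * eta.
Proof.
have n0 := leq0n n; have hT := half_in n0; rewrite half0 in hT.
have [hh hT'] := andP hT; have z0 : 0 <= (0 : R) <= T by rewrite lexx.
have sp := slow_par SE (lexx 0) hh hT'; have sv := slow_vel SE (lexx 0) hh hT'.
rewrite subr0 in sp sv.
have h21 : h / 2 <= 1 by move: h1 h0'; lra.
have {}sp := sp h21 smallh; have {}sv := sv h21 smallh.
have nn := ns_near NS n0; have ns := ns_start NS; have wn := slow_near SE z0.
have fe := force_err n0; rewrite /par_err half0 in fe.
have mx : enorm (m 0 - x 0) <= C * h by have := enorm_half_incr n0; rewrite xs0;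
  have : 0 <= C * h by [rewrite mulr_ge0]; lra.
have fm : `|f (m 0) - f (x 0)| <= 3 * L * (C * h).
  apply: le_trans (force_lip (xK z0) (self_near 0) _) _.
    by apply: le_trans mx _; move: small1 rho0; lra.
  by rewrite ler_wpM2l ?mulr_ge0.
have xh : enorm (x (h / 2) - x 0) <= C * h / 2.
  by have := exact_half_move n0; rewrite half0 mul0r.
have fm2 : `|f (x (h / 2)) - f (x 0)| <= 3 * L * (C * h).
  apply: le_trans (force_lip (xK z0) (self_near 0) _) _.
    by apply: le_trans xh _; move: small1 rho0; lra.
  rewrite ler_wpM2l ?mulr_ge0 // (le_trans xh) //.
  by have : 0 <= C * h by [rewrite mulr_ge0]; lra.
have fx0 := force_exact_le z0; have fxh := force_exact_le hT.
(* the trapezoidal rule is applied on an interval of length h / 2 <= 1 *)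
have small_eta : C * (eps + (h / 2) ^+ 2) * (h / 2) <= C * eta / 2.
  have : C * (eps + (h / 2) ^+ 2) <= C * eta.
    by rewrite ler_wpM2l // lerD2l lerXn2r ?nnegrE ?divr_ge0 //; move: h0'; lra.
  have : 0 <= C * (eps + (h / 2) ^+ 2) by rewrite mulr_ge0 ?addr_ge0 ?exprn_ge0 ?divr_ge0.
  move: (C * (eps + (h / 2) ^+ 2)) => p p0 pe.
  by have : p * h <= p by [rewrite ler_piMr]; lra.
have dm : dotv b (m 0) = dotv b (x 0) + h / 2 * u 0.
  rewrite -xs0 -[m 0](subrK (xs 0%N)) midpt_sub_l dotvDr dotvZr addrC; congr (_ + _).
  by rewrite /par_speed; move: (dotv b (d 0)) => p; field; rewrite gt_eqF.
have Ceps : C * eps <= C * eta by rewrite ler_wpM2l.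
have Lh : L * h ^+ 2 <= L * eta by rewrite ler_wpM2l.
have LCh : L * C * h ^+ 2 <= L * C * eta by rewrite ler_wpM2l ?mulr_ge0.
have Ceta : 0 <= C * eta by rewrite mulr_ge0.
have Leta : 0 <= L * eta by rewrite mulr_ge0.
have LCeta : 0 <= L * C * eta by rewrite !mulr_ge0.
have Cetah : C * eta * h <= C * eta by rewrite ler_piMr.
set uu := u 0 in nn ns dm *; set w0 := W 0 in sp sv wn *; set wh := W (h / 2) in sp sv *.
set fm0 := f (m 0) in ns fm fe; set f0 := f (x 0) in fm fm2 fx0 sv.
set fh := f (x (h / 2)) in fm2 fxh sv fe.
have V0 : vel_err 0 <= (4 * C + 3 * L * C) * eta.
  rewrite /vel_err half0 -/wh.
  have t1 : `|h / 2 * fm0 - h / 2 / 2 * (f0 + fh)| <= 9 / 4 * (L * C * h ^+ 2).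
    rewrite (_ : _ - _ = h / 4 * (2 * (fm0 - f0) - (fh - f0))); last by field.
    rewrite normrM ger0_norm ?divr_ge0 //.
    rewrite (_ : 9 / 4 * _ = h / 4 * (9 * (L * C * h))); last by field.
    rewrite ler_wpM2l ?divr_ge0 //.
    by move: fm fm2; rewrite !ler_norml => /andP[? ?] /andP[? ?]; apply/andP; split; lra.
  rewrite (_ : U 0%N - wh = (U 0%N - uu) + (uu - dotv b (v 0) - h / 2 * fm0)
    - (w0 - dotv b (v 0)) + (h / 2 * fm0 - h / 2 / 2 * (f0 + fh))
    - (wh - w0 - h / 2 / 2 * (f0 + fh))); last by ring.
  apply: le_trans (ler_normB _ _) _; apply: le_trans (lerD (ler_normD _ _) sv) _.
  apply: le_trans (lerD (lerD (ler_normB _ _) t1) (lexx _)) _.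
  apply: le_trans (lerD (lerD (lerD (ler_normD _ _) wn) (lexx _)) (lexx _)) _.
  lra.
have E0 : par_err 0 <= (L + L * C + 4 * C) * eta.
  have hX (X B : R) : `|X| <= B -> `|h / 2 * X| <= B.
    move=> XB; rewrite normrM ger0_norm ?divr_ge0 //.
    by apply: le_trans XB; rewrite ler_piMl.
  have h2X (X B : R) : `|X| <= B -> `|h ^+ 2 / 4 * X| <= h ^+ 2 / 4 * B.
    move=> XB; rewrite normrM ger0_norm ?divr_ge0 ?exprn_ge0 //.
    by rewrite ler_wpM2l ?divr_ge0 ?exprn_ge0.
  have g : `|fm0 - 4^-1 * (f0 + fh)| <= 3 / 2 * L + 3 * (L * C).
    have : L * C * h <= L * C by rewrite ler_piMr ?mulr_ge0.
    move: fm fx0 fxh; rewrite !ler_norml => /andP[? ?] /andP[? ?] /andP[? ?] ?.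
    by apply/andP; split; lra.
  rewrite /par_err half0 dm.
  rewrite (_ : _ - _ = h / 2 * (uu - dotv b (v 0) - h / 2 * fm0)
    - h / 2 * (w0 - dotv b (v 0)) + h ^+ 2 / 4 * (fm0 - 4^-1 * (f0 + fh))
    - h / 2 * (2^-1 * (wh - w0 - h / 2 / 2 * (f0 + fh)))
    - (dotv b (x (h / 2)) - dotv b (x 0) - h / 2 / 2 * (w0 + wh))); last first.
    by move: (dotv b (x (h / 2))) (dotv b (x 0)) (dotv b (v 0)) => p q r; field.
  apply: le_trans (ler_normB _ _) _; apply: le_trans (lerD (ler_normB _ _) sp) _.
  have sv2 : `|2^-1 * (wh - w0 - h / 2 / 2 * (f0 + fh))| <= C * eta.
    by rewrite normrM ger0_norm ?invr_ge0 //; lra.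
  apply: le_trans (lerD (lerD (ler_normD _ _) (hX _ _ sv2)) (lexx _)) _.
  apply: le_trans (lerD (lerD (lerD (ler_normB _ _) (h2X _ _ g)) (lexx _)) (lexx _)) _.
  have := hX _ _ ns; have := hX _ _ wn.
  lra.
lra.
Qed.

Definition err_const : R :=
  expR (4 * (1 + 3 * L) * T) * ((L + 4 * L * C + 8 * C) + 2 * err_defect * T).

Lemma err_bound k : (k <= n)%N -> par_err k + vel_err k <= err_const * eta.
Proof.
have k0 : 0 <= 1 + 3 * L by rewrite addr_ge0 ?mulr_ge0.
have d0 : 0 <= err_defect by rewrite addr_ge0 ?mulr_ge0.
have nT : n%:R * h <= T by have /andP[] := node_in (leqnn n).
move=> kn; have a0 j : (j <= n)%N -> 0 <= par_err j + vel_err j.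
  by move=> _; rewrite addr_ge0 ?normr_ge0.
have := discrete_gronwall h0' k0 (mulr_ge0 d0 eta0) rate nT a0 err_step kn.
move/le_trans; apply; rewrite /err_const -[leRHS]mulrA ler_wpM2l ?expR_ge0 //.
have st := err_start.
rewrite mulrDl; lra.
Qed.

Let err_const0 : 0 <= err_const.
Proof.
rewrite mulr_ge0 ?expR_ge0 // addr_ge0 //; first by rewrite !addr_ge0 ?mulr_ge0.
by rewrite !mulr_ge0 // addr_ge0 ?mulr_ge0.
Qed.

Definition total_const : R := 4 * err_const + 12 * L * (err_const + 2 * C) + L + 20 * C + 6 * L * C.

Let Ceps : C * eps <= C * eta. Proof. by rewrite ler_wpM2l. Qed.
Let Ceta : 0 <= C * eta. Proof. by rewrite mulr_ge0. Qed.
Let Leta : 0 <= L * eta. Proof. by rewrite mulr_ge0. Qed.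
Let LCeta : 0 <= L * C * eta. Proof. by rewrite !mulr_ge0. Qed.
Let Geta : 0 <= err_const * eta. Proof. exact: mulr_ge0 err_const0 eta0. Qed.
Let LGeta : 0 <= L * err_const * eta.
Proof. exact: mulr_ge0 (mulr_ge0 L0 err_const0) eta0. Qed.
Let pe k : 0 <= par_err k. Proof. exact: normr_ge0. Qed.
Let ve k : 0 <= vel_err k. Proof. exact: normr_ge0. Qed.

Lemma half_position_error k : (k <= n)%N -> enorm (m k - x (half k)) <= total_const * eta.
Proof.
move=> kn; apply: le_trans (midpt_err kn) _; have := err_bound kn; have := ve k.
by move: Ceps Ceta Leta LCeta Geta LGeta; rewrite /total_const; lra.
Qed.

Lemma half_velocity_error_W k : (k <= n)%N ->
  `|u k - W (half k)| <= (err_const + C) * eta.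
Proof.
move=> kn; have := ns_near NS kn; have := err_bound kn; have := pe k.
have := ler_normB (U k - W (half k)) (U k - u k).
rewrite (_ : U k - W (half k) - (U k - u k) = u k - W (half k)); last by ring.
by rewrite -/(vel_err k); move: Ceps; lra.
Qed.

Lemma half_velocity_error k : (k <= n)%N ->
  `|u k - dotv b (v (half k))| <= total_const * eta.
Proof.
move=> kn; have := half_velocity_error_W kn; have := slow_near SE (half_in kn).
have := ler_normD (u k - W (half k)) (W (half k) - dotv b (v (half k))).
rewrite subrKA.
by move: Ceps Ceta Leta LCeta Geta LGeta; rewrite /total_const; lra.
Qed.

Section Node.
Variable k : nat.
Hypothesis kn : (k <= n)%N.

Let ht : half k - node k = h / 2. Proof. by rewrite half_node addrAC subrr add0r. Qed.
Let h21 : h / 2 <= 1. Proof. by move: h1 h0'; lra. Qed.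
Let small_eta : C * (eps + (h / 2) ^+ 2) * (h / 2) <= C * eta / 2.
Proof.
have : C * (eps + (h / 2) ^+ 2) <= C * eta.
  by rewrite ler_wpM2l // lerD2l lerXn2r ?nnegrE ?divr_ge0 //; move: h0'; lra.
have : 0 <= C * (eps + (h / 2) ^+ 2) by rewrite mulr_ge0 ?addr_ge0 ?exprn_ge0 ?divr_ge0.
move: (C * (eps + (h / 2) ^+ 2)) => p p0 pe'.
by have : p * h <= p by [rewrite ler_piMr]; lra.
Qed.

Let par_half : `|dotv b (x (half k)) - dotv b (x (node k))
  - h / 2 / 2 * (W (node k) + W (half k))| <= C * eta.
Proof.
have [n0 _] := andP (node_in kn); have [_ hT] := andP (half_in kn).
have sp := slow_par SE n0 (node_half k) hT; rewrite ht in sp.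
by apply: le_trans (sp h21 smallh) _; move: small_eta Ceta; lra.
Qed.

Let vel_half : `|W (half k) - W (node k)
  - h / 2 / 2 * (f (x (node k)) + f (x (half k)))| <= C * eta.
Proof.
have [n0 _] := andP (node_in kn); have [_ hT] := andP (half_in kn).
have sp := slow_vel SE n0 (node_half k) hT; rewrite ht in sp.
by apply: le_trans (sp h21 smallh) _; move: small_eta Ceta; lra.
Qed.

(** The estimates at the integer times follow by going back half a step. *)
Lemma node_position_error : enorm (xs k - x (node k)) <= total_const * eta.
Proof.
have nT := node_in kn; have hT := half_in kn.
have pp : enorm (perp b (xs k - x (node k))) <= 3 * C * eps.
  have p1 := ns_perp NS kn; have p2 := slow_perp SE nT; have p3 := ns_perp_incr NS kn.
  have p4 : enorm (perp b (m k - xs k)) <= C * eps / 2.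
    by rewrite midpt_sub_l perpZ enormZ ger0_norm ?invr_ge0 // mulrC ler_wpM2r ?invr_ge0.
  rewrite (_ : xs k - x (node k) = - (m k - xs k) + (m k - x (node k))); last first.
    by rewrite opprB subrKA.
  rewrite perpD perpN [perp b (m k - x _)]perpB.
  rewrite enormBC in p2.
  have := enorm_dist (perp b (m k)) (perp b (x 0)) (perp b (x (node k))).
  have := enormD (- perp b (m k - xs k)) (perp b (m k) - perp b (x (node k))).
  by rewrite enormN; have : 0 <= C * eps by [rewrite mulr_ge0]; lra.
have dE : dotv b (xs k) = dotv b (m k) - h / 2 * u k.
  rewrite -[m k](subrK (xs k)) midpt_sub_l dotvDr dotvZr /par_speed.
  by move: (dotv b (d k)) => p; field; rewrite gt_eqF.
have hX (X B : R) : `|X| <= B -> `|h / 2 * X| <= B.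
  move=> XB; rewrite normrM ger0_norm ?divr_ge0 //.
  by apply: le_trans XB; rewrite ler_piMl.
have h2f : `|h ^+ 2 / 16 * (f (x (node k)) + f (x (half k)))| <= L * eta.
  rewrite normrM ger0_norm ?divr_ge0 ?exprn_ge0 //.
  apply: (@le_trans _ _ (h ^+ 2 / 16 * (2 * L))).
    rewrite ler_wpM2l ?divr_ge0 ?exprn_ge0 // (le_trans (ler_normD _ _)) //.
    by have := force_exact_le nT; have := force_exact_le hT; lra.
  have : L * h ^+ 2 <= L * eta by rewrite ler_wpM2l.
  by have : 0 <= L * h ^+ 2 by [rewrite mulr_ge0 ?exprn_ge0]; lra.
have par : `|dotv b (xs k) - dotv b (x (node k))| <=
    par_err k + (err_const + C) * eta + C * eta + C * eta + L * eta.
  have vh2 : `|2^-1 * (W (half k) - W (node k)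
      - h / 2 / 2 * (f (x (node k)) + f (x (half k))))| <= C * eta.
    by rewrite normrM ger0_norm ?invr_ge0 //; move: vel_half Ceta; lra.
  rewrite dE (_ : _ - _ = (dotv b (m k) - dotv b (x (half k)))
    - h / 2 * (u k - W (half k)) + (dotv b (x (half k)) - dotv b (x (node k))
      - h / 2 / 2 * (W (node k) + W (half k)))
    - h / 2 * (2^-1 * (W (half k) - W (node k)
      - h / 2 / 2 * (f (x (node k)) + f (x (half k)))))
    - h ^+ 2 / 16 * (f (x (node k)) + f (x (half k)))); last first.
    move: (dotv b (m k)) (dotv b (x (half k))) (dotv b (x (node k))) (u k) => p1 p2 p3 p4.
    by move: (W (half k)) (W (node k)) (f (x (node k))) (f (x (half k))) => p5 p6 p7 p8; field.
  apply: le_trans (ler_normB _ _) (lerD _ h2f).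
  apply: le_trans (ler_normB _ _) (lerD _ (hX _ _ vh2)).
  apply: le_trans (ler_normD _ _) (lerD _ par_half).
  apply: le_trans (ler_normB _ _) (lerD (lexx _) (hX _ _ (half_velocity_error_W kn))).
apply: le_trans (enorm_par_perp b1 _) _; rewrite dotvBr.
have := err_bound kn; have := ve k; move: par pp.
by move: Ceps Ceta Leta LCeta Geta LGeta; rewrite /total_const; lra.
Qed.

Lemma node_velocity_error : `|dotv b (vs k) - dotv b (v (node k))| <= total_const * eta.
Proof.
have nT := node_in kn; have hT := half_in kn.
have kv := ns_vs NS kn; have wn := slow_near SE nT.
have hw := half_velocity_error_W kn; have f1 := force_err kn.
have f2 : `|f (x (half k)) - f (x (node k))| <= 3 * L * (C * h).
  have mv := exact_half_move kn; have Ch : 0 <= C * h by rewrite mulr_ge0.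
  apply: le_trans (force_lip (xK nT) (self_near _) _) _.
    by apply: le_trans mv _; move: small1 rho0; lra.
  by rewrite ler_wpM2l ?mulr_ge0 // (le_trans mv) //; lra.
have g : `|h / 2 * (f (m k) - 2^-1 * (f (x (node k)) + f (x (half k))))| <=
    3 * L * (par_err k + 2 * C * eps) + 3 * (L * C * eta).
  rewrite normrM ger0_norm ?divr_ge0 //.
  have : `|f (m k) - 2^-1 * (f (x (node k)) + f (x (half k)))| <=
      3 * L * (par_err k + 2 * C * eps) + 3 * L * (C * h).
    have Y0 : 0 <= 3 * L * (C * h) by rewrite !mulr_ge0.
    move: f1 f2; rewrite !ler_norml => /andP[? ?] /andP[? ?].
    by apply/andP; split; lra.
  have X0 : 0 <= 3 * L * (par_err k + 2 * C * eps) by rewrite !mulr_ge0 ?addr_ge0 ?mulr_ge0.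
  move=> /(ler_wpM2l (divr_ge0 h0' (ler0n _ 2))) /le_trans; apply.
  rewrite mulrDr lerD //; first by rewrite ler_piMl.
  have : L * C * h ^+ 2 <= L * C * eta by rewrite ler_wpM2l ?mulr_ge0.
  by move: LCeta; lra.
rewrite (_ : dotv b (vs k) - _ = (dotv b (vs k) - (u k - h / 2 * f (m k)))
  + (u k - W (half k)) + (W (half k) - W (node k)
    - h / 2 / 2 * (f (x (node k)) + f (x (half k))))
  + (W (node k) - dotv b (v (node k)))
  - h / 2 * (f (m k) - 2^-1 * (f (x (node k)) + f (x (half k))))); last first.
  move: (dotv b (vs k)) (dotv b (v (node k))) (u k) (f (m k)) => p1 p2 p3 p4.
  by move: (W (half k)) (W (node k)) (f (x (node k))) (f (x (half k))) => p5 p6 p7 p8; field.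
apply: le_trans (ler_normB _ _) _; apply: le_trans (lerD (ler_normD _ _) g) _.
apply: le_trans (lerD (lerD (ler_normD _ _) wn) (lexx _)) _.
apply: le_trans (lerD (lerD (lerD (ler_normD _ _) vel_half) (lexx _)) (lexx _)) _.
have Lpe : L * par_err k <= L * err_const * eta.
  by rewrite -mulrA ler_wpM2l //; have := err_bound kn; have := ve k; lra.
have LCe : L * (C * eps) <= L * (C * eta) by rewrite ler_wpM2l.
by move: Ceps Ceta Leta LCeta Geta LGeta; rewrite /total_const; lra.
Qed.

End Node.

End Comparison.

(** * Global error *)

Section GlobalError.
Variable R : realType.
Local Notation V := 'cV[R]_3.

Lemma slow_motionW (T rho eps C C' : R) (b : V) (F : V -> V) (x v : R -> V) (W : R -> R) :
  0 <= eps -> C <= C' -> slow_motion T rho eps C b F x v W ->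
  slow_motion T rho eps C' b F x v W.
Proof.
move=> e0 CC S.
have e2 (r : R) : 0 <= eps + r ^+ 2 by rewrite addr_ge0 ?sqr_ge0.
have small (s t : R) : s <= t -> C' * (t - s + eps) <= rho -> C * (t - s + eps) <= rho.
  by move=> st; apply: le_trans; rewrite ler_wpM2r // addr_ge0 ?subr_ge0.
split.
- by move=> t tT; apply: le_trans (slow_perp S tT) _; rewrite ler_wpM2r.
- by move=> t tT; apply: le_trans (slow_near S tT) _; rewrite ler_wpM2r.
- move=> s t s0 st tT; apply: le_trans (slow_lip S s0 st tT) _.
  by rewrite ler_wpM2r ?subr_ge0.
- move=> s t s0 st tT st1 str.
  apply: le_trans (slow_par S s0 st tT st1 (small _ _ st str)) _.
  by rewrite ler_wpM2r ?subr_ge0 // ler_wpM2r.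
move=> s t s0 st tT st1 str.
apply: le_trans (slow_vel S s0 st tT st1 (small _ _ st str)) _.
by rewrite ler_wpM2r ?subr_ge0 // ler_wpM2r.
Qed.

Lemma numeric_slowW (C C' eps h : R) (b : V) (F : V -> V) (x0 v0 : V) (n : nat)
    (xs vs : nat -> V) (U : nat -> R) :
  0 <= eps -> 0 <= h -> C <= C' -> numeric_slow C eps h b F x0 v0 n xs vs U ->
  numeric_slow C' eps h b F x0 v0 n xs vs U.
Proof.
move=> e0 h0 CC S; have e2 : 0 <= eps + h ^+ 2 by rewrite addr_ge0 ?sqr_ge0.
split.
- by move=> k kn; apply: le_trans (ns_incr S kn) _; rewrite ler_wpM2r.
- by move=> k kn; apply: le_trans (ns_perp_incr S kn) _; rewrite ler_wpM2r.
- by move=> k kn; apply: le_trans (ns_perp S kn) _; rewrite ler_wpM2r.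
- by move=> k kn; apply: le_trans (ns_near S kn) _; rewrite ler_wpM2r.
- move=> k kn; apply: le_trans (ns_step S kn) _.
  by rewrite ler_wpM2r // mulr_ge0.
- by apply: le_trans (ns_start S) _; rewrite ler_wpM2r.
by move=> k kn; apply: le_trans (ns_vs S kn) _; rewrite ler_wpM2r.
Qed.

Lemma is_fviW (eps h : R) (b : V) (A1 F : V -> V) (x0 v0 : V) (j n : nat)
    (xs vs : nat -> V) : (j <= n)%N ->
  is_fvi eps b A1 F h x0 v0 n xs vs -> is_fvi eps b A1 F h x0 v0 j xs vs.
Proof.
move=> jn [i0 st sp ve]; split=> // k.
  by move=> /andP[k0 kj]; apply: sp; rewrite k0 (leq_trans kj).
by move=> kj; apply: ve; exact: leq_trans kj jn.
Qed.

Lemma fvi_par_speed (eps h : R) (b : V) (A1 F : V -> V) (x0 v0 : V) (n k : nat)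
    (xs vs : nat -> V) : enorm b = 1 -> (k <= n)%N ->
  is_fvi eps b A1 F h x0 v0 n xs vs ->
  dotv b (mid (vs k) (vs k.+1)) = par_speed h b xs k.
Proof.
by move=> b1 kn [_ _ _ ve]; rewrite (ve k kn) Phi_par // dotvZr mulrC.
Qed.

(** All errors, in the form [C * (eps + h ^+ 2)] that covers both regimes. *)
Definition global_error (C eps h : R) (b : V) (x v : R -> V) (n : nat)
    (xs vs : nat -> V) : Prop :=
  [/\ enorm (mid (xs n) (xs n.+1) - x ((n%:R + 2^-1) * h)) <= C * (eps + h ^+ 2),
      `|dotv b (mid (vs n) (vs n.+1)) - dotv b (v ((n%:R + 2^-1) * h))|
        <= C * (eps + h ^+ 2),
      enorm (xs n - x (n%:R * h)) <= C * (eps + h ^+ 2) &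
      `|dotv b (vs n) - dotv b (v (n%:R * h))| <= C * (eps + h ^+ 2)].

Section Fixed.
Variables (T Chat c0 rho L : R).
Hypotheses (T0 : 0 < T) (Ch0 : 0 <= Chat) (c00 : 0 < c0) (rho0 : 0 < rho) (L0 : 0 <= L).

Record problem eps K b A1 B1 F x v h n xs vs : Prop := Problem {
  pb_exact : exact_setting T Chat rho L eps K b B1 F x v;
  pb_A1 : smooth_bound (closed_nbhd K rho) L 3 A1;
  pb_curl : forall y, B1 y = curl A1 y;
  pb_h : 0 < h;
  pb_sin : c0 <= `|sin (h / (2 * eps))|;
  pb_cos : c0 <= `|cos (h / (2 * eps))|;
  pb_fvi : is_fvi eps b A1 F h (x 0) (v 0) n xs vs;
  pb_step : step_within rho n xs;
  pb_time : (n%:R + 2^-1) * h <= T }.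

Lemma problem_numeric eps K b A1 B1 F x v h n xs vs (j : nat) :
  problem eps K b A1 B1 F x v h n xs vs -> (j <= n)%N ->
  (forall k, (k <= j)%N -> enorm (xs k - x (k%:R * h)) <= rho / 2) ->
  numeric_setting T Chat c0 rho L eps h K b A1 B1 F (x 0) (v 0) j xs vs.
Proof.
move=> P jn near; have E := pb_exact P; have h0 := pb_h P.
have jT : j%:R * h <= T.
  apply: le_trans (pb_time P); rewrite ler_pM2r //.
  by have : (j%:R : R) <= n%:R; [rewrite ler_nat|lra].
have v0 : enorm (v 0) <= Chat by exact: exact_v0 E.
split=> //.
- exact: exact_eps E.
- exact: exact_b E.
- exact: pb_sin P.
- exact: pb_cos P.
- exact: pb_A1 P.
- exact: exact_B1 E.
- exact: exact_F E.
- exact: pb_curl P.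
- exact: is_fviW jn (pb_fvi P).
- by move=> k kj; apply: (pb_step P); exact: leq_trans kj jn.
move=> k kj; exists (x (k%:R * h)); last exact: near.
apply: (exact_K E); rewrite mulr_ge0 ?(ltW h0) //= (le_trans _ jT) //.
by rewrite ler_pM2r // ler_nat.
Qed.

(** The estimates hold as long as the numerical solution has stayed near [K];
    they in turn keep it near [K] for one more step. *)
Lemma error_small_steps : exists C h0 : R, [/\ 0 < C, 0 < h0 &
  forall eps K b A1 B1 F x v h n xs vs,
    problem eps K b A1 B1 F x v h n xs vs -> h <= h0 ->
    global_error C eps h b x v n xs vs].
Proof.
have [C1 C10 exactC] := exact_slow_motion rho T0 Ch0 L0.
have [C2 [h1 [C20 h10 numC]]] := numeric_slow_motion T0 Ch0 c00 L0.
pose C := C1 + C2; have C0 : 0 <= C by rewrite addr_ge0 // ltW.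
have CC1 : C1 <= C by rewrite lerDl ltW.
have CC2 : C2 <= C by rewrite lerDr ltW.
clearbody C.
pose G := 1 + `|total_const T L C|.
have G0 : 0 < G by rewrite ltr_pwDl.
have GE : total_const T L C <= G by rewrite ler_wpDl // ler_norm.
pose q := 1 + (2 * c0)^-1.
have q0 : 0 < q by rewrite ltr_pwDl // invr_ge0 mulr_ge0 // ltW.
have qE : q = 1 + (2 * c0)^-1 by [].
clearbody q G.
pose Z := h1^-1 + q + 2 * (1 + 3 * L) + (C * q + G * q + 2 * C) * 2 / rho.
have i1 : 0 < h1^-1 by rewrite invr_gt0.
have i2 : 0 <= (C * q + G * q + 2 * C) * 2 / rho.
  by rewrite divr_ge0 ?(ltW rho0) // mulr_ge0 // !addr_ge0 ?mulr_ge0 // ltW.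
have i3 : 0 < 2 * (1 + 3 * L) by rewrite mulr_gt0 // ltr_pwDl // mulr_ge0.
have Z0 : 0 < Z by rewrite /Z; lra.
exists G, Z^-1; split=> // [|eps K b A1 B1 F x v h n xs vs P hZ]; first by rewrite invr_gt0.
have E := pb_exact P; have h0 := pb_h P; have e0 := exact_eps E; have b1 := exact_b E.
have hZ1 : h * Z <= 1 by rewrite -ler_pdivlMr // div1r.
have part (w : R) : w <= Z -> h * w <= 1.
  by move=> wZ; apply: le_trans hZ1; rewrite ler_pM2l.
have hh1 : h <= h1 by rewrite -[h1]invrK -div1r ler_pdivlMr // part // /Z; lra.
have hq : h * q <= 1 by apply: part; rewrite /Z; lra.
have rate : 2 * (h * (1 + 3 * L)) <= 1.
  by rewrite mulrCA; apply: part; rewrite /Z; lra.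
have hrho : h * (C * q + G * q + 2 * C) <= rho / 2.
  rewrite ler_pdivlMr // -[rho]mul1r -ler_pdivrMr // -!mulrA; apply: part.
  by rewrite mulrA /Z; lra.
have xs0 : xs 0%N = x 0 by have [[]] := pb_fvi P.
have half_rho : 0 <= rho / 2 by rewrite divr_ge0 // ltW.
have near0 k : (k <= 0)%N -> enorm (xs k - x (k%:R * h)) <= rho / 2.
  by rewrite leqn0 => /eqP ->; rewrite xs0 mul0r subrr enorm0.
have eh : eps <= h * (2 * c0)^-1.
  have := nonres_eps_le (problem_numeric P (leq0n n) near0).
  by rewrite ler_pdivlMr ?mulr_gt0 // mulrC.
have hq' : h * q = h + h * (2 * c0)^-1 by rewrite qE mulrDr mulr1.
have ih : 0 <= h * (2 * c0)^-1 by rewrite mulr_ge0 ?invr_ge0 ?mulr_ge0 // ltW.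
have e1 : eps <= 1 by lra.
have h_1 : h <= 1 by lra.
have eta_h : eps + h ^+ 2 <= h * q.
  have : h ^+ 2 <= h by rewrite expr2 ler_piMr // ltW.
  lra.
have eta0 : 0 <= eps + h ^+ 2 by rewrite addr_ge0 ?sqr_ge0 // ltW.
have small : C * (h + eps) <= rho / 2.
  have : C * (h + eps) <= C * (h * q) by rewrite ler_wpM2l //; lra.
  have : 0 <= h * (G * q) by rewrite !mulr_ge0 // ltW.
  have : 0 <= h * C by rewrite mulr_ge0 // ltW.
  lra.
have SE := slow_motionW (ltW e0) CC1 (exactC _ _ _ _ _ _ _ E e1).
have timej j : (j <= n)%N -> (j%:R + 2^-1) * h <= T.
  move=> jn; apply: le_trans (pb_time P); rewrite ler_pM2r // lerD2r ler_nat.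
  exact: jn.
have slow j : (j <= n)%N ->
    (forall k, (k <= j)%N -> enorm (xs k - x (k%:R * h)) <= rho / 2) ->
    numeric_slow C eps h b F (x 0) (v 0) j xs vs (par_slow eps h b B1 xs).
  move=> jn near; apply: numeric_slowW (ltW e0) (ltW h0) CC2 _.
  exact: numC (problem_numeric P jn near) hh1.
have FB := exact_F E; have xK := exact_K E; have T1 := ltW T0; have e0' := ltW e0.
have near j : (j <= n)%N -> forall k, (k <= j)%N -> enorm (xs k - x (k%:R * h)) <= rho / 2.
  elim: j => [_|j IH jn]; first exact: near0.
  have jn' := ltnW jn; have nearj := IH jn'; have NS := slow j jn' nearj.
  move=> k; rewrite leq_eqVlt => /predU1P[->|]; last exact: nearj.
  have err := node_position_error SE NS FB xK b1 C0 T1 e0' h0 h_1 xs0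
    nearj small rate (timej j jn') (leqnn j).
  have tj : 0 <= j%:R * h by rewrite mulr_ge0 // ltW.
  have tjj : j%:R * h <= j.+1%:R * h by rewrite ler_pM2r // ler_nat.
  have tT : j.+1%:R * h <= T.
    apply: le_trans (timej _ jn); rewrite ler_pM2r //.
    by move: (j.+1%:R : R) => w; lra.
  have mv := slow_lip SE tj tjj tT; have ic := ns_incr NS (leqnn j).
  rewrite (_ : j.+1%:R * h - j%:R * h = h) in mv; last by rewrite -(natr1 j); ring.
  have d1 := enorm_dist (xs j.+1) (xs j) (x (j.+1%:R * h)).
  have d2 := enorm_dist (xs j) (x (j%:R * h)) (x (j.+1%:R * h)).
  rewrite [enorm (x (j%:R * h) - _)]enormBC in d2.
  have Gerr : total_const T L C * (eps + h ^+ 2) <= G * (h * q).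
    apply: (@le_trans _ _ (G * (eps + h ^+ 2))); first by rewrite ler_wpM2r.
    by rewrite ler_wpM2l // ltW.
  have Cq : 0 <= h * (C * q) by rewrite !mulr_ge0 // ltW.
  rewrite -/(incr xs j) in d1.
  lra.
have NS := slow n (leqnn n) (near n (leqnn n)).
have nearn := near n (leqnn n); have timen := pb_time P.
have Gtot (X : R) : X <= total_const T L C * (eps + h ^+ 2) -> X <= G * (eps + h ^+ 2).
  by move/le_trans; apply; rewrite ler_wpM2r.
split; apply: Gtot.
- have := half_position_error SE NS FB xK b1 C0 T1 e0' h0 h_1 xs0 nearn small rate timen
    (leqnn n).
  exact.
- rewrite (fvi_par_speed b1 (leqnn n) (pb_fvi P)).
  have := half_velocity_error SE NS FB xK b1 C0 T1 e0' h0 h_1 xs0 nearn small rate timen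
    (leqnn n).
  exact.
- have := node_position_error SE NS FB xK b1 C0 T1 e0' h0 h_1 xs0 nearn small rate timen
    (leqnn n).
  exact.
have := node_velocity_error SE NS FB xK b1 C0 T1 e0' h0 h_1 xs0 nearn small rate timen
    (leqnn n).
  exact.
Qed.

(** For step sizes bounded below, the number of steps is bounded, and so is the
    distance that steps of bounded length can reach. *)
Lemma error_large_steps (h0 : R) : 0 < h0 -> exists2 C : R, 0 < C &
  forall eps K b A1 B1 F x v h n xs vs,
    problem eps K b A1 B1 F x v h n xs vs -> h0 < h ->
    global_error C eps h b x v n xs vs.
Proof.
move=> h00; pose Vb := speed_bound T Chat L.
have T1 := ltW T0; have r1 := ltW rho0.
have Vb0 : 0 <= Vb by rewrite addr_ge0 // !mulr_ge0.
have EV : speed_bound T Chat L = Vb by [].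
pose N := T / h0; have N0 : 0 <= N by rewrite divr_ge0 // ltW.
have EN : N = T / h0 by [].
clearbody Vb N.
pose X := (N + 1) * rho + Vb * T + rho / h0 + Vb + Chat + 2 * N * (rho / h0).
have rh0 : 0 <= rho / h0 by rewrite divr_ge0 // ltW.
have Nr : 0 <= N * rho by rewrite mulr_ge0.
have VT : 0 <= Vb * T by rewrite mulr_ge0.
have Nrh : 0 <= N * (rho / h0) by rewrite mulr_ge0.
have X0 : 0 < X by move: rho0 Ch0; rewrite /X; lra.
exists (X / h0 ^+ 2); first by rewrite divr_gt0 // exprn_gt0.
move=> eps K b A1 B1 F x v h n xs vs P hh.
have E := pb_exact P; have h_0 := pb_h P; have e0 := exact_eps E; have b1 := exact_b E.
have [_ _ _ ve] := pb_fvi P; have [[xs0 vs0] _ _ _] := pb_fvi P.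
have half_T : 0 <= (n%:R + 2^-1) * h <= T.
  by rewrite (pb_time P) mulr_ge0 ?addr_ge0 ?invr_ge0 // ltW.
have node_T : 0 <= n%:R * h <= T.
  rewrite mulr_ge0 ?(ltW h_0) //= (le_trans _ (pb_time P)) //.
  by rewrite ler_pM2r // lerDl invr_ge0.
have nN : n%:R <= N.
  have /andP[_ nT] := node_T; rewrite EN ler_pdivlMr //; apply: le_trans nT.
  by rewrite ler_wpM2l // ltW.
have incr_rho k : (k <= n)%N -> enorm (xs k.+1 - xs k) <= rho by exact: (pb_step P).
have pos k : (k <= n.+1)%N -> enorm (xs k - x 0) <= k%:R * rho.
  elim: k => [_|k IH kn]; first by rewrite xs0 subrr enorm0 mul0r.
  apply: le_trans (enorm_dist _ (xs k) _) _.
  by rewrite -natr1 mulrDl mul1r addrC lerD ?IH ?incr_rho // ltnW.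
have exact_pos t : 0 <= t <= T -> enorm (x t - x 0) <= Vb * T.
  move=> tT; have [t0 tT'] := andP tT.
  apply: le_trans (exact_lip E (lexx 0) t0 tT') _.
  by rewrite subr0 EV ler_wpM2l.
have exact_vel t : 0 <= t <= T -> `|dotv b (v t)| <= Vb.
  by move=> tT; rewrite -EV (le_trans (normr_par b1 _)) // (speed_le E).
have speed k : (k <= n)%N -> `|par_speed h b xs k| <= rho / h0.
  move=> kn; rewrite /par_speed normrM normfV [`|h|]gtr0_norm //.
  rewrite ler_pM ?invr_ge0 ?(ltW h_0) //.
    by rewrite (le_trans (normr_par b1 _)) // incr_rho.
  by rewrite lef_pV2 ?posrE // ltW.
have vel k : (k <= n)%N -> `|dotv b (vs k)| <= Chat + 2 * k%:R * (rho / h0).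
  elim: k => [_|k IH kn].
    by rewrite vs0 mulr0 mul0r addr0 (le_trans (normr_par b1 _)) // (exact_v0 E).
  have kn' := ltnW kn; have := fvi_par_speed b1 kn' (pb_fvi P).
  have := speed k kn'; have := IH kn'; rewrite /mid dotvZr dotvDr -(natr1 k).
  move: (par_speed h b xs k) (dotv b (vs k)) (dotv b (vs k.+1)) (k%:R : R) => p q r w.
  move=> qw pr E1; have -> : r = 2 * p - q by rewrite -E1; field.
  apply: le_trans (ler_normB _ _) _; rewrite normrM ger0_norm //; lra.
have large (Y : R) : Y <= X -> Y <= X / h0 ^+ 2 * (eps + h ^+ 2).
  move=> YX; apply: le_trans YX _.
  rewrite mulrAC ler_pdivlMr ?exprn_gt0 // ler_pM2l //.
  apply: (@le_trans _ _ (h ^+ 2)); last by rewrite lerDr ltW.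
  by rewrite lerXn2r ?nnegrE ?ltW.
have nrho : n%:R * rho <= N * rho by rewrite ler_wpM2r.
have nrh : n%:R * (rho / h0) <= N * (rho / h0) by rewrite ler_wpM2r.
have dist (p q : V) (k l : R) : enorm (p - x 0) <= k -> enorm (q - x 0) <= l ->
    enorm (p - q) <= k + l.
  move=> pk ql; have := enorm_dist p (x 0) q; rewrite [enorm (x 0 - q)]enormBC; lra.
split; apply: large.
- have mm : enorm (mid (xs n) (xs n.+1) - x 0) <= (N + 1) * rho.
    have := enorm_dist (mid (xs n) (xs n.+1)) (xs n) (x 0); rewrite enorm_midl.
    have := incr_rho n (leqnn n); have := pos n (leqnSn n); rewrite mulrDl mul1r; lra.
  by have := dist _ _ _ _ mm (exact_pos _ half_T); move: rho0 Ch0; rewrite /X; lra.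
- rewrite (fvi_par_speed b1 (leqnn n) (pb_fvi P)).
  have := ler_normB (par_speed h b xs n) (dotv b (v ((n%:R + 2^-1) * h))).
  by have := speed n (leqnn n); have := exact_vel _ half_T; move: rho0 Ch0; rewrite /X; lra.
- by have := dist _ _ _ _ (pos n (leqnSn n)) (exact_pos _ node_T); move: rho0 Ch0; rewrite /X; lra.
have := ler_normB (dotv b (vs n)) (dotv b (v (n%:R * h))).
by have := vel n (leqnn n); have := exact_vel _ node_T; move: rho0 Ch0; rewrite /X; lra.
Qed.

Lemma error_all_steps : exists2 C : R, 0 < C &
  forall eps K b A1 B1 F x v h n xs vs,
    problem eps K b A1 B1 F x v h n xs vs -> global_error C eps h b x v n xs vs.
Proof.
have [C1 [h0 [C10 h00 small]]] := error_small_steps.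
have [C2 C20 large] := error_large_steps h00.
exists (C1 + C2) => [|eps K b A1 B1 F x v h n xs vs P]; first exact: addr_gt0.
have eta0 : 0 <= eps + h ^+ 2.
  by rewrite addr_ge0 ?sqr_ge0 // ltW // (exact_eps (pb_exact P)).
have W1 (X : R) : X <= C1 * (eps + h ^+ 2) -> X <= (C1 + C2) * (eps + h ^+ 2).
  by move/le_trans; apply; rewrite ler_wpM2r // lerDl ltW.
have W2 (X : R) : X <= C2 * (eps + h ^+ 2) -> X <= (C1 + C2) * (eps + h ^+ 2).
  by move/le_trans; apply; rewrite ler_wpM2r // lerDr ltW.
have [hh|hh] := leP h h0.
  by have [e1 e2 e3 e4] := small _ _ _ _ _ _ _ _ _ _ _ _ P hh; split; exact: W1.
by have [e1 e2 e3 e4] := large _ _ _ _ _ _ _ _ _ _ _ _ P hh; split; exact: W2.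
Qed.

End Fixed.

Lemma derivs_smooth_bound (D : set V) (L : nat -> R) (f : V -> V) :
  smooth f -> derivs_bounded_on D L f ->
  smooth_bound D (`|L 0%N| + `|L 1%N| + `|L 2%N| + `|L 3%N|) 3 f.
Proof.
move=> sf fL; split=> // s y s3 Dy; apply: le_trans (fL s y Dy) _.
have := (normr_ge0 (L 0%N), normr_ge0 (L 1%N), normr_ge0 (L 2%N), normr_ge0 (L 3%N)).
move=> -[[[? ?] ?] ?]; have := (ler_norm (L (size s))).
by case: (size s) s3 => [|[|[|[|//]]]] _; lra.
Qed.

End GlobalError.

Theorem theorem3p5 (R : realType) (T Chat c0 rho : R) (K : set 'cV[R]_3)
    (L : nat -> R)
    (hT : 0 < T) (hc0 : 0 < c0) (hrho : 0 < rho) (hK : compact K) :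
  exists Cstar cstar : R, [/\ 0 < Cstar, 0 < cstar &
  exists eps0 C : R, [/\ 0 < eps0, 0 < C &
  forall (eps : R) (B0 : 'cV[R]_3) (A1 B1 F : 'cV[R]_3 -> 'cV[R]_3)
    (x v : R -> 'cV[R]_3) (h : R) (N n : nat) (xs vs : nat -> 'cV[R]_3),
  0 < eps <= eps0 ->
  enorm B0 = 1 ->
  smooth A1 -> smooth B1 -> smooth F ->
  (forall y, B1 y = curl A1 y) ->
  (exists y z, B1 y <> B1 z) ->
  derivs_bounded_on (closed_nbhd K rho) L A1 ->
  derivs_bounded_on (closed_nbhd K rho) L B1 ->
  derivs_bounded_on (closed_nbhd K rho) L F ->
  is_solution eps B0 B1 F T x v ->
  enorm (x 0) <= Chat -> enorm (v 0) <= Chat ->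
  (forall t, 0 <= t <= T -> K (x t)) ->
  0 < h -> (1 <= N)%N -> nonresonant eps h c0 N ->
  is_fvi eps B0 A1 F h (x 0) (v 0) n xs vs ->
  step_within rho n xs ->
  let thalf := (n%:R + 2^-1) * h in
  let tn := n%:R * h in
  (thalf <= T ->
     (Cstar * eps < h ^+ 2 ->
        enorm (mid (xs n) (xs n.+1) - x thalf) <= C * h ^+ 2 /\
        enorm (Ppar B0 (mid (vs n) (vs n.+1)) - Ppar B0 (v thalf))
          <= C * h ^+ 2) /\
     (cstar * eps ^+ 2 <= h ^+ 2 <= Cstar * eps ->
        enorm (mid (xs n) (xs n.+1) - x thalf) <= C * eps /\
        enorm (Ppar B0 (mid (vs n) (vs n.+1)) - Ppar B0 (v thalf))
          <= C * eps)) /\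
  (n.+1%:R * h <= T ->
     (Cstar * eps < h ^+ 2 ->
        enorm (xs n - x tn) <= C * h ^+ 2 /\
        enorm (Ppar B0 (vs n) - Ppar B0 (v tn)) <= C * h ^+ 2) /\
     (cstar * eps ^+ 2 <= h ^+ 2 <= Cstar * eps ->
        enorm (xs n - x tn) <= C * eps /\
        enorm (Ppar B0 (vs n) - Ppar B0 (v tn)) <= C * eps))]].
Proof.
pose Lb := `|L 0%N| + `|L 1%N| + `|L 2%N| + `|L 3%N|.
have Lb0 : 0 <= Lb by rewrite !addr_ge0.
have [Ch0|Ch0] := leP 0 Chat; last first.
  exists 1, 1; split=> //; exists 1, 1; split=> // eps B0 A1 B1 F x v h N n xs vs.
  move=> _ _ _ _ _ _ _ _ _ _ _ x0; have := lt_le_trans Ch0 (enorm_ge0 (x 0)).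
  by rewrite ltNge x0.
have [C C0 err] := error_all_steps hT Ch0 hc0 hrho Lb0.
(* any threshold separates the regimes in which h ^+ 2 or eps dominates the sum *)
exists 1, 1; split=> //; exists 1, (2 * C); split=> //; first by rewrite mulr_gt0.
move=> eps B0 A1 B1 F x v h N n xs vs /andP[e0 _] b1 sA sB sF curlA _ bA bB bF sol _ v0 xK.
move=> h0 N1 nonres fvi step thalf tn.
have [sn cn] := nonres 1%N N1.
rewrite mul1r in sn cn.
have E : exact_setting T Chat rho Lb eps K B0 B1 F x v.
  by split=> //; exact: derivs_smooth_bound.
have all : thalf <= T -> global_error C eps h B0 x v n xs vs.
  move=> tT; apply: (err eps K B0 A1 B1 F x v h n xs vs).
  by split=> //; exact: derivs_smooth_bound.
have large (X : R) : X <= C * (eps + h ^+ 2) -> 1 * eps < h ^+ 2 -> X <= 2 * C * h ^+ 2.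
  rewrite mul1r => Xe eh; apply: le_trans Xe _.
  rewrite [2 * C]mulrC -mulrA ler_pM2l //; lra.
have small (X : R) : X <= C * (eps + h ^+ 2) -> h ^+ 2 <= 1 * eps -> X <= 2 * C * eps.
  rewrite mul1r => Xe eh; apply: le_trans Xe _.
  rewrite [2 * C]mulrC -mulrA ler_pM2l //; lra.
split=> tT.
  have [e1 e2 _ _] := all tT; rewrite enorm_Ppar //.
  by split=> [eh|/andP[_ eh]]; split; by [exact: large|exact: small].
have [_ _ e1 e2] : global_error C eps h B0 x v n xs vs.
  apply: all; apply: le_trans tT; rewrite /thalf ler_pM2r // -(natr1 n) lerD2l.
  by rewrite invf_le1 // ler1n.
rewrite enorm_Ppar //.
by split=> [eh|/andP[_ eh]]; split; by [exact: large|exact: small].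
Qed.
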